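(* For $i=1,2,\ldots$, $$\frac{W_{2i+1}(u)+(\frac z2-u-1)}{W_{2i-1}(u)+(\frac z2-u-1)}=\frac{(u+x_{2i})^2-1}{(u+x_{2i})^2}\cdot\frac{(u-x_{2i-1})^2}{(u-x_{2i-1})^2-1}$$ and $$\frac{W_{2i+2}(u)}{W_{2i}(u)}=\frac{(u+x_{2i+1})^2-1}{(u+x_{2i+1})^2}\cdot\frac{(u-x_{2i})^2}{(u-x_{2i})^2-1},$$ as identities of formal Laurent series in $u^{-1}$ with coefficients in $A_{2i}$ and $A_{2i+1}$ respectively.
   Context: Partition algebras. Let $z$ be an indeterminate, $R=\mathbb Z[z]$, $\mathbb F=\mathbb Q(z)$. For $r\ge1$ let $P_{2r}$ be the set of set partitions of $\{1,\dots,r,1',\dots,r'\}$ and $P_{2r-1}\subseteq P_{2r}$ those in which $r$ and $r'$ lie in the same block. $\mathcal A_{2r}$ is the free $R$-module on $P_{2r}$ with product $\rho_1\rho_2=z^c\,\rho_1\circ\rho_2$, where $\rho_1\circ\rho_2$ is obtained by placing the diagram of $\rho_1$ above that of $\rho_2$ (unprimed vertices are the top row), identifying bottom vertex $j'$ of $\rho_1$ with top vertex $j$ of $\rho_2$, and deleting the $c$ components lying entirely in the middle row. $\mathcal A_{2r-1}$ is the span of $P_{2r-1}$, $\mathcal A_0=R$, and $\mathcal A_{2r}\subseteq\mathcal A_{2r+1}$ by adding the block $\{r+1,(r+1)'\}$. Put $A_r=\mathcal A_r\otimes_R\mathbb F$. $s_i$ is the diagram of the transposition $(i,i+1)$; $e_{2i-1}$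 has singleton blocks $\{i\},\{i'\}$ and blocks $\{j,j'\}$ ($j\ne i$); $e_{2i}$ has the block $\{i,i+1,i',(i+1)'\}$ and blocks $\{j,j'\}$ ($j\neq i,i+1$). Jucys--Murphy elements. $L_1=0$, $L_2=e_1$, $\sigma_2=1$, $\sigma_3=s_1$; for $i\ge1$, $L_{2i+1}=-L_{2i}e_{2i}-e_{2i}L_{2i}+(z-L_{2i-1})e_{2i}+s_iL_{2i-1}s_i+\sigma_{2i}$ and $L_{2i+2}=-s_iL_{2i}e_{2i}-e_{2i}L_{2i}s_i+e_{2i}L_{2i}e_{2i+1}e_{2i}+s_iL_{2i}s_i+\sigma_{2i+1}$; for $i\ge2$, $\sigma_{2i}=s_{i-1}s_i\sigma_{2i-2}s_is_{i-1}+e_{2i-2}L_{2i-2}s_ie_{2i-2}s_i+s_ie_{2i-2}L_{2i-2}s_ie_{2i-2}-e_{2i-2}L_{2i-2}s_{i-1}e_{2i}e_{2i-1}e_{2i-2}-s_ie_{2i-2}e_{2i-1}e_{2i}s_{i-1}L_{2i-2}e_{2i-2}s_i$ and $\sigma_{2i+1}=s_{i-1}s_i\sigma_{2i-1}s_is_{i-1}+s_ie_{2i-2}L_{2i-2}s_ie_{2i-2}s_i+e_{2i-2}L_{2i-2}s_ie_{2i-2}-s_ie_{2i-2}L_{2i-2}s_{i-1}e_{2i}e_{2i-1}e_{2i-2}-e_{2i-2}e_{2i-1}e_{2i}s_{i-1}L_{2i-2}e_{2i-2}s_i$. One has $L_i\in\mathcal A_i$ and $L_i$ commutes with $\mathcal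 A_{i-1}$. Central series. Put $x_i=-\frac z2+L_i$ for $i\ge1$. For $i\ge0$ and $j\ge0$, $x_{i+1}^{(j)}$ denotes the (unique, central) element of $A_i$ determined by $x_{i+1}^{(j)}e_{i+1}=e_{i+1}(x_{i+1})^je_{i+1}$. Let $u$ be a formal variable and, for $i\ge0$, $$W_{2i+1}(u)=u^{-1}\sum_{j\ge0}x_{2i+1}^{(j)}u^{-j}\in A_{2i}[[u^{-1}]],\qquad W_{2i+2}(u)=\sum_{j\ge0}x_{2i+2}^{(j)}u^{-j}\in A_{2i+1}[[u^{-1}]].$$ All elements appearing in each displayed identity commute with one another and the denominators are invertible formal Laurent series in $u^{-1}$. *)

(* Defs.v *)
From HB Require Import structures.
From mathcomp Require Import all_boot all_order all_algebra.

Set Implicit Arguments.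
Unset Strict Implicit.
Unset Printing Implicit Defensive.

Import Order.TTheory GRing.Theory Num.Theory.
Local Open Scope ring_scope.

(* [inl j] is the top vertex j+1 and [inr j] the bottom vertex (j+1)'. *)
Definition vertex n := ('I_n + 'I_n)%type.

Definition diagram n := {P : {set {set vertex n}} | partition P [set: vertex n]}.
HB.instance Definition _ n := SubFinite.on (diagram n).

Definition same_block n (d : diagram n) : rel (vertex n) :=
  fun x y => y \in pblock (val d) x.

(* The locked definitions keep unification from enumerating set partitions. *)
HB.lock Definition fibres (T : eqType) n (f : vertex n -> T) : diagram n :=
  exist _ (preim_partition f [set: vertex n]) (preim_partitionP f _).

(* Vertices of the stacked diagrams: top row, middle row, bottom row. *)
Definition stack n := ('I_n + 'I_n + 'I_n)%type.

Definition upper n (v : vertex n) : stack n := inl v.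
Definition lower n (v : vertex n) : stack n :=
  match v with inl j => inl (inr j) | inr j => inr j end.
Definition outer n (v : vertex n) : stack n :=
  match v with inl j => inl (inl j) | inr j => inr j end.
Definition middle n : {set stack n} := [set inl (inr j) | j : 'I_n].

Definition glue n (d1 d2 : diagram n) : rel (stack n) := fun v w =>
  [exists x, exists y, [&& v == upper x, w == upper y & same_block d1 x y]]
  || [exists x, exists y, [&& v == lower x, w == lower y & same_block d2 x y]].

Definition component n (d1 d2 : diagram n) (v : stack n) : {set stack n} :=
  [set w | connect (glue d1 d2) v w].

HB.lock Definition compose n (d1 d2 : diagram n) : diagram n :=
  fibres (fun v => component d1 d2 (outer v)).

HB.lock Definition loops n (d1 d2 : diagram n) : nat :=
  #|[set C in [set component d1 d2 v | v : stack n] | C \subset middle n]|.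

Definition id_diagram n : diagram n :=
  fibres (fun v => match v with inl j => j | inr j => j end).

(* Two-colourings of the vertices that are constant on blocks; they separate
   diagrams, and the number of compatible colourings of the middle row computes
   [compose] and [loops] at once. *)
Section Colouring.
Variable n : nat.
Implicit Types (d : diagram n) (a b c : {ffun 'I_n -> bool}).

Definition join_col a b (v : vertex n) : bool :=
  match v with inl j => a j | inr j => b j end.

Definition proper d (f : vertex n -> bool) : bool :=
  [forall x, forall y, same_block d x y ==> (f x == f y)].

Lemma properP d f :
  reflect (forall x y, same_block d x y -> f x = f y) (proper d f).
Proof.
apply: (iffP forallP) => [H x y dxy|H x].
  by have /forallP/(_ y)/implyP/(_ dxy)/eqP := H x.
by apply/forallP => y; apply/implyP => /H ->.
Qed.

Lemma same_block_equiv d : {in [set: vertex n] & &, equivalence_rel (same_block d)}.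
Proof. exact: pblock_equivalence (valP d). Qed.

Lemma same_blockxx d x : same_block d x x.
Proof. by have [-> //] := @same_block_equiv d x x x (in_setT _) (in_setT _) (in_setT _). Qed.

Lemma same_block_left d x y z :
  same_block d x y -> same_block d x z = same_block d y z.
Proof. by have [_ H] := @same_block_equiv d x y z (in_setT _) (in_setT _) (in_setT _). Qed.

Lemma same_block_sym d x y : same_block d x y = same_block d y x.
Proof.
by apply/idP/idP => h; [rewrite -(same_block_left _ h)|rewrite -(same_block_left _ h)];
   rewrite same_blockxx.
Qed.

Lemma fibresE (T : eqType) (f : vertex n -> T) x y :
  same_block (fibres f) x y = (f x == f y).
Proof.
rewrite /same_block fibres.unlock /= /preim_partition pblock_equivalence_partition ?inE //.
by split=> // /eqP->.
Qed.

Lemma diagram_ext d1 d2 : same_block d1 =2 same_block d2 -> d1 = d2.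
Proof.
move=> E; apply: val_inj.
rewrite -(equivalence_partition_pblock (valP d1)).
rewrite -(equivalence_partition_pblock (valP d2)).
apply: eq_in_imset => x _; apply/setP => y; rewrite !inE.
exact: E.
Qed.

Lemma proper_eq d1 d2 :
  (forall a b, proper d1 (join_col a b) = proper d2 (join_col a b)) -> d1 = d2.
Proof.
suff sub e1 e2 : (forall a b, proper e1 (join_col a b) = proper e2 (join_col a b)) ->
    subrel (same_block e1) (same_block e2).
  move=> E; apply: diagram_ext => x y; apply/idP/idP; first exact: sub.
  by apply: sub => a b; rewrite E.
move=> E x y e1xy; pose f v := same_block e2 x v.
have jf : join_col [ffun j => f (inl j)] [ffun j => f (inr j)] =1 f.
  by case=> j; rewrite /= ffunE.
have := E [ffun j => f (inl j)] [ffun j => f (inr j)].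
suff -> : proper e2 (join_col [ffun j => f (inl j)] [ffun j => f (inr j)]).
  by move=> /properP/(_ x y e1xy); rewrite !jf /f same_blockxx => <-.
apply/properP => u v e2uv; rewrite !jf /f.
by rewrite ![same_block e2 x _]same_block_sym; apply: same_block_left.
Qed.

Definition join3 a b c (v : stack n) : bool :=
  match v with inl (inl j) => a j | inl (inr j) => b j | inr j => c j end.

Lemma join3_upper a b c v : join3 a b c (upper v) = join_col a b v.
Proof. by case: v. Qed.
Lemma join3_lower a b c v : join3 a b c (lower v) = join_col b c v.
Proof. by case: v. Qed.
Lemma join3_outer a b c v : join3 a b c (outer v) = join_col a c v.
Proof. by case: v. Qed.

Lemma glue_sym d1 d2 : symmetric (glue d1 d2).
Proof.
move=> v w; rewrite /glue; congr (_ || _); apply/idP/idP => /existsP[x /existsP[y]];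
  rewrite same_block_sym => /and3P[hv hw h]; apply/existsP; exists y;
  by apply/existsP; exists x; apply/and3P.
Qed.

Lemma gconnect_sym d1 d2 : connect_sym (glue d1 d2).
Proof. exact/sym_connect_sym/glue_sym. Qed.

Lemma componentP d1 d2 v w :
  reflect (component d1 d2 v = component d1 d2 w) (connect (glue d1 d2) v w).
Proof.
apply: (iffP idP) => [h|E].
  by apply/setP => t; rewrite !inE (same_connect (gconnect_sym d1 d2) h).
have : w \in component d1 d2 w by rewrite inE connect0.
by rewrite -E inE.
Qed.

Lemma proper_glueP d1 d2 a b c :
  reflect (forall v w, connect (glue d1 d2) v w -> join3 a b c v = join3 a b c w)
    (proper d1 (join_col a b) && proper d2 (join_col b c)).
Proof.
apply: (iffP andP) => [[/properP h1 /properP h2]|H].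
  have hg v w : glue d1 d2 v w -> join3 a b c v = join3 a b c w.
    case/orP => /existsP[x /existsP[y /and3P[/eqP-> /eqP->]]].
      by rewrite !join3_upper; apply: h1.
    by rewrite !join3_lower; apply: h2.
  move=> v w /connectP[p]; elim: p v => [|t p IH] v /= => [_ ->//|/andP[/hg ->]].
  exact: IH.
split; apply/properP => x y dxy.
  rewrite -!(join3_upper a b c); apply/H/connect1/orP; left.
  by apply/existsP; exists x; apply/existsP; exists y; rewrite !eqxx.
rewrite -!(join3_lower a b c); apply/H/connect1/orP; right.
by apply/existsP; exists x; apply/existsP; exists y; rewrite !eqxx.
Qed.

Definition midcomps d1 d2 : {set {set stack n}} :=
  [set C in [set component d1 d2 v | v : stack n] | C \subset middle n].

Lemma mem_midcomps d1 d2 v :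
  (component d1 d2 v \in midcomps d1 d2) = (component d1 d2 v \subset middle n).
Proof. by rewrite inE imset_f. Qed.

Lemma outerP v : (v \in middle n) || [exists x, v == outer x].
Proof.
case: v => [[j|j]|j].
- by apply/orP; right; apply/existsP; exists (inl j).
- by apply/orP; left; apply/imsetP; exists j.
- by apply/orP; right; apply/existsP; exists (inr j).
Qed.

Lemma outer_notin v : outer v \notin middle n.
Proof. by case: v => j; apply/imsetP => -[]. Qed.

Lemma card_middle d1 d2 a c :
  (\sum_b (proper d1 (join_col a b) && proper d2 (join_col b c)) =
   2 ^ loops d1 d2 * proper (compose d1 d2) (join_col a c))%N.
Proof.
rewrite loops.unlock -[X in (2 ^ X)%N]/#|midcomps d1 d2| -card_powerset.
rewrite -big_mkcond sum1dep_card /=.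
case: (boolP (proper _ _)) => [/properP Pac|nP]; last first.
  rewrite muln0; apply/eqP; rewrite cards_eq0; apply/eqP/setP => b.
  rewrite !inE; apply/proper_glueP => H; case/negP: nP; apply/properP => x y.
  rewrite compose.unlock fibresE => /eqP/componentP/H.
  by rewrite !join3_outer.
rewrite muln1.
have Pout x y : connect (glue d1 d2) (outer x) (outer y) -> join_col a c x = join_col a c y.
  by move=> h; apply: Pac; rewrite compose.unlock fibresE; apply/eqP/componentP.
pose mid j : stack n := inl (inr j).
pose col (S : {set {set stack n}}) v : bool :=
  if component d1 d2 v \in midcomps d1 d2 then component d1 d2 v \in S
  else [exists x, connect (glue d1 d2) v (outer x) && join_col a c x].
pose F (S : {set {set stack n}}) : {ffun 'I_n -> bool} := [ffun j => col S (mid j)].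
have colout S x : col S (outer x) = join_col a c x.
  rewrite /col mem_midcomps ifN; last first.
    by apply/negP => /subsetP/(_ (outer x)); rewrite inE connect0 (negbTE (outer_notin x)) => /(_ isT).
  apply/existsP/idP => [[y /andP[/Pout-> //]]|h].
  by exists x; rewrite connect0.
have colE S : join3 a (F S) c =1 col S.
  case=> [[j|j]|j] /=; last by rewrite (colout S (inr j)).
    by rewrite (colout S (inl j)).
  by rewrite ffunE.
have Finj : {in powerset (midcomps d1 d2) &, injective F}.
  have sub (S S' : {set {set stack n}}) : S \subset midcomps d1 d2 -> F S = F S' -> S \subset S'.
    move=> SM ES; apply/subsetP => C CS; have CM := subsetP SM _ CS.
    have := CM; rewrite inE => /andP[/imsetP[v _ EC] Cmid].
    have vm : v \in middle n by apply: (subsetP Cmid); rewrite EC inE connect0.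
    have [j _ Ev] := imsetP vm.
    move: ES => /ffunP/(_ j); rewrite !ffunE /col /mid -Ev -EC CM CS.
    by move=> <-.
  move=> S S'; rewrite !inE => SM SM' E; apply/eqP; rewrite eqEsubset.
  by rewrite (sub S S') // (sub S' S).
rewrite -(card_in_imset Finj); apply: eq_card => b; apply/idP/imsetP.
  rewrite inE => /proper_glueP H.
  pose S := [set C in midcomps d1 d2 | [forall v in C, join3 a b c v]].
  exists S; first by rewrite inE; apply/subsetP => C; rewrite inE => /andP[].
  apply/ffunP => j; rewrite ffunE /col.
  case: ifPn => [CM|]; last first.
    rewrite mem_midcomps => /subsetPn[w]; rewrite inE => cw wm.
    have := outerP w; rewrite (negbTE wm) /= => /existsP[x /eqP Ew].
    rewrite -[b j]/(join3 a b c (mid j)) (H _ _ cw) Ew join3_outer.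
    apply/idP/existsP => [h|[y /andP[cy]]]; first by exists x; rewrite -Ew cw.
    have : connect (glue d1 d2) (outer x) (outer y).
      by rewrite -Ew -(same_connect (gconnect_sym d1 d2) cw).
    by move/Pout->.
  rewrite inE CM /=; apply/idP/forallP => [bj v|/(_ (mid j))].
    by apply/implyP; rewrite inE => /H <-.
  by rewrite inE connect0 /=.
move=> [S _ ->]; rewrite inE; apply/proper_glueP => v w cvw.
rewrite !colE /col; have := cvw => /componentP ->.
case: ifP => // _; apply: eq_existsb => x.
by rewrite (same_connect (gconnect_sym d1 d2) cvw).
Qed.

Definition cst_col : {ffun 'I_n -> bool} := [ffun=> true].

Lemma proper_cst d : proper d (join_col cst_col cst_col).
Proof. by apply/properP => -[x|x] [y|y]; rewrite /= !ffunE. Qed.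

Lemma proper_id a b : proper (id_diagram n) (join_col a b) = (a == b).
Proof.
apply/properP/eqP => [H|-> x y].
  apply/ffunP => j; apply: (H (inl j) (inr j)).
  by rewrite fibresE.
rewrite fibresE => /eqP E.
by case: x y E => [x|x] [y|y] /= ->.
Qed.

Lemma pow2_eq k l (F G : {ffun 'I_n -> bool} -> {ffun 'I_n -> bool} -> bool) :
  F cst_col cst_col -> G cst_col cst_col ->
  (forall a c, 2 ^ k * F a c = 2 ^ l * G a c)%N -> k = l /\ F =2 G.
Proof.
move=> F1 G1 H; have := H cst_col cst_col; rewrite F1 G1 !muln1 => /eqP.
rewrite eqn_exp2l // => /eqP Ekl; split=> // a c; have := H a c.
by rewrite Ekl => /eqP; rewrite eqn_pmul2l ?expn_gt0 //; case: (F a c); case: (G a c).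
Qed.

Lemma compose1d d : compose (id_diagram n) d = d /\ loops (id_diagram n) d = 0%N.
Proof.
have [a c|-> H] := @pow2_eq (loops (id_diagram n) d) 0
  (fun a c => proper (compose (id_diagram n) d) (join_col a c))
  (fun a c => proper d (join_col a c)) (proper_cst _) (proper_cst _).
  rewrite -card_middle mul1n (bigD1 a) //= proper_id eqxx big1 ?addn0 //.
  by move=> b /negbTE; rewrite proper_id eq_sym => ->.
by split=> //; apply: proper_eq.
Qed.

Lemma composed1 d : compose d (id_diagram n) = d /\ loops d (id_diagram n) = 0%N.
Proof.
have [a c|-> H] := @pow2_eq (loops d (id_diagram n)) 0
  (fun a c => proper (compose d (id_diagram n)) (join_col a c))
  (fun a c => proper d (join_col a c)) (proper_cst _) (proper_cst _).
  rewrite -card_middle mul1n (bigD1 c) //= proper_id eqxx andbT big1 ?addn0 //.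
  by move=> b /negbTE; rewrite proper_id andbC => ->.
by split=> //; apply: proper_eq.
Qed.

Lemma composeA d1 d2 d3 :
  compose d1 (compose d2 d3) = compose (compose d1 d2) d3 /\
  (loops d2 d3 + loops d1 (compose d2 d3) =
   loops d1 d2 + loops (compose d1 d2) d3)%N.
Proof.
have [a e|-> H] := @pow2_eq (loops d2 d3 + loops d1 (compose d2 d3))
  (loops d1 d2 + loops (compose d1 d2) d3)
  (fun a c => proper (compose d1 (compose d2 d3)) (join_col a c))
  (fun a c => proper (compose (compose d1 d2) d3) (join_col a c))
  (proper_cst _) (proper_cst _); last first.
  by split=> //; apply: proper_eq.
transitivity (\sum_b \sum_c [&& proper d1 (join_col a b),
   proper d2 (join_col b c) & proper d3 (join_col c e)])%N.
  rewrite expnD -mulnA -card_middle big_distrr /=.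
  apply: eq_bigr => b _.
  transitivity (proper d1 (join_col a b) * (2 ^ loops d2 d3 * proper (compose d2 d3) (join_col b e)))%N.
    by rewrite -mulnb mulnCA.
  rewrite -card_middle big_distrr /=; apply: eq_bigr => c _.
  by rewrite mulnb.
rewrite exchange_big expnD -mulnA -card_middle big_distrr /=.
apply: eq_bigr => c _.
transitivity ((2 ^ loops d1 d2 * proper (compose d1 d2) (join_col a c)) * proper d3 (join_col c e))%N.
  rewrite -card_middle big_distrl /=; apply: eq_bigr => b _.
  by rewrite mulnb andbA.
by rewrite -mulnA mulnb.
Qed.

End Colouring.

Definition partalg (K : comNzRingType) (q : K) n := {ffun diagram n -> K^o}.

HB.instance Definition _ (K : comNzRingType) (q : K) n :=
  GRing.Lmodule.on (partalg q n).
HB.instance Definition _ (K : comNzRingType) (q : K) n :=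
  Vector.on (partalg q n).

HB.lock Definition dbasis (K : comNzRingType) (q : K) n (d : diagram n) :
  partalg q n := [ffun d' => (d' == d)%:R].

HB.lock Definition pmul (K : comNzRingType) (q : K) n (f g : partalg q n) :
  partalg q n := \sum_d1 \sum_d2
     (f d1 * g d2 * q ^+ loops d1 d2) *: dbasis q (compose d1 d2).

Section PartitionAlgebra.
Variables (K : comNzRingType) (q : K) (n : nat).
Local Notation A := (partalg q n).
Local Notation dbasis := (@dbasis K q n).
Local Notation pmul := (@pmul K q n).

Lemma dbasisE d d' : dbasis d d' = (d' == d)%:R :> K.
Proof. by rewrite dbasis.unlock ffunE. Qed.

Lemma partalg_expand (f : A) : f = \sum_d (f d : K) *: dbasis d.
Proof.
apply/ffunP => d; rewrite sum_ffunE (bigD1 d) //= big1 ?addr0.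
  rewrite ffunE; have -> : dbasis d d = 1 :> K by rewrite dbasisE eqxx.
  exact/esym/mulr1.
move=> d' /negbTE ne; rewrite ffunE.
have -> : dbasis d' d = 0 :> K by rewrite dbasisE eq_sym ne.
exact: mulr0.
Qed.

Lemma pmulDl : left_distributive pmul +%R.
Proof.
move=> f g h; rewrite pmul.unlock -big_split; apply: eq_bigr => d1 _.
rewrite -big_split; apply: eq_bigr => d2 _ /=.
by rewrite ffunE -scalerDl -!mulrDl.
Qed.

Lemma pmulDr : right_distributive pmul +%R.
Proof.
move=> f g h; rewrite pmul.unlock -big_split; apply: eq_bigr => d1 _.
rewrite -big_split; apply: eq_bigr => d2 _ /=.
by rewrite ffunE -scalerDl -!mulrDl mulrDr.
Qed.

Lemma pmulZl (k : K) f g : pmul (k *: f) g = k *: pmul f g.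
Proof.
rewrite pmul.unlock scaler_sumr; apply: eq_bigr => d1 _.
rewrite scaler_sumr; apply: eq_bigr => d2 _.
by rewrite scalerA ffunE !mulrA.
Qed.

Lemma pmulZr (k : K) f g : pmul f (k *: g) = k *: pmul f g.
Proof.
rewrite pmul.unlock scaler_sumr; apply: eq_bigr => d1 _.
rewrite scaler_sumr; apply: eq_bigr => d2 _.
by rewrite scalerA ffunE !mulrA -[k * f d1]mulrC.
Qed.

Lemma pmul_basis d1 d2 :
  pmul (dbasis d1) (dbasis d2) = q ^+ loops d1 d2 *: dbasis (compose d1 d2).
Proof.
have db1 d : dbasis d d = 1 :> K by rewrite dbasisE eqxx.
have db0 d d' : d' != d -> dbasis d d' = 0 :> K.
  by move=> /negbTE ne; rewrite dbasisE ne.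
rewrite pmul.unlock (bigD1 d1) //= [X in _ + X]big1 ?addr0; last first.
  move=> d /db0 ne; apply: big1 => d' _; rewrite ne.
  by rewrite (mul0r (_ : K)) (mul0r (_ : K)) scale0r.
rewrite (bigD1 d2) //= big1 ?addr0.
  by rewrite !db1 (mul1r (1 : K)) (mul1r (_ : K)).
move=> d /db0 ne; rewrite ne.
by rewrite (mulr0 (_ : K)) (mul0r (_ : K)) scale0r.
Qed.

Lemma pmul_suml I (r : seq I) (F : I -> A) g :
  pmul (\sum_(i <- r) F i) g = \sum_(i <- r) pmul (F i) g.
Proof.
elim: r => [|i r IH]; last by rewrite !big_cons pmulDl IH.
rewrite !big_nil; have := pmulDl 0 0 g; rewrite addr0 => E.
by apply: (addrI (pmul 0 g)); rewrite -E addr0.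
Qed.

Lemma pmul_sumr I (r : seq I) (F : I -> A) g :
  pmul g (\sum_(i <- r) F i) = \sum_(i <- r) pmul g (F i).
Proof.
elim: r => [|i r IH]; last by rewrite !big_cons pmulDr IH.
rewrite !big_nil; have := pmulDr g 0 0; rewrite addr0 => E.
by apply: (addrI (pmul g 0)); rewrite -E addr0.
Qed.

Lemma pmul1f : left_id (dbasis (id_diagram n)) pmul.
Proof.
move=> f; rewrite {1}[f]partalg_expand pmul_sumr [RHS]partalg_expand.
apply: eq_bigr => d _; rewrite pmulZr pmul_basis.
by have [-> ->] := compose1d d; rewrite scale1r.
Qed.

Lemma pmulf1 : right_id (dbasis (id_diagram n)) pmul.
Proof.
move=> f; rewrite {1}[f]partalg_expand pmul_suml [RHS]partalg_expand.
apply: eq_bigr => d _; rewrite pmulZl pmul_basis.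
by have [-> ->] := composed1 d; rewrite scale1r.
Qed.

Lemma pmulA : associative pmul.
Proof.
move=> f g h; rewrite [f]partalg_expand (pmul_suml _ _ g).
rewrite (pmul_suml _ _ (pmul g h)) (pmul_suml _ _ h); apply: eq_bigr => d1 _.
rewrite !pmulZl; congr (_ *: _).
rewrite [g]partalg_expand (pmul_suml _ _ h) (pmul_sumr _ _ (dbasis d1)).
rewrite (pmul_sumr _ _ (dbasis d1)) (pmul_suml _ _ h); apply: eq_bigr => d2 _.
rewrite pmulZl !pmulZr pmulZl; congr (_ *: _).
rewrite [h]partalg_expand (pmul_sumr _ _ (dbasis d2)).
rewrite (pmul_sumr _ _ (dbasis d1)) (pmul_sumr _ _ (pmul _ _)).
apply: eq_bigr => d3 _.
rewrite !pmulZr !pmul_basis pmulZr pmulZl !pmul_basis !scalerA.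
by have [-> E] := composeA d1 d2 d3; rewrite -!mulrA -!exprD E.
Qed.

Lemma pmul1_neq0 : dbasis (id_diagram n) != 0.
Proof.
apply/eqP => /ffunP/(_ (id_diagram n)); rewrite (dbasisE (id_diagram n)) eqxx.
by rewrite ffunE => /eqP; rewrite oner_eq0.
Qed.

HB.instance Definition _ := GRing.Zmodule_isNzRing.Build A
  pmulA pmul1f pmulf1 pmulDl pmulDr pmul1_neq0.

Fact partalg_scaleAl (k : K) (f g : A) : k *: (f * g) = (k *: f) * g.
Proof. by rewrite [RHS]pmulZl. Qed.
HB.instance Definition _ := GRing.Lmodule_isLalgebra.Build K A partalg_scaleAl.

Fact partalg_scaleAr (k : K) (f g : A) : k *: (f * g) = f * (k *: g).
Proof. by rewrite [RHS]pmulZr. Qed.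
HB.instance Definition _ := GRing.Lalgebra_isAlgebra.Build K A partalg_scaleAr.

Lemma partalg_mulE (f g : A) :
  f * g = \sum_d1 \sum_d2
     (f d1 * g d2 * q ^+ loops d1 d2) *: dbasis (compose d1 d2).
Proof. by rewrite -[LHS]/(pmul f g) pmul.unlock. Qed.

Lemma dbasisM d1 d2 :
  dbasis d1 * dbasis d2 = q ^+ loops d1 d2 *: dbasis (compose d1 d2).
Proof. exact: pmul_basis. Qed.

End PartitionAlgebra.

From mathcomp Require Import boolp classical_sets fsbigop zify.

(* Formal Laurent series in u^-1: [lcoef f k] is the coefficient of u^-k. *)
Definition bounded_below (R : nzRingType) (f : int -> R) : bool :=
  `[< exists N : int, forall k, k < N -> f k = 0 >].

Record laurent (R : nzRingType) :=
  Laurent { lcoef :> int -> R; _ : bounded_below lcoef }.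

HB.instance Definition _ (R : nzRingType) := [isSub for @lcoef R].
HB.instance Definition _ (R : nzRingType) := gen_eqMixin (laurent R).
HB.instance Definition _ (R : nzRingType) := gen_choiceMixin (laurent R).

Section LaurentSeries.
Variable R : nzRingType.
Implicit Types f g h : laurent R.

Lemma laurentP f g : f =1 g -> f = g.
Proof. by move=> E; apply: val_inj; apply: funext. Qed.

Lemma lbound f : exists N : int, forall k, k < N -> f k = 0.
Proof. by case: f => f /= /asboolP. Qed.

Fact lzero_subproof : bounded_below (fun _ : int => 0 : R).
Proof. by apply/asboolP; exists 0. Qed.
Definition lzero := Laurent lzero_subproof.

Fact lopp_subproof f : bounded_below (fun k => - f k).
Proof.
by apply/asboolP; have [N fN] := lbound f; exists N => k /fN ->; rewrite oppr0.
Qed.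
Definition lopp f := Laurent (lopp_subproof f).

Fact ladd_subproof f g : bounded_below (fun k => f k + g k).
Proof.
apply/asboolP; have [N fN] := lbound f; have [M gM] := lbound g.
exists (Num.min N M) => k; rewrite lt_min => /andP[/fN -> /gM ->].
by rewrite addr0.
Qed.
Definition ladd f g := Laurent (ladd_subproof f g).

Fact laddA : associative ladd.
Proof. by move=> f g h; apply: laurentP => k /=; rewrite addrA. Qed.
Fact laddC : commutative ladd.
Proof. by move=> f g; apply: laurentP => k /=; rewrite addrC. Qed.
Fact ladd0 : left_id lzero ladd.
Proof. by move=> f; apply: laurentP => k /=; rewrite add0r. Qed.
Fact laddN : left_inverse lzero lopp ladd.
Proof. by move=> f; apply: laurentP => k /=; rewrite addNr. Qed.

HB.instance Definition _ := GRing.isZmodule.Build (laurent R)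
  laddA laddC ladd0 laddN.

Definition lmul_coef f g (k : int) : R :=
  \sum_(i \in [set: int]%classic) f i * g (k - i).

(* The sum defining [lmul_coef] is finite, and is a Cauchy product up to shifts. *)
Lemma lmul_coefE f g (a b : int) m :
  (forall k, k < a -> f k = 0) -> (forall k, k < b -> g k = 0) ->
  lmul_coef f g (a + b + m%:Z) =
  \sum_(i < m.+1) f (a + i%:Z) * g (b + (m - i)%N%:Z).
Proof.
move=> fa gb; rewrite /lmul_coef.
pose s := [seq a + i%:Z | i <- iota 0 m.+1].
rewrite (fsbigE s); first last.
- move=> i _ iNs; have [/fa->|ai] := ltP i a; first by rewrite mul0r.
  rewrite gb ?mulr0 //; have : (`|i - a| \notin iota 0 m.+1)%N.
    apply: contra iNs => h; apply/mapP; exists `|i - a|%N => //.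
    by rewrite gez0_abs ?subr_ge0 // subrKC.
  rewrite mem_iota /= add0n -leqNgt => h.
  have : (m.+1)%:Z <= i - a by rewrite -[i - a]gez0_abs ?subr_ge0 // lez_nat.
  by rewrite -addn1 PoszD; lia.
- by [].
- by rewrite /s map_inj_uniq ?iota_uniq // => i j /addrI [].
rewrite (eq_bigl xpredT) => [|i]; last by rewrite in_setT.
rewrite big_map -[iota 0 m.+1]/(index_iota 0 m.+1) big_mkord.
apply: eq_bigr => i _; congr (_ * g _).
have := ltn_ord i; lia.
Qed.

Lemma lmul_coef0 f g (a b k : int) :
  (forall k, k < a -> f k = 0) -> (forall k, k < b -> g k = 0) ->
  k < a + b -> lmul_coef f g k = 0.
Proof.
move=> fa gb kab; rewrite /lmul_coef fsbig1 // => i _.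
have [/fa->|ai] := ltP i a; first by rewrite mul0r.
by rewrite gb ?mulr0 //; lia.
Qed.

Fact lmul_subproof f g : bounded_below (lmul_coef f g).
Proof.
apply/asboolP; have [a fa] := lbound f; have [b gb] := lbound g.
by exists (a + b) => k; apply: lmul_coef0.
Qed.
Definition lmul f g := Laurent (lmul_subproof f g).

Lemma lmulE f g a b m (p q : {poly R}) :
  (forall k, k < a -> f k = 0) -> (forall k, k < b -> g k = 0) ->
  (forall i, (i <= m)%N -> p`_i = f (a + i%:Z)) ->
  (forall i, (i <= m)%N -> q`_i = g (b + i%:Z)) ->
  forall i, (i <= m)%N -> (p * q)`_i = lmul f g (a + b + i%:Z).
Proof.
move=> fa gb Ep Eq i im /=; rewrite (lmul_coefE _ fa gb) coefM.
apply: eq_bigr => j _; rewrite Ep ?Eq //.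
  by apply: leq_trans im; apply: leq_subr.
by apply: leq_trans im; rewrite -ltnS.
Qed.

Definition lpoly f (a : int) m : {poly R} := \poly_(i < m.+1) f (a + i%:Z).

Lemma lpolyE f a m i : (i <= m)%N -> (lpoly f a m)`_i = f (a + i%:Z).
Proof. by move=> im; rewrite coef_poly ltnS im. Qed.

Lemma split_ge (c k : int) : c <= k -> exists m : nat, k = c + m%:Z.
Proof.
by move=> ck; exists `|k - c|%N; rewrite gez0_abs ?subr_ge0 // subrKC.
Qed.

Fact lmulA : associative lmul.
Proof.
move=> f g h; have [a fa] := lbound f; have [b gb] := lbound g.
have [c hc] := lbound h; apply: laurentP => k.
have fgab l : l < a + b -> lmul f g l = 0 by apply: lmul_coef0.
have ghbc l : l < b + c -> lmul g h l = 0 by apply: lmul_coef0.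
have [kabc|/split_ge[m ->]] := ltP k (a + b + c).
  rewrite /= (lmul_coef0 fgab hc) // (lmul_coef0 fa ghbc) //.
  by rewrite addrA.
pose p := lpoly f a m; pose q := lpoly g b m; pose r := lpoly h c m.
have Ep := @lpolyE f a m; have Eq := @lpolyE g b m; have Er := @lpolyE h c m.
have Epq := lmulE fa gb Ep Eq; have Eqr := lmulE gb hc Eq Er.
rewrite -(lmulE fgab hc Epq Er (leqnn m)) -mulrA.
by rewrite (lmulE fa ghbc Ep Eqr (leqnn m)) addrA.
Qed.

Fact lmulDl : left_distributive lmul ladd.
Proof.
move=> f g h; have [N fN] := lbound f; have [M gM] := lbound g.
have [c hc] := lbound h; apply: laurentP => k.
pose a := Num.min N M.
have fa l : l < a -> f l = 0 by rewrite lt_min => /andP[/fN].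
have ga l : l < a -> g l = 0 by rewrite lt_min => /andP[_ /gM].
have fga l : l < a -> ladd f g l = 0 by move=> la /=; rewrite fa ?ga ?addr0.
have [kac|/split_ge[m ->]] := ltP k (a + c).
  by rewrite /= (lmul_coef0 fa hc) // (lmul_coef0 ga hc) // (lmul_coef0 fga hc) ?addr0.
rewrite /= (lmul_coefE _ fa hc) (lmul_coefE _ ga hc) (lmul_coefE _ fga hc).
by rewrite -big_split; apply: eq_bigr => i _ /=; rewrite mulrDl.
Qed.

Fact lmulDr : right_distributive lmul ladd.
Proof.
move=> h f g; have [N fN] := lbound f; have [M gM] := lbound g.
have [c hc] := lbound h; apply: laurentP => k.
pose a := Num.min N M.
have fa l : l < a -> f l = 0 by rewrite lt_min => /andP[/fN].
have ga l : l < a -> g l = 0 by rewrite lt_min => /andP[_ /gM].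
have fga l : l < a -> ladd f g l = 0 by move=> la /=; rewrite fa ?ga ?addr0.
have [kac|/split_ge[m ->]] := ltP k (c + a).
  by rewrite /= (lmul_coef0 hc fa) // (lmul_coef0 hc ga) // (lmul_coef0 hc fga) ?addr0.
rewrite /= (lmul_coefE _ hc fa) (lmul_coefE _ hc ga) (lmul_coefE _ hc fga).
by rewrite -big_split; apply: eq_bigr => i _ /=; rewrite mulrDr.
Qed.

(* The monomial c u^-d. *)
Fact lmonom_subproof (d : int) (c : R) :
  bounded_below (fun k => if k == d then c else 0).
Proof. by apply/asboolP; exists d => k /lt_eqF ->. Qed.
Definition lmonom d c := Laurent (lmonom_subproof d c).

Lemma lmonomMl d c f k : lmul (lmonom d c) f k = c * f (k - d).
Proof.
rewrite /= /lmul_coef (fsbigE [:: d]) //=; last first.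
  by move=> i _; rewrite inE => /negbTE->; rewrite mul0r.
by rewrite big_cons big_nil in_setT eqxx addr0.
Qed.

Lemma lmonomMr d c f k : lmul f (lmonom d c) k = f (k - d) * c.
Proof.
rewrite /= /lmul_coef (fsbigE [:: k - d]) //=; last first.
  move=> i _; rewrite inE => ne; rewrite ifN ?mulr0 //.
  by apply: contra ne => /eqP <-; rewrite subKr.
by rewrite big_cons big_nil in_setT subKr eqxx addr0.
Qed.

Fact lmul1f : left_id (lmonom 0 1) lmul.
Proof. by move=> f; apply: laurentP => k; rewrite lmonomMl mul1r subr0. Qed.
Fact lmulf1 : right_id (lmonom 0 1) lmul.
Proof. by move=> f; apply: laurentP => k; rewrite lmonomMr mulr1 subr0. Qed.
Fact lone_neq0 : lmonom 0 1 != 0.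
Proof.
by apply/eqP => /(congr1 (fun f : laurent R => f 0)) /= /eqP; rewrite oner_eq0.
Qed.

HB.instance Definition _ := GRing.Zmodule_isNzRing.Build (laurent R)
  lmulA lmul1f lmulf1 lmulDl lmulDr lone_neq0.

Definition lunit : pred (laurent R) :=
  fun f => `[< exists g, g * f = 1 /\ f * g = 1 >].

Definition linv f : laurent R :=
  xget f [set g | g * f = 1 /\ f * g = 1]%classic.

Fact lmulVf : {in lunit, left_inverse 1 linv *%R}.
Proof.
move=> f /asboolP ex; rewrite /linv.
by have [] : (linv f * f = 1 /\ f * linv f = 1) := xgetPex f ex.
Qed.

Fact lmulfV : {in lunit, right_inverse 1 linv *%R}.
Proof.
move=> f /asboolP ex; rewrite /linv.
by have [] : (linv f * f = 1 /\ f * linv f = 1) := xgetPex f ex.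
Qed.

Fact lunitPl f g : g * f = 1 /\ f * g = 1 -> lunit f.
Proof. by move=> gf; apply/asboolP; exists g. Qed.

Fact linv_out : {in [predC lunit], linv =1 id}.
Proof.
move=> f /negP nU; rewrite /linv.
by case: xgetP => // g _ gf; case: nU; apply: lunitPl gf.
Qed.

HB.instance Definition _ := GRing.NzRing_hasMulInverse.Build (laurent R)
  lmulVf lmulfV lunitPl linv_out.

Definition lconst (c : R) : laurent R := lmonom 0 c.
Definition lvar : laurent R := lmonom (-1) 1.

(* \sum_(j >= 0) c j * u^-j *)
Fact lseries_subproof (c : nat -> R) :
  bounded_below (fun k : int => if k is Posz j then c j else 0).
Proof. by apply/asboolP; exists 0 => -[]. Qed.
Definition lseries c := Laurent (lseries_subproof c).

Lemma coefM_laurent f g k :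
  (f * g) k = \sum_(i \in [set: int]%classic) f i * g (k - i).
Proof. by []. Qed.

End LaurentSeries.

Arguments lvar {R}.

(* The subset P_r of P_2n for r <= 2n: a diagram on fewer points is completed by
   the columns {j,j'}, and for r = 2k - 1 the points k and k' share a block. *)
Definition tower n r : {set diagram n} :=
  [set d : diagram n |
    [forall j : 'I_n, (uphalf r <= j)%N ==> ([set inl j; inr j] \in val d)]
    && (odd r ==> [forall j : 'I_n,
          (j.+1 == uphalf r) ==> same_block d (inl j) (inr j)])].

(* A_r as a subspace of A_2n. *)
Definition tower_alg (K : fieldType) (q : K) n r : {vspace partalg q n} :=
  <<[seq dbasis q d | d <- enum (tower n r)]>>%VS.

Section JucysMurphy.
Variables (K : comNzRingType) (q : K) (n : nat).
Local Notation A := (partalg q n).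

Definition s_diagram i : diagram n :=
  fibres (fun v : vertex n => match v with
    | inl j => j.+1
    | inr j => [eta id with i |-> i.+1, i.+1 |-> i] j.+1
    end).

Definition e_odd_diagram k : diagram n :=
  fibres (fun v : vertex n => match v with
    | inl j => (j.+1, false)
    | inr j => (j.+1, j.+1 == k)
    end).

Definition e_even_diagram k : diagram n :=
  fibres (fun v : vertex n => match v with
    | inl j | inr j => if j.+1 == k.+1 then k else j.+1
    end).

Definition s_ i : A := dbasis q (s_diagram i).
Definition e_ i : A :=
  dbasis q (if odd i then e_odd_diagram (uphalf i) else e_even_diagram i./2).

Record jm_state := JMState { Lodd : A; Leven : A; sigeven : A; sigodd : A }.

(* From (L_{2i-1}, L_{2i}, sigma_{2i}, sigma_{2i+1})
   to (L_{2i+1}, L_{2i+2}, sigma_{2i+2}, sigma_{2i+3}). *)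
Definition jm_step i (t : jm_state) : jm_state :=
  let: JMState L' L sg sg' := t in
  {| Lodd := - (L * e_ (2 * i)) - e_ (2 * i) * L + (q%:A - L') * e_ (2 * i)
       + s_ i * L' * s_ i + sg;
     Leven := - (s_ i * L * e_ (2 * i)) - e_ (2 * i) * L * s_ i
       + e_ (2 * i) * L * e_ (2 * i + 1) * e_ (2 * i)
       + s_ i * L * s_ i + sg';
     sigeven := s_ i * s_ i.+1 * sg * s_ i.+1 * s_ i
       + e_ (2 * i) * L * s_ i.+1 * e_ (2 * i) * s_ i.+1
       + s_ i.+1 * e_ (2 * i) * L * s_ i.+1 * e_ (2 * i)
       - e_ (2 * i) * L * s_ i * e_ (2 * i + 2) * e_ (2 * i + 1) * e_ (2 * i)
       - s_ i.+1 * e_ (2 * i) * e_ (2 * i + 1) * e_ (2 * i + 2) * s_ i * L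
         * e_ (2 * i) * s_ i.+1;
     sigodd := s_ i * s_ i.+1 * sg' * s_ i.+1 * s_ i
       + s_ i.+1 * e_ (2 * i) * L * s_ i.+1 * e_ (2 * i) * s_ i.+1
       + e_ (2 * i) * L * s_ i.+1 * e_ (2 * i)
       - s_ i.+1 * e_ (2 * i) * L * s_ i * e_ (2 * i + 2) * e_ (2 * i + 1)
         * e_ (2 * i)
       - e_ (2 * i) * e_ (2 * i + 1) * e_ (2 * i + 2) * s_ i * L * e_ (2 * i)
         * s_ i.+1 |}.

(* [jm k] is (L_{2k+1}, L_{2k+2}, sigma_{2k+2}, sigma_{2k+3}). *)
Fixpoint jm k : jm_state :=
  if k is k'.+1 then jm_step k (jm k') else JMState 0 (e_ 1) 1 (s_ 1).

(* The Jucys-Murphy element L_m, for 1 <= m <= 2n. *)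
Definition JM m : A := if odd m then Lodd (jm m./2) else Leven (jm m./2.-1).

End JucysMurphy.

Notation Qz := {fraction {poly rat}}.
Definition zF : Qz := FracField.tofrac 'X.

(* [PA n] is the algebra A_2n; the smaller A_r are its subspaces [tower_alg zF n r]. *)
Notation PA n := (partalg zF n).

Section CentralSeries.
Variable n : nat.

Definition x_ m : PA n := - (zF / 2)%:A + JM zF n m.

(* x_m^(j), the element y of A_{m-1} with y e_m = e_m (x_m)^j e_m. *)
Definition xpow m j : PA n :=
  xget 0 [set y | y \in tower_alg zF n m.-1 /\
                  y * e_ zF n m = e_ zF n m * x_ m ^+ j * e_ zF n m]%classic.

Definition W m : laurent (PA n) :=
  if odd m then lvar^-1 * lseries (xpow m) else lseries (xpow m).

End CentralSeries.

(* Main.v *)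
From HB Require Import structures.
From Stdlib Require Import Setoid Morphisms Ncring Ncring_tac.
From mathcomp Require Import all_boot all_order all_algebra.
From mathcomp Require Import boolp zify ring.
Require Import Defs.

Set Implicit Arguments.
Unset Strict Implicit.
Unset Printing Implicit Defensive.

Import Order.TTheory GRing.Theory Num.Theory.
Local Open Scope ring_scope.

(** Give z the value N = 2^k and let the partition algebra act on functions of
    the colourings a of n positions by N colours: a diagram sends phi to the
    function whose value at a is the sum of the phi(b) over the colourings b of
    the bottom row for which the pair (a, b) is constant on the blocks. These
    actions are jointly faithful as k varies ([act_inj]), and in them the
    recursively defined elements become transparent ([jm_act]). Write p for
    i - 1, positions being counted from 0. Then L_{2i} sums over all colours c
    the exchange of the colours a_p and c on the positions 0, ..., p; the element
    z - L_{2i-1} does the same on the positions before p; sigma_{2i} and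
    sigma_{2i+1} exchange the colours a_p and a_{p+1} on the positions before p
    and on the positions up to p+1. Each relation between generators and
    Jucys-Murphy elements that is needed is then checked by comparing
    recolourings.

    The first identity is a computation with resolvents ([first_recursion]). Put
    w = u - z/2, X = L_{2i}, Y = z - L_{2i-1}, Y' = z - L_{2i+1}, P = w + X,
    R = w + Y, e = e_{2i}, f = e_{2i+1}, g = e_{2i-1}, s = s_i and
    sigma = sigma_{2i}. The definition of the central series gives
    W_{2i+1} f = f (w + Y')^-1 f and W_{2i-1} f = f (w + s Y s)^-1 f, and s Y s =
    sigma Y sigma. Comparing the two resolvents by means of
    Y' - s Y s = X e + e X - Y e - sigma leaves two unknown terms,
    f (w + Y')^-1 sigma f and f e g R^-1 sigma f. The same comparison applied to
    the first brings back W_{2i+1}, because sigma is an involution; the relation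
    sigma X sigma = X + g e + e g - X e - e X applied to the second brings back
    W_{2i-1}. The outcome is
      (W_{2i+1} - w - 1) (1 - R^-2) f = (1 - P^-2) (W_{2i-1} - w - 1) f.
    The second identity ([second_recursion]) has the same shape, with
    w = u + z/2, the resolvents of L_{2i+2} and of sigma_{2i+1} L_{2i} sigma_{2i+1},
    and multiplication by e_{2i+2} at the right.

    The factor at the right can be cancelled, since right multiplication by
    e_{2i+1} is injective on A_{2i} ([cut_inj]), and that by e_{2i+2} on A_{2i+2}
    ([join_inj]). The formula of the statement follows because W_{m+1} commutes with L_{m+1}: diagrams of A_m
    commute with every operator that recolours their positions by a permutation
    of the colours depending only on the positions that they fix
    ([dact_peripheral]). *)
(** * Colourings *)

Definition colours n (T : eqType) (d : diagram n) (f : vertex n -> T) : bool :=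
  [forall x, forall y, same_block d x y ==> (f x == f y)].

Lemma coloursP n (T : eqType) (d : diagram n) (f : vertex n -> T) :
  reflect (forall x y, same_block d x y -> f x = f y) (colours d f).
Proof.
apply: (iffP forallP) => [H x y dxy|H x].
  by have /forallP/(_ y)/implyP/(_ dxy)/eqP := H x.
by apply/forallP => y; apply/implyP => /H ->.
Qed.

Lemma colours_fibres n (T S : eqType) (h : vertex n -> S) (f : vertex n -> T) :
  reflect (forall x y, h x = h y -> f x = f y) (colours (fibres h) f).
Proof.
apply: (iffP (coloursP _ _)) => H x y; last by rewrite fibresE => /eqP/H.
by move=> /eqP; rewrite -(fibresE h) => /H.
Qed.

Lemma eq_colours n (T : eqType) (d : diagram n) (f g : vertex n -> T) :
  f =1 g -> colours d f = colours d g.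
Proof.
by move=> E; apply/coloursP/coloursP => H x y /H; rewrite !E.
Qed.

Definition rows n (T : Type) (a b : nat -> T) (v : vertex n) : T :=
  match v with inl j => a j | inr j => b j end.

Definition paint n (T : Type) (a : nat -> T) (b : {ffun 'I_n -> T}) (k : nat) : T :=
  if insub k is Some j then b j else a k.

Section Paint.
Variables (n : nat) (T : Type).
Implicit Types (a : nat -> T) (b c : {ffun 'I_n -> T}).

Lemma paint_ord a b (j : 'I_n) : paint a b j = b j.
Proof. by rewrite /paint valK. Qed.

Lemma paint_out a b k : (n <= k)%N -> paint a b k = a k.
Proof. by move=> nk; rewrite /paint insubN // -leqNgt. Qed.

Lemma paint_eq a b (c : nat -> T) : (forall j : 'I_n, b j = c j) ->
  (forall k, (n <= k)%N -> c k = a k) -> paint a b = c.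
Proof.
move=> E F; apply: funext => k; have [kn|nk] := ltnP k n.
  by rewrite (paint_ord a b (Ordinal kn)) E.
by rewrite paint_out // F.
Qed.

Lemma paint_paint a b c : paint (paint a b) c = paint a c.
Proof.
by apply: paint_eq => [j|k nk]; rewrite ?paint_ord ?paint_out.
Qed.

Lemma paint_inj a : injective (@paint n T a).
Proof.
by move=> b c E; apply/ffunP => j; rewrite -!(paint_ord a) E.
Qed.

End Paint.

(** With bit vectors as colours a colouring is a vector of two-colourings, so
    counting reduces to two colours; the numbers 2^k are still enough values to
    determine a polynomial in z. *)
Definition bits k := {ffun 'I_k -> bool}.

Section Counting.
Variables (n k : nat).
Implicit Types (d : diagram n) (a b c : {ffun 'I_n -> bits k}).

Definition bit_row a (j : 'I_k) : {ffun 'I_n -> bool} := [ffun i => a i j].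

Definition join a b (v : vertex n) : bits k :=
  match v with inl j => a j | inr j => b j end.

Lemma colours_bits d a b :
  colours d (join a b) = [forall j, proper d (join_col (bit_row a j) (bit_row b j))].
Proof.
have E j v : join_col (bit_row a j) (bit_row b j) v = join a b v j.
  by case: v => i; rewrite /= ffunE.
apply/coloursP/forallP => [H j|H x y dxy].
  by apply/properP => x y /H; rewrite !E => ->.
by apply/ffunP => j; have /properP/(_ _ _ dxy) := H j; rewrite !E.
Qed.

Lemma count_colours d1 d2 a c :
  (\sum_b (colours d1 (join a b) && colours d2 (join b c)) =
   #|{: bits k}| ^ loops d1 d2 * colours (compose d1 d2) (join a c))%N.
Proof.
pose col (b : {ffun 'I_n -> bits k}) : {ffun 'I_k -> {ffun 'I_n -> bool}} :=
  [ffun j => bit_row b j].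
pose row (B : {ffun 'I_k -> {ffun 'I_n -> bool}}) : {ffun 'I_n -> bits k} :=
  [ffun i => [ffun j => B j i]].
have colK : cancel col row.
  by move=> b; apply/ffunP => i; apply/ffunP => j; rewrite !ffunE.
have rowK : cancel row col.
  by move=> b; apply/ffunP => i; apply/ffunP => j; rewrite !ffunE.
have natb (I : finType) (P : pred I) : (\prod_i (P i : nat) = [forall i, P i])%N.
  apply/esym; case: forallP => [H|/forallP].
    by rewrite big1 // => i _; rewrite H.
  by rewrite negb_forall => /existsP[i /negbTE Pi]; rewrite (bigD1 i) //= Pi.
transitivity (\sum_(B : {ffun 'I_k -> {ffun 'I_n -> bool}}) \prod_(j < k)
    (proper d1 (join_col (bit_row a j) (B j)) && proper d2 (join_col (B j) (bit_row c j))))%N.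
  rewrite (reindex row) /=; last by exists col => b _; [exact: rowK|exact: colK].
  apply: eq_bigr => B _; rewrite natb !colours_bits; congr (nat_of_bool _).
  have E j : bit_row (row B) j = B j by rewrite -{2}(rowK B) ffunE.
  apply/andP/forallP => [[/forallP H1 /forallP H2] j|H].
    by have := H1 j; have := H2 j; rewrite !E => -> ->.
  by split; apply/forallP => j; have /andP[] := H j; rewrite E.
rewrite -(bigA_distr_bigA (fun j (b : {ffun 'I_n -> bool}) => nat_of_bool (proper d1 (join_col (bit_row a j) b)
    && proper d2 (join_col b (bit_row c j))))) /=.
under eq_bigr do rewrite card_middle.
rewrite big_split /= natb colours_bits prod_nat_const card_ord.
by rewrite card_ffun card_bool card_ord -!expnM [(k * _)%N]mulnC.
Qed.

End Counting.

(** * Diagrams as operators on functions of colourings *)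

Section Action.
Variables (n k : nat).
Local Notation T := (bits k).
Local Notation config := (nat -> T).
Local Notation A := (partalg ('X : {poly rat}) n).
Implicit Types (d : diagram n) (a : config) (phi : config -> rat) (x y : A).

Definition ncol : rat := #|{: T}|%:R.

Definition dact d phi a : rat :=
  \sum_(b : {ffun 'I_n -> T} | colours d (rows a (paint a b))) phi (paint a b).

Definition act x phi a : rat := \sum_d (x d : {poly rat}).[ncol] * dact d phi a.

Lemma rows_join a b : rows a (paint a b) =1 join [ffun j : 'I_n => a j] b.
Proof. by case=> j /=; rewrite ?paint_ord ?ffunE. Qed.

(** Stacking multiplies the number of colourings of the middle row, which is the
    number of colours for each component deleted there. *)
Lemma dact_comp d1 d2 phi a :
  dact d1 (dact d2 phi) a = ncol ^+ loops d1 d2 * dact (compose d1 d2) phi a.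
Proof.
rewrite /dact.
transitivity (\sum_(c : {ffun 'I_n -> T}) phi (paint a c) *
  (\sum_(b : {ffun 'I_n -> T}) (colours d1 (join [ffun j : 'I_n => a j] b) &&
     colours d2 (join b c))%N)%:R).
  under [RHS]eq_bigr => c _.
    rewrite natr_sum mulr_sumr; over.
  rewrite exchange_big big_mkcond /=; apply: eq_bigr => b _.
  rewrite (eq_colours _ (rows_join a b)); case: (colours d1 _) => /=; last first.
    by rewrite big1 // => c _; rewrite mulr0.
  rewrite big_mkcond; apply: eq_bigr => c _.
  rewrite paint_paint [X in colours d2 X](_ : _ = rows (paint a b) (paint (paint a b) c));
    last by rewrite paint_paint.
  rewrite (eq_colours _ (rows_join _ _)).
  have -> : [ffun j : 'I_n => paint a b j] = b by apply/ffunP => j; rewrite ffunE paint_ord.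
  by case: (colours _ _); rewrite ?mulr1 ?mulr0.
rewrite mulr_sumr [RHS]big_mkcond; apply: eq_bigr => c _.
rewrite count_colours -(eq_colours _ (rows_join a c)) natrM natrX.
by case: (colours _ _); rewrite ?mulr1 ?mulr0 // mulrC.
Qed.

Lemma dact_sum I (r : seq I) d (F : I -> config -> rat) a :
  dact d (fun c => \sum_(i <- r) F i c) a = \sum_(i <- r) dact d (F i) a.
Proof. by rewrite /dact exchange_big. Qed.

Lemma dact_scale d (l : rat) phi a : dact d (fun c => l * phi c) a = l * dact d phi a.
Proof. by rewrite /dact mulr_sumr. Qed.

Lemma actD x y phi a : act (x + y) phi a = act x phi a + act y phi a.
Proof.
rewrite /act -big_split; apply: eq_bigr => d _ /=.
by rewrite ffunE hornerD mulrDl.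
Qed.

Lemma actN x phi a : act (- x) phi a = - act x phi a.
Proof.
rewrite /act -sumrN; apply: eq_bigr => d _ /=.
by rewrite ffunE hornerN mulNr.
Qed.

Lemma act0 phi a : act 0 phi a = 0.
Proof. by rewrite /act big1 // => d _; rewrite ffunE horner0 mul0r. Qed.

Lemma actZ (p : {poly rat}) x phi a : act (p *: x) phi a = p.[ncol] * act x phi a.
Proof.
rewrite /act mulr_sumr; apply: eq_bigr => d _ /=.
by rewrite ffunE hornerM mulrA.
Qed.

Lemma act_sum I (r : seq I) (F : I -> A) phi a :
  act (\sum_(i <- r) F i) phi a = \sum_(i <- r) act (F i) phi a.
Proof.
elim: r => [|i r IH]; first by rewrite !big_nil act0.
by rewrite !big_cons actD IH.
Qed.

Lemma act_dbasis d phi a : act (dbasis 'X d) phi a = dact d phi a.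
Proof.
rewrite /act (bigD1 d) //= big1 ?addr0.
  by rewrite dbasisE eqxx hornerC mul1r.
by move=> d' /negbTE dd'; rewrite dbasisE dd' horner0 mul0r.
Qed.

Lemma actM x y phi a : act (x * y) phi a = act x (act y phi) a.
Proof.
rewrite partalg_mulE act_sum [RHS]/act; apply: eq_bigr => d1 _.
rewrite act_sum -[act y phi]/(fun c => \sum_d2 (y d2 : {poly rat}).[ncol] * dact d2 phi c).
rewrite dact_sum mulr_sumr; apply: eq_bigr => d2 _.
rewrite actZ act_dbasis dact_scale dact_comp !hornerM horner_exp hornerX.
by rewrite !mulrA.
Qed.

Lemma eq_dact d phi psi a : phi =1 psi -> dact d phi a = dact d psi a.
Proof. by move=> E; apply: eq_bigr. Qed.

(** The generators admit an explicit list of the colourings of the bottom row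
    compatible with a given top row; this turns the list into an operator. *)
Lemma dactE (I : finType) (F : I -> config) d phi a :
  injective F -> (forall i k, (n <= k)%N -> F i k = a k) ->
  (forall i, colours d (rows a (F i))) ->
  (forall b : {ffun 'I_n -> T}, colours d (rows a (paint a b)) ->
     exists i, paint a b = F i) ->
  dact d phi a = \sum_i phi (F i).
Proof.
move=> Finj Fout Fcol Fex; rewrite /dact.
pose G i : {ffun 'I_n -> T} := [ffun j : 'I_n => F i j].
have GF i : paint a (G i) = F i.
  by apply: paint_eq => [j|l nl]; rewrite ?ffunE // Fout.
have Ginj : injective G by move=> i j E; apply: Finj; rewrite -!GF E.
transitivity (\sum_(b in [set G i | i : I]) phi (paint a b)); last first.
  by rewrite big_imset /=; [apply: eq_bigr => i _; rewrite GF|move=> i j _ _ /Ginj].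
apply: eq_bigl => b; apply/idP/imsetP => [/Fex[i Ei]|[i _ ->]].
  by exists i => //; apply: (paint_inj (a := a)); rewrite GF.
by rewrite GF.
Qed.

Lemma dact_nil d phi a :
  (forall b : {ffun 'I_n -> T}, ~~ colours d (rows a (paint a b))) ->
  dact d phi a = 0.
Proof. by move=> H; apply: big_pred0 => b; apply: negbTE. Qed.

End Action.

(** * Faithfulness *)

Section Faithful.
Variable n : nat.
Local Notation A := (partalg ('X : {poly rat}) n).

Definition weight (d : diagram n) : nat :=
  #|[set xy | same_block d xy.1 xy.2]|.

(** A vertex is coloured by its row in the incidence matrix of d, so that two
    vertices get the same colour exactly when they share a block. *)
Definition separate k (d : diagram n) (x : vertex n) : bits k :=
  [ffun j : 'I_k => [exists y, ((enum_rank y : nat) == j :> nat) && same_block d x y]].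

Lemma separateE k d x y : (#|{: vertex n}| <= k)%N ->
  (separate k d x = separate k d y) <-> same_block d x y.
Proof.
move=> nk; split=> [E|dxy]; last first.
  apply/ffunP => j; rewrite !ffunE; apply: eq_existsb => t.
  by rewrite (same_block_left _ dxy).
have lt : (enum_rank y < k)%N by apply: leq_trans nk.
have /ffunP/(_ (Ordinal lt)) := E; rewrite !ffunE.
have -> : [exists t, ((enum_rank t : nat) == Ordinal lt) && same_block d y t].
  by apply/existsP; exists y; rewrite eqxx same_blockxx.
by move=> /existsP[t /andP[/eqP/ord_inj/enum_rank_inj->]].
Qed.

(** Induction on [weight]: at the colouring separating the blocks of d, only d and
    the strictly finer diagrams, of smaller weight, contribute. *)
Lemma colours_indep k (c : diagram n -> rat) : (#|{: vertex n}| <= k)%N ->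
  (forall f : vertex n -> bits k, \sum_(d | colours d f) c d = 0) ->
  forall d, c d = 0.
Proof.
move=> nk H d; move: {2}(weight d) (leqnn (weight d)) => m.
elim/ltn_ind: m d => m IH d dm; have := H (separate k d).
rewrite (bigD1 d) /=; last by apply/coloursP => x y /separateE ->.
rewrite big1 ?addr0 // => d' /andP[/coloursP d'd ne]; apply: (IH (weight d')) => //.
have sub x y : same_block d' x y -> same_block d x y by move/d'd/separateE; apply.
apply: leq_trans dm; apply: fintype.proper_card; apply/fintype.properP; split.
  by apply/fintype.subsetP => -[x y]; rewrite !inE /= => /sub.
have [/eqfunP E|] := boolP [forall xy, same_block d' xy.1 xy.2 == same_block d xy.1 xy.2].
  by case/eqP: ne; apply: diagram_ext => x y; apply: (E (x, y)).
rewrite negb_forall => /existsP[[x y] /= nE]; exists (x, y); rewrite inE /=.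
  by apply: contraNT nE => /negbTE dxy; rewrite dxy; apply/eqP/negbTE; apply: contraFN dxy => /sub.
by apply: contra nE => d'xy; rewrite d'xy (sub _ _ d'xy).
Qed.

Lemma poly_eq0_pow2 (p : {poly rat}) k0 :
  (forall k, (k0 <= k)%N -> p.[(2 ^ k)%N%:R] = 0) -> p = 0.
Proof.
move=> H; apply/eqP; apply/negPn/negP => p0.
pose s : seq rat := [seq (2 ^ (k0 + i))%N%:R | i <- iota 0 (size p)].
have : (size s < size p)%N.
  apply: max_poly_roots => //.
    by apply/allP => _ /mapP[i _ ->]; apply/rootP/H; rewrite leq_addr.
  rewrite map_inj_uniq ?iota_uniq // => i j /eqP.
  by rewrite eqr_nat eqn_exp2l // eqn_add2l => /eqP.
by rewrite size_map size_iota ltnn.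
Qed.

Lemma act_inj (x y : A) :
  (forall k phi a, act (k := k) x phi a = act y phi a) -> x = y.
Proof.
move=> E; apply/ffunP => d; apply/eqP; rewrite -subr_eq0; apply/eqP.
apply: (poly_eq0_pow2 (k0 := #|{: vertex n}|)) => k nk.
have -> : (2 ^ k)%N%:R = ncol k by rewrite /ncol card_ffun card_bool card_ord.
apply: (colours_indep (k := k) (c := fun d => (x d - y d : {poly rat}).[ncol k])) => // f.
pose a i : bits k := if insub i is Some j then f (inl j) else [ffun=> false].
pose b : {ffun 'I_n -> bits k} := [ffun j => f (inr j)].
pose phi c : rat := (c == paint a b)%:R.
have := E k phi a; rewrite /act => /eqP; rewrite -subr_eq0 => /eqP.
rewrite -sumrB => E0; rewrite -[RHS]E0 big_mkcond /=; apply: eq_bigr => d' _.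
rewrite -mulrBl -hornerN -hornerD.
have -> : dact d' phi a = (colours d' f)%:R.
  have Ef : rows a (paint a b) =1 f.
    by case=> j /=; rewrite ?paint_ord ?ffunE /a ?valK.
  rewrite /dact big_mkcond (bigD1 b) //= big1 ?addr0.
    by rewrite (eq_colours _ Ef) /phi eqxx; case: colours.
  move=> b' /negbTE ne; rewrite /phi; case: eqP => [/paint_inj E'|]; last by case: ifP.
  by rewrite E' eqxx in ne.
by case: colours; rewrite ?mulr1 ?mulr0.
Qed.

End Faithful.

(** * The operators of the generators *)

Section Moves.
Variable T : eqType.
Implicit Types (a : nat -> T) (x y z : T).

Definition swp x y z : T := if z == x then y else if z == y then x else z.
Definition recol q x y a k : T := if (k < q)%N then swp x y (a k) else a k.
Definition upd p x a k : T := if k == p then x else a k.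
Definition exch p a k : T :=
  if k == p then a p.+1 else if k == p.+1 then a p else a k.

End Moves.

(** The two parities of the index act differently: as an operator [ejoin p]
    compares the colours at p and p+1, while [ecut p] sums over the colour at p. *)
Section Generators.
Variables (K : comNzRingType) (q : K) (n : nat).
Definition ejoin p : partalg q n := e_ q n (2 * p.+1).
Definition ecut p : partalg q n := e_ q n (2 * p + 1).
Definition transp p : partalg q n := s_ q n p.+1.
End Generators.

Section GeneratorActions.
Variables (n k : nat).
Local Notation T := (bits k).
Implicit Types (a : nat -> T) (phi : (nat -> T) -> rat).

Lemma act_transp p phi a : (p.+1 < n)%N ->
  act (transp 'X n p) phi a = phi (exch p a).
Proof.
move=> pn; rewrite act_dbasis (dactE (F := fun _ : unit => exch p a)).
- by rewrite big_const card_unit /= addr0.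
- by case=> -[].
- by move=> _ l nl; rewrite /exch; repeat case: eqP => ? //; lia.
- move=> _; apply/colours_fibres => -[j|j] [l|l] /=; rewrite /exch;
  by repeat (case: eqP => ?); move=> ? ; try congr a; lia.
move=> b /colours_fibres H; exists tt; apply: paint_eq => [j|l nl]; last first.
  by rewrite /exch; repeat case: eqP => ? //; lia.
rewrite -(paint_ord a) /exch; case: eqP => [jp|jp].
  by apply/esym; apply: (H (inl (Ordinal pn)) (inr j)); rewrite /= jp eqxx.
case: eqP => [jp1|jp1].
  apply/esym; apply: (H (inl (Ordinal (ltnW pn))) (inr j)); rewrite /= jp1.
  by rewrite !eqSS eqxx; case: eqP => //; lia.
apply/esym; apply: (H (inl j) (inr j)) => /=.
by repeat case: eqP => ? //; lia.
Qed.

Lemma act_ecut p phi a : (p < n)%N ->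
  act (ecut 'X n p) phi a = \sum_c phi (upd p c a).
Proof.
move=> pn; have -> : ecut 'X n p = dbasis 'X (e_odd_diagram n p.+1).
  have o : odd (2 * p + 1) by lia.
  have h : uphalf (2 * p + 1) = p.+1 by lia.
  by rewrite /ecut /e_ o h.
rewrite act_dbasis.
rewrite (dactE (F := fun c => upd p c a)) //.
- by move=> c c' /(congr1 (@^~ p)); rewrite /upd eqxx.
- by move=> c l nl; rewrite /upd; case: eqP => ? //; lia.
- move=> c; apply/colours_fibres => -[j|j] [l|l] /= /eqP;
  rewrite xpair_eqE !eqSS => /andP[/eqP jl /eqP]; rewrite /upd ?jl //.
  + by move=> <-.
  + by move=> ->.
move=> b /colours_fibres H.
exists (b (Ordinal pn)); apply: paint_eq => [j|l nl]; last first.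
  by rewrite /upd; case: eqP => ? //; lia.
rewrite /upd; case: eqP => [jp|jp]; first by congr (b _); apply: ord_inj.
rewrite -(paint_ord a); apply/esym; apply: (H (inl j) (inr j)) => /=.
by rewrite eqSS; case: eqP.
Qed.

Lemma act_ejoin p phi a : (p.+1 < n)%N ->
  act (ejoin 'X n p) phi a = (a p == a p.+1)%:R * phi a.
Proof.
move=> pn; have -> : ejoin 'X n p = dbasis 'X (e_even_diagram n p.+1).
  have o : odd (2 * p.+1) = false by lia.
  have h : (2 * p.+1)./2 = p.+1 by lia.
  by rewrite /ejoin /e_ o h.
rewrite act_dbasis.
have [E|ne] := eqVneq (a p) (a p.+1); last first.
  rewrite mul0r; apply: dact_nil => b; apply/negP => /colours_fibres H.
  case/eqP: ne; apply: (H (inl (Ordinal (ltnW pn))) (inl (Ordinal pn))) => /=.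
  by repeat case: eqP => //; lia.
rewrite mul1r (dactE (F := fun _ : unit => a)).
- by rewrite big_const card_unit /= addr0.
- by case=> -[].
- by [].
- have R (j : 'I_n) : a (if j.+1 == p.+2 then p.+1 else j.+1).-1 = a j.
    by case: eqP => [[->]|//]; rewrite -E.
  by move=> _; apply/colours_fibres => -[j|j] [l|l] /= jl; rewrite -R jl R.
move=> b /colours_fibres H; exists tt; apply: paint_eq => // j.
by rewrite -(paint_ord a); apply/esym; apply: (H (inl j) (inr j)).
Qed.
End GeneratorActions.

(** * The operators of the Jucys-Murphy elements *)

Section Recursion.
Variables (K : comNzRingType) (q : K) (n : nat).
Local Notation A := (partalg q n).

(** With positions counted from 0, the elements attached to the position p are
    [jodd p] and [jeven p], and [sige p], [sigo p] straddle p and p+1. *)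
Definition jodd p : A := Lodd (jm q n p).
Definition jeven p : A := Leven (jm q n p).
Definition sige p : A := sigeven (jm q n p).
Definition sigo p : A := sigodd (jm q n p).

Local Notation E := (ejoin q n).
Local Notation C := (ecut q n).
Local Notation S := (transp q n).

Lemma joddS p : jodd p.+1 =
  - (jeven p * E p) - E p * jeven p + (q%:A - jodd p) * E p
  + S p * jodd p * S p + sige p.
Proof. by rewrite /jodd /jeven /sige /= /jm_step; case: (jm q n p). Qed.

Lemma jevenS p : jeven p.+1 =
  - (S p * jeven p * E p) - E p * jeven p * S p
  + E p * jeven p * C p.+1 * E p + S p * jeven p * S p + sigo p.
Proof. by rewrite /jeven /sigo /= /jm_step; case: (jm q n p). Qed.

Lemma ejoinS p : E p.+1 = e_ q n (2 * p.+1 + 2).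
Proof. by rewrite /ejoin; congr e_; lia. Qed.

Lemma sigeS p : sige p.+1 =
  S p * S p.+1 * sige p * S p.+1 * S p
  + E p * jeven p * S p.+1 * E p * S p.+1
  + S p.+1 * E p * jeven p * S p.+1 * E p
  - E p * jeven p * S p * E p.+1 * C p.+1 * E p
  - S p.+1 * E p * C p.+1 * E p.+1 * S p * jeven p * E p * S p.+1.
Proof. by rewrite ejoinS /sige /jeven /= /jm_step; case: (jm q n p). Qed.

Lemma sigoS p : sigo p.+1 =
  S p * S p.+1 * sigo p * S p.+1 * S p
  + S p.+1 * E p * jeven p * S p.+1 * E p * S p.+1
  + E p * jeven p * S p.+1 * E p
  - S p.+1 * E p * jeven p * S p * E p.+1 * C p.+1 * E p
  - E p * C p.+1 * E p.+1 * S p * jeven p * E p * S p.+1.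
Proof. by rewrite ejoinS /sigo /jeven /= /jm_step; case: (jm q n p). Qed.

End Recursion.

Section FunctionalForm.
Variables (n k : nat).
Local Notation T := (bits k).
Local Notation config := (nat -> T).
Local Notation A := (partalg ('X : {poly rat}) n).
Implicit Types (phi : config -> rat) (x y : A).

Lemma actDE x y phi : act (x + y) phi = fun a => act x phi a + act y phi a.
Proof. by apply: funext => a; rewrite actD. Qed.
Lemma actNE x phi : act (- x) phi = fun a => - act x phi a.
Proof. by apply: funext => a; rewrite actN. Qed.
Lemma actME x y phi : act (x * y) phi = act x (act y phi).
Proof. by apply: funext => a; rewrite actM. Qed.
Lemma act1E phi : act (1 : A) phi = phi.
Proof.
apply: funext => a; rewrite act_dbasis (dactE (F := fun _ : unit => a)) //.
- by rewrite big_const card_unit /= addr0.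
- by case=> -[].
- by move=> _; apply/colours_fibres => -[i|i] [j|j] /= ->.
move=> b /colours_fibres H; exists tt; apply: paint_eq => // j.
by rewrite -(paint_ord a); apply/esym; apply: (H (inl j) (inr j)).
Qed.
Lemma actAE phi : act ('X%:A : A) phi = fun a => ncol k * phi a.
Proof. by apply: funext => a; rewrite actZ act1E hornerX. Qed.
Lemma act_transpE p phi : (p.+1 < n)%N ->
  act (transp 'X n p) phi = fun a => phi (exch p a).
Proof. by move=> pn; apply: funext => a; rewrite act_transp. Qed.
Lemma act_ecutE p phi : (p < n)%N ->
  act (ecut 'X n p) phi = fun a => \sum_c phi (upd p c a).
Proof. by move=> pn; apply: funext => a; rewrite act_ecut. Qed.
Lemma act_ejoinE p phi : (p.+1 < n)%N ->
  act (ejoin 'X n p) phi = fun a => (a p == a p.+1)%:R * phi a.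
Proof. by move=> pn; apply: funext => a; rewrite act_ejoin. Qed.

Definition actE := (actDE, actNE, actME, act1E, actAE).

End FunctionalForm.

Lemma recolE (T : eqType) q (x y : T) a k :
  recol q x y a k = if (k < q)%N then swp x y (a k) else a k.
Proof. by []. Qed.
Lemma updE (T : eqType) p (x : T) a k : upd p x a k = if k == p then x else a k.
Proof. by []. Qed.
Lemma exchE (T : eqType) p (a : nat -> T) k :
  exch p a k = if k == p then a p.+1 else if k == p.+1 then a p else a k.
Proof. by []. Qed.

Lemma swpl (T : eqType) (x y : T) : swp x y x = y.
Proof. by rewrite /swp eqxx. Qed.
Lemma swpr (T : eqType) (x y : T) : swp x y y = x.
Proof. by rewrite /swp eqxx; case: eqP. Qed.
Lemma swpxx (T : eqType) (x y : T) : swp x x y = y.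
Proof. by rewrite /swp; case: eqP. Qed.

(* Clearing the rest of the context keeps [lia] fast. *)
Ltac natlia :=
  repeat match goal with H : is_true (leq _ _) |- _ => revert H end;
  clear; intros; lia.

Ltac natcmp := repeat match goal with
  | |- context [leq ?m ?q] =>
     first [rewrite (_ : leq m q = true); last natlia | rewrite (_ : leq m q = false); last natlia]
  | |- context [@eq_op Datatypes_nat__canonical__eqtype_Equality ?m ?q] =>
     first [rewrite (_ : (@eq_op Datatypes_nat__canonical__eqtype_Equality m q) = true); last natlia
           | rewrite (_ : (@eq_op Datatypes_nat__canonical__eqtype_Equality m q) = false); last natlia]
  end.

Ltac evalpos := rewrite ?(recolE, updE, exchE); natcmp;
  rewrite ?(swpl, swpr, swpxx).

Ltac swpcase :=
  repeat match goal with H : is_true (_ != _) |- _ => move/eqP: H => H end;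
  rewrite /swp; repeat match goal with |- context [@eq_op ?T ?x ?y] =>
    lazymatch constr:((x, y)) with
    | context [if _ then _ else _] => fail
    | _ => case: (@eqP T x y) => ?; cbv iota end end;
  subst; try done; try congruence.

(* At most the positions p, p+1 and p+2 need separate treatment. *)
Ltac config p := let j := fresh "j" in
  apply: funext => j;
  (have [?|[?|[?|[?|?]]]] : (j < p)%N \/ j = p \/ j = p.+1 \/ j = p.+2 \/ (p.+2 < j)%N
     by natlia); subst; cbv beta delta [recol upd exch]; natcmp; cbv beta iota;
  rewrite ?(swpl, swpr, swpxx); try done; try (by swpcase).

Lemma sum_delta (T : finType) (F : T -> rat) y : \sum_x (x == y)%:R * F x = F y.
Proof.
by rewrite (bigD1 y) //= eqxx mul1r big1 ?addr0 // => x /negbTE->; rewrite mul0r.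
Qed.
Lemma sum_pick (T : finType) (P : pred T) (F : T -> rat) y :
  (forall x, P x = (x == y)) -> \sum_x (P x)%:R * F x = F y.
Proof. by move=> Py; under eq_bigr do rewrite Py; rewrite sum_delta. Qed.
Lemma sum_deltar (T : finType) (F : T -> rat) y : \sum_x (y == x)%:R * F x = F y.
Proof. by under eq_bigr do rewrite eq_sym; rewrite sum_delta. Qed.

Lemma swpC (T : eqType) (x y z : T) : swp x y z = swp y x z.
Proof. by swpcase. Qed.

Lemma recolC (T : eqType) q (x y : T) a : recol q x y a = recol q y x a.
Proof. by apply: funext => j; rewrite /recol swpC. Qed.

Lemma recol_id (T : eqType) q (x : T) a : recol q x x a = a.
Proof. by apply: funext => j; rewrite /recol swpxx; case: ifP. Qed.

Lemma exchK (T : eqType) p (a : nat -> T) : exch p (exch p a) = a.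
Proof. by config p. Qed.

Lemma exch_id (T : eqType) p (a : nat -> T) : a p = a p.+1 -> exch p a = a.
Proof. by move=> E; config p. Qed.

Ltac colcase x y E :=
  case: (eqVneq x y) => [E|E]; rewrite /= ?mulr1n ?mulr0n ?mul1r ?mul0r.

Ltac congr_config p := match goal with
  |- ?phi ?a = ?phi ?b => congr (phi _); by config p end.

Ltac unify_configs phi p b := repeat match goal with
  |- context [phi ?c] =>
    assert_fails (constr_eq c b); rewrite (_ : c = b); last (by config p) end.

(** Explicit operators for the recursively defined elements. The many terms of the
    recursion for sigma correct the leading one when the colour at p equals one of
    the next two; otherwise they all vanish. *)
Lemma jm_act n k p (phi : (nat -> bits k) -> rat) : (p.+1 < n)%N ->
  [/\ act (jodd 'X n p) phi =
        (fun a => ncol k * phi a - \sum_c phi (recol p (a p) c a)),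
      act (jeven 'X n p) phi = (fun a => \sum_c phi (recol p.+1 (a p) c a)),
      act (sige 'X n p) phi = (fun a => phi (recol p (a p) (a p.+1) a)) &
      act (sigo 'X n p) phi = (fun a => phi (recol p.+2 (a p) (a p.+1) a))].
Proof.
elim: p phi => [|p IH] phi pn.
  split.
  - apply: funext => a; rewrite act0.
    under eq_bigr => c _.
      rewrite (_ : recol 0 (a 0) c a = a); last by apply: funext.
      over.
    by rewrite sumr_const /ncol mulr_natl subrr.
  - rewrite -[jeven 'X n 0]/(ecut 'X n 0) act_ecutE; last by lia.
    apply: funext => a; apply: eq_bigr => c _; congr phi.
    by apply: funext => j; evalpos; case: j => [|j] /=; evalpos.
  - rewrite -[sige 'X n 0]/1 act1E; apply: funext => a; congr phi; apply: funext.
  - rewrite -[sigo 'X n 0]/(transp 'X n 0) act_transpE //.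
    by apply: funext => a; congr phi; config 0%N.
have jo (psi : (nat -> bits k) -> rat) : act (jodd 'X n p) psi = fun a => ncol k * psi a - \sum_c psi (recol p (a p) c a).
  by case: (IH psi (ltnW pn)).
have je (psi : (nat -> bits k) -> rat) : act (jeven 'X n p) psi = fun a => \sum_c psi (recol p.+1 (a p) c a).
  by case: (IH psi (ltnW pn)).
have se (psi : (nat -> bits k) -> rat) : act (sige 'X n p) psi = fun a => psi (recol p (a p) (a p.+1) a).
  by case: (IH psi (ltnW pn)).
have so (psi : (nat -> bits k) -> rat) : act (sigo 'X n p) psi = fun a => psi (recol p.+2 (a p) (a p.+1) a).
  by case: (IH psi (ltnW pn)).
have ep (psi : (nat -> bits k) -> rat) := act_ejoinE psi (ltnW pn); have ep1 (psi : (nat -> bits k) -> rat) := act_ejoinE psi pn.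
have tp (psi : (nat -> bits k) -> rat) := act_transpE psi (ltnW pn); have tp1 (psi : (nat -> bits k) -> rat) := act_transpE psi pn.
have cp1 (psi : (nat -> bits k) -> rat) := act_ecutE psi (ltnW pn : (p.+1 < n)%N).
(* Words whose condition selects one summand. *)
have XE (psi : (nat -> bits k) -> rat) : act (jeven 'X n p) (act (ejoin 'X n p) psi) =
    fun a => psi (recol p.+1 (a p) (a p.+1) a).
  apply: funext => a; rewrite je ep.
  rewrite -(sum_delta (fun c => psi (recol p.+1 (a p) c a))).
  by apply: eq_bigr => c _; evalpos.
have XTE (psi : (nat -> bits k) -> rat) :
    act (jeven 'X n p) (act (transp 'X n p.+1) (act (ejoin 'X n p) psi)) =
    fun a => psi (exch p.+1 (recol p.+1 (a p) (a p.+2) a)).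
  apply: funext => a; rewrite je ep tp1.
  rewrite -(sum_delta (fun c => psi (exch p.+1 (recol p.+1 (a p) c a)))).
  by apply: eq_bigr => c _; evalpos.
have XSE (psi : (nat -> bits k) -> rat) :
    act (jeven 'X n p) (act (transp 'X n p) (act (ejoin 'X n p.+1) psi)) =
    fun a => psi (exch p (recol p.+1 (a p) (a p.+2) a)).
  apply: funext => a; rewrite je ep1 tp.
  rewrite -(sum_delta (fun c => psi (exch p (recol p.+1 (a p) c a)))).
  by apply: eq_bigr => c _; evalpos.
have JE (psi : (nat -> bits k) -> rat) : act (jodd 'X n p) (act (ejoin 'X n p) psi) =
    fun a => (a p == a p.+1)%:R * (ncol k * psi a - \sum_c psi (recol p (a p) c a)).
  apply: funext => a; rewrite jo ep mulrBr mulrCA mulr_sumr; congr (_ - _).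
  by apply: eq_bigr => c _; evalpos.
have CE (psi : (nat -> bits k) -> rat) : act (ecut 'X n p.+1) (act (ejoin 'X n p) psi) =
    fun a => psi (upd p.+1 (a p) a).
  apply: funext => a; rewrite cp1 ep.
  rewrite -(sum_deltar (fun c => psi (upd p.+1 c a))).
  by apply: eq_bigr => c _; evalpos.
have CE1 (psi : (nat -> bits k) -> rat) : act (ecut 'X n p.+1) (act (ejoin 'X n p.+1) psi) =
    fun a => psi (upd p.+1 (a p.+2) a).
  apply: funext => a; rewrite cp1 ep1.
  rewrite -(sum_delta (fun c => psi (upd p.+1 c a))).
  by apply: eq_bigr => c _; evalpos.
pose words := (XE, XTE, XSE, JE, CE, CE1).
pose gens := (jo, je, se, so, ep, ep1, tp, tp1).
split; apply: funext => a.
- rewrite joddS !actE !words !gens /=; evalpos.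
  rewrite exchK; have -> : \sum_c phi (exch p (recol p (a p.+1) c (exch p a))) =
      \sum_c phi (recol p (a p.+1) c a) by apply: eq_bigr => c _; congr_config p.
  colcase (a p) (a p.+1) E; first by rewrite E !recol_id; ring.
  rewrite (bigD1 (a p)) //= [in RHS](bigD1 (a p)) //=.
  rewrite (recolC p (a p.+1)) (recolC p.+1 (a p.+1)).
  set s1 := \sum_(i | _) _; set s2 := \sum_(i | _) _.
  suff -> : s1 = s2 by ring.
  by apply: eq_bigr => c cx; congr_config p.
- rewrite jevenS !actE !words !gens /=; evalpos.
  colcase (a p) (a p.+1) E.
    have -> : \sum_c phi (upd p.+1 (recol p.+1 (a p) c a p) (recol p.+1 (a p) c a)) =
        \sum_c phi (recol p.+2 (a p.+1) c a).
      by apply: eq_bigr => c _; evalpos; congr_config p.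
    have -> : \sum_c phi (exch p (recol p.+1 (a p.+1) c (exch p a))) =
        \sum_c phi (exch p (recol p.+1 (a p) c a)) by rewrite exch_id // E.
    by rewrite E !recol_id exch_id //; ring.
  rewrite addr0 subr0 (bigD1 (a p)) //= [in RHS](bigD1 (a p)) //=.
  rewrite (recolC p.+2 (a p.+1)).
  have -> : exch p (recol p.+1 (a p.+1) (a p) (exch p a)) =
     recol p.+1 (a p.+1) (a p) (exch p a) by config p.
  set s1 := \sum_(i | _) _; set s2 := \sum_(i | _) _.
  suff -> : s1 = s2 by ring.
  by apply: eq_bigr => c cx; congr_config p.
- rewrite sigeS !actE !words !gens /=; evalpos.
  by colcase (a p) (a p.+1) E; colcase (a p) (a p.+2) E';
    match goal with |- phi ?w + _ + _ - _ - _ = phi ?r =>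
      unify_configs phi p r; unify_configs phi p w end; ring.
- rewrite sigoS !actE !words !gens /=; evalpos.
  by colcase (a p) (a p.+1) E; colcase (a p) (a p.+2) E';
    match goal with |- phi ?w + _ + _ - _ - _ = phi ?r =>
      unify_configs phi p r; unify_configs phi p w end; ring.
Qed.

(** * Relations over the field of rational functions *)

Section Lift.
Variable n : nat.
Local Notation A := (partalg ('X : {poly rat}) n).
Implicit Types (x y : A).

Definition lift x : PA n := [ffun d => FracField.tofrac (x d : {poly rat})].

Lemma liftD x y : lift (x + y) = lift x + lift y.
Proof. by apply/ffunP => d; rewrite !ffunE rmorphD. Qed.
Lemma liftN x : lift (- x) = - lift x.
Proof. by apply/ffunP => d; rewrite !ffunE rmorphN. Qed.
Lemma lift0 : lift 0 = 0.
Proof. by apply/ffunP => d; rewrite !ffunE rmorph0. Qed.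
Lemma liftZ (c : {poly rat}) x : lift (c *: x) = (FracField.tofrac c : Qz) *: lift x.
Proof. by apply/ffunP => d; rewrite !ffunE /= rmorphM. Qed.
Lemma lift_dbasis d : lift (dbasis 'X d) = dbasis zF d.
Proof. by apply/ffunP => d'; rewrite !ffunE !dbasisE; case: eqP; rewrite ?rmorph1 ?rmorph0. Qed.
Lemma lift1 : lift 1 = 1.
Proof. exact: lift_dbasis. Qed.
Lemma lift_sum I (r : seq I) (F : I -> A) :
  lift (\sum_(i <- r) F i) = \sum_(i <- r) lift (F i).
Proof.
elim: r => [|i r IH]; first by rewrite !big_nil lift0.
by rewrite !big_cons liftD IH.
Qed.
Lemma liftM x y : lift (x * y) = lift x * lift y.
Proof.
rewrite !partalg_mulE lift_sum; apply: eq_bigr => d1 _.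
rewrite lift_sum; apply: eq_bigr => d2 _.
by rewrite liftZ lift_dbasis !ffunE !rmorphM rmorphXn.
Qed.
Lemma liftA : lift ('X%:A) = zF%:A.
Proof. by rewrite liftZ lift1. Qed.
Lemma lift_ejoin p : lift (ejoin 'X n p) = ejoin zF n p.
Proof. exact: lift_dbasis. Qed.
Lemma lift_ecut p : lift (ecut 'X n p) = ecut zF n p.
Proof. exact: lift_dbasis. Qed.
Lemma lift_transp p : lift (transp 'X n p) = transp zF n p.
Proof. exact: lift_dbasis. Qed.

Lemma lift_jm p :
  [/\ lift (jodd 'X n p) = jodd zF n p, lift (jeven 'X n p) = jeven zF n p,
      lift (sige 'X n p) = sige zF n p & lift (sigo 'X n p) = sigo zF n p].
Proof.
elim: p => [|p [IH1 IH2 IH3 IH4]].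
  split; [exact: lift0|exact: lift_dbasis|exact: lift1|exact: lift_dbasis].
by split; rewrite ?(joddS, jevenS, sigeS, sigoS)
  !(liftD, liftN, liftM, lift_ejoin, lift_ecut, lift_transp, liftA, IH1, IH2, IH3, IH4).
Qed.

Lemma lift_jodd p : lift (jodd 'X n p) = jodd zF n p. Proof. by case: (lift_jm p). Qed.
Lemma lift_jeven p : lift (jeven 'X n p) = jeven zF n p. Proof. by case: (lift_jm p). Qed.
Lemma lift_sige p : lift (sige 'X n p) = sige zF n p. Proof. by case: (lift_jm p). Qed.
Lemma lift_sigo p : lift (sigo 'X n p) = sigo zF n p. Proof. by case: (lift_jm p). Qed.

Lemma lift_eq x y :
  (forall k (phi : (nat -> bits k) -> rat), act x phi = act y phi) -> lift x = lift y.
Proof. by move=> E; congr lift; apply: act_inj => k phi a; rewrite E. Qed.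

End Lift.

Definition liftE := (liftD, liftN, liftM, lift1, liftA, lift_ejoin, lift_ecut,
  lift_transp, lift_jodd, lift_jeven, lift_sige, lift_sigo).

(** The element z - L_{2p+1}, which acts like L_{2p+2} does but fixes the
    position p. *)
HB.lock Definition jcod (K : comNzRingType) (q : K) n p : partalg q n := q%:A - jodd q n p.

Lemma lift_jcod n p : lift (jcod 'X n p) = jcod zF n p.
Proof. by rewrite !jcod.unlock !liftE. Qed.

Section JMActions.
Variables (n k p : nat) (phi : (nat -> bits k) -> rat).
Hypothesis pn : (p.+1 < n)%N.

Lemma act_jcod : act (jcod 'X n p) phi = fun a => \sum_c phi (recol p (a p) c a).
Proof.
by apply: funext => a; have [jo _ _ _] := jm_act phi pn; rewrite jcod.unlock !actE jo subKr.
Qed.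
Lemma act_jeven : act (jeven 'X n p) phi = fun a => \sum_c phi (recol p.+1 (a p) c a).
Proof. by case: (jm_act phi pn). Qed.
Lemma act_sige : act (sige 'X n p) phi = fun a => phi (recol p (a p) (a p.+1) a).
Proof. by case: (jm_act phi pn). Qed.
Lemma act_sigo : act (sigo 'X n p) phi = fun a => phi (recol p.+2 (a p) (a p.+1) a).
Proof. by case: (jm_act phi pn). Qed.
End JMActions.

(* Reduces an identity in the algebra to one between operators. *)
Ltac via_act := rewrite -!(lift_jcod, liftE); apply: lift_eq => k phi; apply: funext => a;
  rewrite !actE.

Section Relations.
Variables (n p : nat).
Hypothesis pn : (p.+1 < n)%N.
Local Notation e := (ejoin zF n p).
Local Notation f := (ecut zF n p.+1).
Local Notation g := (ecut zF n p).
Local Notation s := (transp zF n p).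
Local Notation sg := (sige zF n p).
Local Notation sg' := (sigo zF n p).
Local Notation X := (jeven zF n p).
Local Notation Y := (jcod zF n p).
Let pn' := ltnW pn.

Lemma sigK : sg * sg = 1.
Proof. by via_act; rewrite !act_sige //; congr phi; config p. Qed.

Lemma sig_ejoin : sg * e = e.
Proof.
via_act; rewrite !act_sige // !act_ejoinE //; evalpos.
by colcase (a p) (a p.+1) E => //; rewrite E recol_id.
Qed.

Lemma ejoin_sig : e * sg = e.
Proof.
via_act; rewrite !act_sige // !act_ejoinE //; evalpos.
by colcase (a p) (a p.+1) E => //; rewrite E recol_id.
Qed.

Lemma ejoin_idem : e * e = e.
Proof. by via_act; rewrite !act_ejoinE //; colcase (a p) (a p.+1) E. Qed.

Lemma transp_ejoin : s * e = e.
Proof.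
via_act; rewrite !act_transpE // !act_ejoinE //; evalpos.
by rewrite eq_sym; colcase (a p) (a p.+1) E => //; rewrite exch_id.
Qed.

Lemma ejoin_transp : e * s = e.
Proof.
via_act; rewrite !act_transpE // !act_ejoinE //; evalpos.
by colcase (a p) (a p.+1) E => //; rewrite exch_id.
Qed.

Lemma transpK : s * s = 1.
Proof. by via_act; rewrite !act_transpE // exchK. Qed.

Lemma sig_transp : sg * s = sg'.
Proof. via_act; rewrite !act_transpE // !act_sige // act_sigo //; congr_config p. Qed.

Lemma transp_sig : s * sg = sg'.
Proof. via_act; rewrite !act_transpE // !act_sige // act_sigo //; congr_config p. Qed.

Lemma transp_jcod : s * Y * s = sg * Y * sg.
Proof.
via_act; rewrite !act_transpE // !act_sige // !act_jcod //.
evalpos.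
have inv x : swp (a p) (a p.+1) (swp (a p) (a p.+1) x) = x by swpcase.
rewrite [RHS](reindex_inj (can_inj inv)); apply: eq_bigr => c _; evalpos.
by congr phi; config p.
Qed.

Ltac collapse v := rewrite (@sum_pick _ _ _ v); last by
  let c := fresh "c" in move=> c; evalpos; rewrite // eq_sym.

Lemma jeven_ejoin : X * e = sg * g * e.
Proof.
via_act; rewrite act_jeven // act_sige // act_ecutE // act_ejoinE //=.
by collapse (a p.+1); collapse (a p.+1); congr_config p.
Qed.

Lemma ejoin_jeven : e * X = e * g * sg.
Proof.
via_act; rewrite act_jeven // act_sige // act_ecutE // !act_ejoinE //=.
colcase (a p) (a p.+1) E => //; apply: eq_bigr => c _; congr_config p.
Qed.

Lemma ecut_jeven : g * X = g * Y.
Proof.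
via_act; rewrite act_jeven // act_jcod // !act_ecutE //= exchange_big.
apply: eq_bigr => c _; apply: eq_bigr => b _; evalpos; congr_config p.
Qed.

Lemma jeven_ecut : X * g = Y * g.
Proof.
via_act; rewrite act_jeven // act_jcod // !act_ecutE //=.
apply: eq_bigr => c _; apply: eq_bigr => b _; congr_config p.
Qed.

(** The two operators differ only in the summand where the colour at p becomes
    that at p+1, and when these colours agree from the start. *)
Lemma sig_jeven_sig : sg * X * sg = X + g * e + e * g - X * e - e * X.
Proof.
suff E : sg * X * sg + X * e + e * X = X + g * e + e * g.
  by rewrite -E [_ + e * X - _]addrAC !addrK.
rewrite jeven_ejoin; via_act; rewrite !act_sige // !act_jeven // !act_ecutE //.
rewrite !act_ejoinE //=; collapse (a p.+1); collapse (a p.+1); evalpos.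
under eq_bigr do evalpos.
colcase (a p) (a p.+1) E.
  have -> : upd p (a p.+1) (recol p (a p) (a p.+1) a) = upd p (a p.+1) a by config p.
  rewrite [RHS]addrC addrA addrAC; congr (_ + _ + _); apply: eq_bigr => c _; congr_config p.
rewrite !addr0 (bigD1 (a p.+1)) //= [in RHS](bigD1 (a p.+1)) //=.
have -> : recol p.+1 (a p) (a p.+1) a = upd p (a p.+1) (recol p (a p) (a p.+1) a) by config p.
have -> : recol p (a p.+1) (a p.+1) (recol p.+1 (a p) (a p.+1) (recol p (a p) (a p.+1) a)) =
  upd p (a p.+1) a by config p.
set s1 := \sum_(i | _) _; set s2 := \sum_(i | _) _.
suff -> : s1 = s2 by ring.
by apply: eq_bigr => c cx; congr_config p.
Qed.

Lemma ecut_sig_ecut : f * sg * f = Y * f.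
Proof.
via_act; rewrite !act_ecutE // act_sige // act_jcod //=; evalpos.
apply: eq_bigr => c _; apply: eq_bigr => b _; evalpos; congr_config p.
Qed.

Lemma ecut_ejoin_ecut : f * e * f = f.
Proof.
via_act; rewrite !act_ecutE // act_ejoinE //=.
by collapse (a p); apply: eq_bigr => c _; congr_config p.
Qed.

Lemma ejoin_ecut_ejoin : e * g * e = e.
Proof.
via_act; rewrite act_ecutE // !act_ejoinE //=.
by collapse (a p.+1); colcase (a p) (a p.+1) E => //; congr_config p.
Qed.

Lemma ejoin_ecut_ejoinr : e * f * e = e.
Proof.
via_act; rewrite act_ecutE // !act_ejoinE //=.
by collapse (a p); colcase (a p) (a p.+1) E => //; congr_config p.
Qed.

Lemma ecut_comm : f * g = g * f.
Proof.
via_act; rewrite !act_ecutE //= exchange_big.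
apply: eq_bigr => c _; apply: eq_bigr => b _; congr_config p.
Qed.

Lemma transp_ecut : s * g * s = f.
Proof.
via_act; rewrite !act_ecutE // !act_transpE //=.
apply: eq_bigr => c _; congr_config p.
Qed.

Lemma jeven_jcod : X * Y = Y * X.
Proof.
via_act; rewrite !act_jeven // !act_jcod // [RHS]exchange_big /=; apply: eq_bigr => b _.
have inv x : swp (a p) b (swp (a p) b x) = x by swpcase.
rewrite (reindex_inj (can_inj inv)); apply: eq_bigr => c _; evalpos; congr_config p.
Qed.

End Relations.

Section Relations3.
Variables (n p : nat).
Hypothesis pn : (p.+2 < n)%N.
Local Notation e := (ejoin zF n p).
Local Notation e' := (ejoin zF n p.+1).
Local Notation s' := (transp zF n p.+1).
Local Notation sg' := (sigo zF n p).
Let pn' := ltnW pn.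

Lemma ejoin_jcodS : e * jcod zF n p.+1 = e * jeven zF n p.
Proof.
via_act; rewrite !act_ejoinE // act_jcod // act_jeven //=.
by colcase (a p) (a p.+1) E => //; rewrite E.
Qed.

Lemma jcodS_ejoin : jcod zF n p.+1 * e = jeven zF n p * e.
Proof.
via_act; rewrite !act_ejoinE // act_jcod // act_jeven //=.
rewrite (@sum_pick _ _ _ (a p)); last first.
  move=> c; evalpos; rewrite /swp; case: (eqVneq (a p) (a p.+1)) => [-> //|].
  by case: (eqVneq (a p) c) => [->|ne /negbTE -> //]; rewrite ?eqxx // eq_sym.
rewrite (@sum_pick _ _ _ (a p.+1)); last by move=> c; evalpos.
by rewrite recolC.
Qed.

Lemma sigo_ejoin : sg' * e' = s' * e * s' * sg'.
Proof.
via_act; rewrite !act_ejoinE // !act_transpE // !act_sigo //=; evalpos.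
by rewrite exchK; congr (_ %:R * phi _); evalpos.
Qed.

Lemma ejoin_sigo_ejoin : e' * sg' * e' = e * e'.
Proof.
via_act; rewrite !act_ejoinE // !act_sigo //=; evalpos.
colcase (a p) (a p.+1) E; colcase (a p.+1) (a p.+2) E' => //.
  by rewrite E E' !recol_id eqxx mul1r.
  by case: eqP => [E2|_]; rewrite ?mul0r //; case/eqP: E; congruence.
Qed.

Lemma ejoin_comm : e * e' = e' * e.
Proof. by via_act; rewrite !act_ejoinE // mulrCA. Qed.

End Relations3.

(** * The tower of subalgebras *)

Section Tower.
Variable n : nat.
Implicit Types (d : diagram n) (j : 'I_n) (a b : {ffun 'I_n -> bool}).

Definition pos (v : vertex n) : 'I_n := match v with inl j | inr j => j end.

Definition spike j : {ffun 'I_n -> bool} := [ffun i => i == j].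

Lemma join_spike j v : join_col (spike j) (spike j) v = (pos v == j).
Proof. by case: v => i; rewrite /= ffunE. Qed.

Lemma same_blockP d x y :
  (forall a b, proper d (join_col a b) -> join_col a b x = join_col a b y) ->
  same_block d x y.
Proof.
move=> H; pose f v := same_block d x v.
have jf : join_col [ffun j => f (inl j)] [ffun j => f (inr j)] =1 f.
  by case=> j; rewrite /= ffunE.
have := H [ffun j => f (inl j)] [ffun j => f (inr j)].
rewrite !jf /f same_blockxx => <- //.
apply/Defs.properP => u v uv; rewrite !jf /f.
by rewrite ![same_block d x _]same_block_sym; apply: same_block_left.
Qed.

(** A column is a block when its two ends are joined and the two-colouring that
    singles it out is proper, which separates it from the other columns. *)
Lemma column_block d j :
  ([set inl j; inr j] \in val d) =
  proper d (join_col (spike j) (spike j)) && same_block d (inl j) (inr j).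
Proof.
have /and3P[/eqP cov triv _] := valP d.
apply/idP/andP => [B|[/Defs.properP H lr]].
  have bl v : pos v == j -> pblock (val d) v = [set inl j; inr j].
    by move=> vj; apply: def_pblock => //; case: v vj => i /= /eqP ->; rewrite !inE eqxx ?orbT.
  split; last by rewrite /same_block bl ?eqxx // !inE eqxx orbT.
  have imp x y : same_block d x y -> pos x == j -> pos y == j.
    by move=> xy /bl E; move: xy; rewrite /same_block E !inE => /orP[] /eqP-> /=.
  apply/Defs.properP => x y xy; rewrite !join_spike; apply/idP/idP; first exact: imp.
  by apply: imp; rewrite same_block_sym.
have -> : [set inl j; inr j] = pblock (val d) (inl j).
  apply/setP => v; rewrite !inE -/(same_block d (inl j) v); apply/idP/idP.
    by case/orP => /eqP -> //; rewrite same_blockxx.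
  by move/H; rewrite !join_spike eqxx; case: v => i /= /esym/eqP ->; rewrite eqxx ?orbT.
by apply: pblock_mem; rewrite cov inE.
Qed.

(** This form of membership passes to compositions at once. For odd r the two
    ends of the column of index r/2 are joined, but that column need not be a
    block. *)
Lemma towerP r d : reflect
  ((forall j a b, (r./2 <= j)%N -> proper d (join_col a b) -> a j = b j) /\
   (forall j, (uphalf r <= j)%N -> proper d (join_col (spike j) (spike j))))
  (d \in tower n r).
Proof.
have col j : same_block d (inl j) (inr j) <->
    forall a b, proper d (join_col a b) -> a j = b j.
  split=> [lr a b /Defs.properP/(_ _ _ lr) //|H]; exact: same_blockP.
rewrite inE; apply: (iffP andP) => [[/forallP H1 H2]|[H1 H2]].
  have cb j : (uphalf r <= j)%N -> proper d (join_col (spike j) (spike j)) /\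
      same_block d (inl j) (inr j).
    by move=> rj; have := H1 j; rewrite rj column_block => /andP.
  split=> j; last by case/cb.
  move=> a b rj; apply/col: a b; have [/cb[] //|jr] := leqP (uphalf r) j.
  have ro : odd r by rewrite uphalf_half in jr; case: odd jr => //; lia.
  have /forallP/(_ j)/implyP -> // := implyP H2 ro.
  by rewrite uphalf_half ro in jr *; lia.
split.
  apply/forallP => j; apply/implyP => rj; rewrite column_block H2 //=.
  apply/col => a b; apply: H1; apply: leq_trans rj; by rewrite uphalf_half leq_addl.
apply/implyP => ro; apply/forallP => j; apply/implyP => /eqP jr.
by apply/col => a b; apply: H1; move: jr; rewrite uphalf_half ro; lia.
Qed.

Lemma tower_le r r' d : (r <= r')%N -> d \in tower n r -> d \in tower n r'.
Proof.
move=> rr' /towerP[H1 H2]; apply/towerP; split=> j.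
  by move=> a b r'j; apply: H1; apply: leq_trans r'j; apply: half_leq.
by move=> r'j; apply: H2; apply: leq_trans r'j; apply: uphalf_leq.
Qed.

Lemma proper_compose d1 d2 a c : proper (compose d1 d2) (join_col a c) =
  [exists b, proper d1 (join_col a b) && proper d2 (join_col b c)].
Proof.
have := card_middle d1 d2 a c; case: existsP => [[b db] E|H E].
  apply/negPn/negP => /negbTE n12; move/eqP: E.
  by rewrite n12 muln0 (bigD1 b) //= db.
move/eqP: E; rewrite big1 => [|b _].
  by rewrite eq_sym muln_eq0 expn_eq0 /=; case: (proper _ _).
by apply/eqP; rewrite eqb0; apply/negP => db; apply: H; exists b.
Qed.

Lemma tower_compose r d1 d2 :
  d1 \in tower n r -> d2 \in tower n r -> compose d1 d2 \in tower n r.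
Proof.
move=> /towerP[H1 H2] /towerP[G1 G2]; apply/towerP; split=> j.
  move=> a c rj; rewrite proper_compose => /existsP[b /andP[ab bc]].
  by rewrite (H1 _ _ _ rj ab) (G1 _ _ _ rj bc).
move=> rj; rewrite proper_compose; apply/existsP; exists (spike j).
by rewrite H2 // G2.
Qed.

Lemma properF (S : eqType) (h : vertex n -> S) a b :
  reflect (forall x y, h x = h y -> join_col a b x = join_col a b y)
    (proper (fibres h) (join_col a b)).
Proof.
apply: (iffP (Defs.properP _ _)) => H x y; last by rewrite fibresE => /eqP/H.
by move=> /eqP; rewrite -(fibresE h) => /H.
Qed.

Lemma tower_fibres r (S : eqType) (h : vertex n -> S) :
  (forall j, (r./2 <= j)%N -> h (inl j) = h (inr j)) ->
  (forall x y, (uphalf r <= pos x)%N -> h x = h y -> pos x = pos y) ->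
  fibres h \in tower n r.
Proof.
move=> H1 H2; apply/towerP; split=> j.
  by move=> a b rj /properF/(_ (inl j) (inr j) (H1 j rj)).
move=> rj; apply/properF => x y hxy; rewrite !join_spike.
apply/eqP/eqP => E; first by rewrite -E; apply/esym/H2; rewrite // E.
by rewrite -E; apply/esym/H2; rewrite // E.
Qed.

Lemma tower_id r : id_diagram n \in tower n r.
Proof. by apply: tower_fibres => // x y; case: x; case: y. Qed.

End Tower.

Section TowerAlgebra.
Variables (K : fieldType) (q : K) (n : nat).
Local Notation TA := (tower_alg q n).
Implicit Types (x y : partalg q n) (r : nat).

Lemma mem_dbasis r d : d \in tower n r -> dbasis q d \in TA r.
Proof.
by move=> dr; apply: memv_span; apply: map_f; rewrite mem_enum.
Qed.

Lemma tower_ind r (P : partalg q n -> Prop) :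
  P 0 -> (forall c x y, P x -> P y -> P (c *: x + y)) ->
  (forall d, d \in tower n r -> P (dbasis q d)) -> forall x, x \in TA r -> P x.
Proof.
move=> P0 PD Pd x; rewrite /tower_alg => /coord_span ->.
elim/big_ind: _ => // [y z Py Pz|i _]; first by rewrite -[y]scale1r; apply: PD.
rewrite -[_ *: _]addr0; apply: PD => //.
have lt : (i < size [seq dbasis q d | d <- enum (tower n r)])%N.
  by rewrite size_map -cardE.
by have /mapP[d] := mem_nth 0 lt; rewrite mem_enum => dr ->; apply: Pd.
Qed.

Lemma tower_algM r x y : x \in TA r -> y \in TA r -> x * y \in TA r.
Proof.
move=> xr yr; move: x xr; apply: tower_ind => [|c x x' IH IH'|d dr].
- by rewrite mul0r mem0v.
- by rewrite mulrDl -scalerAl memvD ?memvZ.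
move: y yr; apply: tower_ind => [|c x x' IH IH'|d' d'r].
- by rewrite mulr0 mem0v.
- by rewrite mulrDr -scalerAr memvD ?memvZ.
by rewrite dbasisM memvZ // mem_dbasis // tower_compose.
Qed.

Lemma tower_alg1 r : 1 \in TA r.
Proof. exact/mem_dbasis/tower_id. Qed.

Lemma tower_algX r x m : x \in TA r -> x ^+ m \in TA r.
Proof.
by move=> xr; elim: m => [|m IH]; rewrite ?expr0 ?tower_alg1 // exprS tower_algM.
Qed.

Lemma tower_alg_le r r' x : (r <= r')%N -> x \in TA r -> x \in TA r'.
Proof.
move=> rr'; move: x; apply: tower_ind => [|c x y Hx Hy|d dr]; rewrite ?mem0v ?memvD ?memvZ //.
exact/mem_dbasis/(tower_le rr').
Qed.

Lemma mem_transp p r : (2 * p + 4 <= r)%N -> transp q n p \in TA r.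
Proof.
move=> pr; apply: mem_dbasis; apply: tower_fibres => [j rj|x y] /=.
  by do 2?[case: eqP => ?]; lia.
move=> rx; case: x y rx => [x|x] [y|y] rx /=; repeat (case: eqP => ?);
  by move=> ?; apply: ord_inj; move: rx => /=; lia.
Qed.

Lemma mem_ecut p r : (2 * p + 2 <= r)%N -> ecut q n p \in TA r.
Proof.
move=> pr; have o : odd (2 * p + 1) by lia.
have h : uphalf (2 * p + 1) = p.+1 by lia.
rewrite /ecut /e_ o h; apply: mem_dbasis; apply: tower_fibres => [j rj|x y] /=.
  by congr (_, _); case: eqP => //; lia.
by move=> rx; case: x y rx => [x|x] [y|y] rx [xy] *; apply: ord_inj.
Qed.

Lemma mem_ejoin p r : (2 * p + 4 <= r)%N -> ejoin q n p \in TA r.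
Proof.
move=> pr; have o : odd (2 * p.+1) = false by lia.
have h : (2 * p.+1)./2 = p.+1 by lia.
rewrite /ejoin /e_ o h; apply: mem_dbasis; apply: tower_fibres => [j rj|x y] //=.
move=> rx; case: x y rx => [x|x] [y|y] rx /=; repeat (case: eqP => ?);
  by move=> ?; apply: ord_inj; move: rx => /=; lia.
Qed.

Lemma mem_jm p : [/\ jodd q n p \in TA (2 * p + 2), jeven q n p \in TA (2 * p + 2),
  sige q n p \in TA (2 * p + 4) & sigo q n p \in TA (2 * p + 4)].
Proof.
elim: p => [|p [IH1 IH2 IH3 IH4]].
  split; [exact: mem0v|exact: (mem_ecut (p := 0))|exact: tower_alg1|exact: (mem_transp (p := 0))].
have Lo r : (2 * p + 2 <= r)%N -> jodd q n p \in TA r by move/tower_alg_le; apply.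
have Le r : (2 * p + 2 <= r)%N -> jeven q n p \in TA r by move/tower_alg_le; apply.
have Se r : (2 * p + 4 <= r)%N -> sige q n p \in TA r by move/tower_alg_le; apply.
have So r : (2 * p + 4 <= r)%N -> sigo q n p \in TA r by move/tower_alg_le; apply.
have Te := mem_ejoin; have Tc := mem_ecut; have Tt := mem_transp.
have T1 := tower_alg1.
split; rewrite ?(joddS, jevenS, sigeS, sigoS);
  by repeat (first [apply: memvD | rewrite memvN | apply: tower_algM | apply: memvZ]);
     first [apply: Lo | apply: Le | apply: Se | apply: So | apply: Te | apply: Tc | apply: Tt
           | apply: T1]; lia.
Qed.

Lemma mem_jodd p r : (2 * p + 2 <= r)%N -> jodd q n p \in TA r.
Proof. by move/tower_alg_le; apply; case: (mem_jm p). Qed.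
Lemma mem_jeven p r : (2 * p + 2 <= r)%N -> jeven q n p \in TA r.
Proof. by move/tower_alg_le; apply; case: (mem_jm p). Qed.
Lemma mem_jcod p r : (2 * p + 2 <= r)%N -> jcod q n p \in TA r.
Proof.
by move=> pr; rewrite jcod.unlock memvB ?mem_jodd // memvZ // tower_alg1.
Qed.

End TowerAlgebra.

(** * Commutation with the tower *)

Section Equivariance.
Variables (n r : nat).
Implicit Types d : diagram n.

Lemma tower_same_column d x y : d \in tower n r -> (uphalf r <= pos x)%N ->
  same_block d x y -> pos y = pos x.
Proof.
move=> /towerP[_ H] rx /(Defs.properP _ _ (H _ rx)).
by rewrite !join_spike eqxx => /esym/eqP.
Qed.

Variable T : eqType.
Implicit Types (a b : nat -> T).

Lemma tower_fixed d a b (j : 'I_n) : d \in tower n r -> (r./2 <= j)%N ->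
  colours d (rows a b) -> a j = b j.
Proof.
move=> /towerP[H _] rj /coloursP/(_ (inl j) (inr j)); apply.
by apply: same_blockP => c c'; apply: H.
Qed.

Lemma colours_recolour d (pi : T -> T) a b a' b' : d \in tower n r ->
  (forall j, (j < uphalf r)%N -> a' j = pi (a j)) ->
  (forall j, (j < uphalf r)%N -> b' j = pi (b j)) ->
  (forall j, (uphalf r <= j < n)%N -> a' j = b' j) ->
  colours d (rows a b) -> colours d (rows a' b').
Proof.
move=> dr Ha Hb Hab /coloursP H; apply/coloursP => x y xy.
have out (v : vertex n) : (uphalf r <= pos v)%N -> rows a' b' v = a' (pos v).
  by case: v => j //= rj; apply/esym/Hab; rewrite rj ltn_ord.
have inn (v : vertex n) : (pos v < uphalf r)%N -> rows a' b' v = pi (rows a b v).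
  by case: v => j /= jr; rewrite (Ha, Hb).
have [rx|xr] := leqP (uphalf r) (pos x).
  by have E := tower_same_column dr rx xy; rewrite (out x) // (out y) E.
have [ry|yr] := leqP (uphalf r) (pos y).
  rewrite same_block_sym in xy; have E := tower_same_column dr ry xy.
  by rewrite ltnNge E ry in xr.
by rewrite !inn // (H _ _ xy).
Qed.

End Equivariance.

(** Operators that see the positions below (r+1)/2 only up to an involutive
    change of colours, which like all their other data depends only on the
    positions from r/2 on. A diagram of the tower at r touches neither. *)
Definition peripheral n k r (O : ((nat -> bits k) -> rat) -> (nat -> bits k) -> rat) :=
  exists (I : finType) (w : I -> (nat -> bits k) -> rat)
    (h : I -> (nat -> bits k) -> nat -> bits k)
    (pi : I -> (nat -> bits k) -> bits k -> bits k),
  [/\ forall phi a, O phi a = \sum_i w i a * phi (h i a),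
      forall i a b, (forall j, (r./2 <= j)%N -> a j = b j) ->
        [/\ w i a = w i b, pi i a = pi i b & forall j, (uphalf r <= j)%N -> h i a j = h i b j],
      forall i a j, (j < uphalf r)%N -> h i a j = pi i a (a j),
      forall i a, involutive (pi i a) &
      forall i a j, (n <= j)%N -> h i a j = a j].

(** Recolouring the top and the bottom row simultaneously is a bijection between
    the proper colourings over a and those over its image. *)
Lemma dact_peripheral n k r d (O : ((nat -> bits k) -> rat) -> (nat -> bits k) -> rat) phi a :
  peripheral n r O -> d \in tower n r ->
  dact (n := n) d (O phi) a = O (dact d phi) a.
Proof.
move=> [I [w [h [pi [OE dep low inv out]]]]] dr.
rewrite OE /dact; under eq_bigr do rewrite OE.
rewrite exchange_big; apply: eq_bigr => i _ /=.
have agree (b : {ffun 'I_n -> bits k}) : colours d (rows a (paint a b)) -> forall j, (r./2 <= j)%N -> a j = paint a b j.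
  move=> col j rj; have [jn|nj] := ltnP j n; last by rewrite paint_out.
  exact: (tower_fixed dr (j := Ordinal jn) rj col).
pose F (b : {ffun 'I_n -> bits k}) : {ffun 'I_n -> bits k} :=
  [ffun j : 'I_n => h i (paint a b) j].
pose G (b : {ffun 'I_n -> bits k}) : {ffun 'I_n -> bits k} :=
  [ffun j : 'I_n => if (j < uphalf r)%N then pi i a (b j) else a j].
have hF (b : {ffun 'I_n -> bits k}) : paint (h i a) (F b) = h i (paint a b).
  apply: paint_eq => [j|j nj]; first by rewrite ffunE.
  by rewrite !out // paint_out.
have half : (r./2 <= uphalf r)%N by rewrite uphalf_half leq_addl.
have agreeG (b : {ffun 'I_n -> bits k}) : colours d (rows (h i a) (paint (h i a) b)) ->
    forall j, (r./2 <= j)%N -> a j = paint a (G b) j.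
  move=> col j rj; have [jn|nj] := ltnP j n; last by rewrite paint_out.
  have := tower_fixed dr (j := Ordinal jn) rj col.
  rewrite (paint_ord _ _ (Ordinal jn)) (paint_ord a (G b) (Ordinal jn)) ffunE /=.
  by case: ltnP => // jr <-; rewrite low // inv.
have FG (b : {ffun 'I_n -> bits k}) : colours d (rows (h i a) (paint (h i a) b)) -> F (G b) = b.
  move=> col; have := agreeG _ col => /(dep i)[_ Epi Eh].
  apply/ffunP => j; rewrite ffunE; have [jr|rj] := ltnP j (uphalf r).
    by rewrite low // -Epi paint_ord ffunE jr inv.
  rewrite -Eh //; have := tower_fixed dr (leq_trans half rj) col.
  by rewrite paint_ord.
rewrite mulr_sumr [RHS](reindex_onto F G FG).
apply: eq_big => b; last first.
  by move=> col; rewrite hF; have [-> _ _] := dep i _ _ (agree _ col).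
rewrite hF; apply/idP/andP => [col|[col /eqP GF]].
  have [_ Epi Eh] := dep i _ _ (agree _ col); split.
    apply: colours_recolour dr _ _ _ col => [j|j|j /andP[rj _]]; last exact: Eh.
      exact: low.
    by move=> jr; rewrite low // Epi.
  apply/eqP/ffunP => j; rewrite !ffunE; case: ltnP => [jr|rj].
    by rewrite low // -Epi inv paint_ord.
  by rewrite (agree _ col) ?paint_ord // (leq_trans half).
have E0 := agreeG (F b); rewrite hF GF in E0; have {}E0 := E0 col; have [_ Epi _] := dep i _ _ E0.
apply: (colours_recolour (pi := pi i a)) dr _ _ _ col => [j jr|j jr|j /andP[rj _]].
- by rewrite low // inv.
- by rewrite low // -Epi inv.
by apply: E0; apply: leq_trans half rj.
Qed.

Lemma tower_comm n r (x : partalg ('X : {poly rat}) n) y :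
  (forall k, peripheral n r (fun phi : (nat -> bits k) -> rat => act x phi)) ->
  y \in tower_alg zF n r -> y * lift x = lift x * y.
Proof.
move=> per; move: y; apply: tower_ind => [|c y z Hy Hz|d dr].
- by rewrite mul0r mulr0.
- by rewrite mulrDl mulrDr -scalerAl -scalerAr Hy Hz.
rewrite -lift_dbasis -!liftM; apply: lift_eq => k phi; apply: funext => a.
rewrite !actM act_dbasis (dact_peripheral _ _ (per k) dr).
by congr (act x _ a); apply: funext => b; rewrite act_dbasis.
Qed.

Lemma swpK (T : eqType) (x y : T) : involutive (swp x y).
Proof. by move=> z; swpcase. Qed.

Section CommInstances.
Variables (n p r : nat) (y : PA n).
Hypothesis yr : y \in tower_alg zF n r.

Lemma comm_jeven : (p.+1 < n)%N -> (r <= 2 * p + 1)%N ->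
  y * jeven zF n p = jeven zF n p * y.
Proof.
move=> pn rp; rewrite -lift_jeven; apply: tower_comm yr => k.
exists (bits k), (fun _ _ => 1), (fun c a => recol p.+1 (a p) c a), (fun c a => swp (a p) c).
split.
- by move=> phi a; rewrite act_jeven //; apply: eq_bigr => c _; rewrite mul1r.
- move=> c a b ab; have abp : a p = b p by apply: ab; lia.
  split=> //; first by rewrite abp.
  by move=> j rj; rewrite /recol abp ab //; lia.
- by move=> c a j jr; rewrite /recol ifT //; lia.
- by move=> c a; apply: swpK.
- by move=> c a j nj; rewrite /recol ifF //; lia.
Qed.

Lemma comm_jcod : (p.+1 < n)%N -> (r <= 2 * p)%N ->
  y * jcod zF n p = jcod zF n p * y.
Proof.
move=> pn rp; rewrite -lift_jcod; apply: tower_comm yr => k.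
exists (bits k), (fun _ _ => 1), (fun c a => recol p (a p) c a), (fun c a => swp (a p) c).
split.
- by move=> phi a; rewrite act_jcod //; apply: eq_bigr => c _; rewrite mul1r.
- move=> c a b ab; have abp : a p = b p by apply: ab; lia.
  split=> //; first by rewrite abp.
  by move=> j rj; rewrite /recol abp ab //; lia.
- by move=> c a j jr; rewrite /recol ifT //; lia.
- by move=> c a; apply: swpK.
- by move=> c a j nj; rewrite /recol ifF //; lia.
Qed.

Lemma comm_sigo : (p.+1 < n)%N -> (r <= 2 * p + 1)%N ->
  y * sigo zF n p = sigo zF n p * y.
Proof.
move=> pn rp; rewrite -lift_sigo; apply: tower_comm yr => k.
exists unit, (fun _ _ => 1), (fun _ a => recol p.+2 (a p) (a p.+1) a),
  (fun _ a => swp (a p) (a p.+1)).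
split.
- by move=> phi a; rewrite act_sigo // big_const card_unit /= addr0 mul1r.
- move=> c a b ab; have abp : a p = b p by apply: ab; lia.
  have abp1 : a p.+1 = b p.+1 by apply: ab; lia.
  split=> //; first by rewrite abp abp1.
  by move=> j rj; rewrite /recol abp abp1 ab //; lia.
- by move=> c a j jr; rewrite /recol ifT //; lia.
- by move=> c a; apply: swpK.
- by move=> c a j nj; rewrite /recol ifF //; lia.
Qed.

Lemma comm_transp : (p.+1 < n)%N -> (r <= 2 * p)%N ->
  y * transp zF n p = transp zF n p * y.
Proof.
move=> pn rp; rewrite -lift_transp; apply: tower_comm yr => k.
exists unit, (fun _ _ => 1), (fun _ a => exch p a), (fun _ a => id).
split=> //.
- by move=> phi a; rewrite act_transpE // big_const card_unit /= addr0 mul1r.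
- move=> c a b ab; split=> // j rj.
  by rewrite /exch; do 2?[case: ifP => _]; apply: ab; lia.
- by move=> c a j jr; rewrite /exch !ifF //; lia.
- by move=> c a j nj; rewrite /exch !ifF //; lia.
Qed.

Lemma comm_ecut : (p < n)%N -> (r <= 2 * p)%N ->
  y * ecut zF n p = ecut zF n p * y.
Proof.
move=> pn rp; rewrite -lift_ecut; apply: tower_comm yr => k.
exists (bits k), (fun _ _ => 1), (fun c a => upd p c a), (fun _ a => id).
split=> //.
- by move=> phi a; rewrite act_ecutE //; apply: eq_bigr => c _; rewrite mul1r.
- move=> c a b ab; split=> // j rj.
  by rewrite /upd; case: ifP => // _; apply: ab; lia.
- by move=> c a j jr; rewrite /upd ifF //; lia.
- by move=> c a j nj; rewrite /upd ifF //; lia.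
Qed.

Lemma comm_ejoin : (p.+1 < n)%N -> (r <= 2 * p + 1)%N ->
  y * ejoin zF n p = ejoin zF n p * y.
Proof.
move=> pn rp; rewrite -lift_ejoin; apply: tower_comm yr => k.
exists unit, (fun _ a => (a p == a p.+1)%:R), (fun _ a => a), (fun _ a => id).
split=> //.
- by move=> phi a; rewrite act_ejoinE // big_const card_unit /= addr0.
- move=> c a b ab; split=> //; first by rewrite !ab //; lia.
  by move=> j rj; apply: ab; lia.
Qed.

End CommInstances.

Lemma ejoin_jcod n p : (p.+1 < n)%N ->
  ejoin zF n p * jcod zF n p = jcod zF n p * ejoin zF n p.
Proof.
move=> pn; via_act; rewrite !act_jcod // !act_ejoinE // mulr_sumr.
by apply: eq_bigr => c _; evalpos.
Qed.

(** * Compression by the generators *)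

Section Compression.
Variables (n : nat).
Implicit Types (d : diagram n) (a b : {ffun 'I_n -> bool}).

Definition cutd (p : nat) : diagram n := e_odd_diagram n p.+1.
Definition joind (p : nat) : diagram n := e_even_diagram n p.+1.

Lemma proper_cutd p a b : proper (cutd p) (join_col a b) =
  [forall j : 'I_n, ((j : nat) != p) ==> (a j == b j)].
Proof.
apply/properF/forallP => [H j|H x y].
  by apply/implyP => /negbTE jp; apply/eqP/(H (inl j) (inr j)); rewrite /= eqSS jp.
have {}H (j : 'I_n) : (j : nat) != p -> a j = b j by move=> jp; apply/eqP/(implyP (H j)).
case: x y => [x|x] [y|y] /= /eqP; rewrite xpair_eqE !eqSS => /andP[/eqP/ord_inj -> //].
  by move=> /eqP yp; apply: H; rewrite -yp.
by move=> /eqP yp; apply/esym/H; rewrite yp.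
Qed.

Lemma proper_joind p (p0 p1 : 'I_n) a b : p0 = p :> nat -> p1 = p.+1 :> nat ->
  proper (joind p) (join_col a b) = (a == b) && (a p0 == a p1).
Proof.
move=> E0 E1; apply/properF/andP => [H|[/eqP <- /eqP a01] x y].
  split; first by apply/eqP/ffunP => j; apply: (H (inl j) (inr j)).
  by apply/eqP/(H (inl p0) (inl p1)) => /=; rewrite E0 E1 eqxx; case: eqP; lia.
have R (j : 'I_n) : a (if j.+1 == p.+2 then p0 else j) = a j.
  by case: eqP => // -[jp]; rewrite a01; congr (a _); apply: ord_inj; rewrite E1.
have R' (i j : 'I_n) : (if i.+1 == p.+2 then p.+1 else i.+1) =
    (if j.+1 == p.+2 then p.+1 else j.+1) -> a i = a j.
  move=> ij; rewrite -[LHS]R -[RHS]R; congr (a _); apply: ord_inj; move: ij.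
  by do 2!case: ifP => _ //=; rewrite ?E0; lia.
by case: x y => [x|x] [y|y] /= /R'.
Qed.

Lemma same_block_pblock d x y :
  (pblock (val d) x == pblock (val d) y) = same_block d x y.
Proof.
apply/eqP/idP => [E|xy]; first by rewrite /same_block E; apply: same_blockxx.
by apply/setP => z; apply: same_block_left.
Qed.

Definition off p (v : vertex n) : bool := (pos v : nat) != p.

(** Freeing the two ends of the column p leaves only the constraints between the
    other columns. *)
Lemma compress_cut p d : (p < n)%N -> d \in tower n (2 * p + 2) ->
  exists2 d', d' \in tower n (2 * p) &
    compose (compose (cutd p) d) (cutd p) = compose d' (cutd p).
Proof.
move=> pn dt.
have u2 : uphalf (2 * p + 2) = p.+1 by lia.
have h2 : (2 * p + 2)./2 = p.+1 by lia.
(* The block of the column p is emptied and that column becomes a block. *)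
pose F v := if off p v then Some (pblock (val d) v) else None.
have FP x y : F x = F y -> off p x = off p y /\ (off p x -> same_block d x y).
  rewrite /F; case: (off p x); case: (off p y) => // -[/eqP].
  by rewrite same_block_pblock.
have FE x y : off p x -> off p y -> same_block d x y -> F x = F y.
  by move=> xp yp; rewrite /F xp yp -same_block_pblock => /eqP ->.
have onp x y : ~~ off p x -> ~~ off p y -> pos x = pos y.
  by rewrite !negbK => /eqP xp /eqP yp; apply: ord_inj; rewrite xp yp.
have [H1 _] := towerP _ _ dt.
exists (fibres F).
  apply: tower_fibres => [j rj|x y rx Fxy].
    have [jp|jp] := boolP (off p (inl j)); last by rewrite /F -[off p (inr j)]/(off p (inl j)) (negbTE jp).
    apply: FE => //; apply: same_blockP => a b; apply: H1.
    by rewrite h2; move: jp; rewrite /off /=; lia.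
  have [E xy] := FP _ _ Fxy; have [xp|xp] := boolP (off p x); last by apply: onp; rewrite -?E.
  apply/esym/(tower_same_column dt _ (xy xp)); move: xp; rewrite u2 /off; lia.
apply: proper_eq => a b; rewrite !proper_compose; apply/existsP/existsP => -[x].
  rewrite proper_compose => /andP[/existsP[y /andP[ay yx]] xb].
  exists [ffun j : 'I_n => if (j : nat) == p then a j else b j]; apply/andP; split; last first.
    by rewrite proper_cutd; apply/forallP => j; apply/implyP => /negbTE jp; rewrite ffunE jp.
  apply/properF => u v /FP[E uv].
  have inn w : ~~ off p w -> join_col a [ffun j : 'I_n => if (j : nat) == p then a j else b j] w
      = a (pos w).
    by case: w => j; rewrite /off /= negbK ?ffunE // => ->.
  have out w : off p w -> join_col a [ffun j : 'I_n => if (j : nat) == p then a j else b j] w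
      = join_col y x w.
    rewrite !proper_cutd in ay xb; case: w => j; rewrite /off /= => jp.
      by apply/eqP/(implyP (forallP ay j)).
    by rewrite ffunE (negbTE jp); apply/esym/eqP/(implyP (forallP xb j)).
  have [up|up] := boolP (off p u); last by rewrite !inn -?E // (onp u v) -?E.
  by rewrite !out -?E //; apply: (Defs.properP _ _ yx); apply: uv.
case/andP=> /properF ax xb.
(* A block that meets the column p inherits the colour of its other vertices. *)
pose f := join_col a x.
pose G v := if off p v then f v else [exists w, [&& off p w, same_block d v w & f w]].
have jG : join_col [ffun j => G (inl j)] [ffun j => G (inr j)] =1 G.
  by case=> j; rewrite /= ffunE.
have Gd : proper d (join_col [ffun j => G (inl j)] [ffun j => G (inr j)]).
  have fd u v : off p u -> off p v -> same_block d u v -> f u = f v.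
    by move=> up vp uv; apply/ax/FE.
  have mix u v : off p u -> ~~ off p v -> same_block d u v -> G u = G v.
    move=> up vp uv; rewrite /G up (negbTE vp); apply/idP/existsP => [fu|[w /and3P[wp vw fw]]].
      by exists u; rewrite up same_block_sym uv.
    by rewrite (fd u w) // (same_block_left _ uv).
  apply/Defs.properP => u v uv; rewrite !jG.
  have [up|up] := boolP (off p u); have [vp|vp] := boolP (off p v).
  - by rewrite /G up vp; apply: fd.
  - exact: mix.
  - by apply/esym/mix; rewrite // same_block_sym.
  rewrite /G (negbTE up) (negbTE vp); apply: eq_existsb => w.
  by rewrite (same_block_left _ uv).
exists [ffun j => G (inr j)]; apply/andP; split; last first.
  move: xb; rewrite !proper_cutd => xb; apply/forallP => j; apply/implyP => jp.
  by rewrite ffunE /G /off /= jp; apply: (implyP (forallP xb j)).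
rewrite proper_compose; apply/existsP; exists [ffun j => G (inl j)].
rewrite Gd andbT proper_cutd; apply/forallP => j; apply/implyP => jp.
by rewrite ffunE /G /off /= jp.
Qed.

(** Comparing the positions p and p+1 on both sides forces the two ends of the
    column p to agree, since the column p+1 is untouched by d. *)
Lemma compress_join p d : (p.+1 < n)%N -> d \in tower n (2 * p + 2) ->
  exists2 d', d' \in tower n (2 * p + 1) &
    compose (compose (joind p) d) (joind p) = compose d' (joind p).
Proof.
move=> pn dt.
have u2 : uphalf (2 * p + 2) = p.+1 by lia.
have h2 : (2 * p + 2)./2 = p.+1 by lia.
have u1 : uphalf (2 * p + 1) = p.+1 by lia.
have h1 : (2 * p + 1)./2 = p by lia.
pose p0 := Ordinal (ltnW pn); pose p1 := Ordinal pn.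
(* The blocks of the two vertices of the column p are merged. *)
pose hit v := same_block d (inl p0) v || same_block d (inr p0) v.
pose F v := if hit v then None else Some (pblock (val d) v).
have [H1 H2] := towerP _ _ dt.
have hitE x y : same_block d x y -> hit x = hit y.
  by move=> xy; rewrite /hit ![same_block d _ x]same_block_sym ![same_block d _ y]same_block_sym
    !(same_block_left _ xy).
have FP a b : proper (fibres F) (join_col a b) = proper d (join_col a b) && (a p0 == b p0).
  apply/properF/andP => [H|[/Defs.properP H /eqP ab] x y].
    split; last first.
      by apply/eqP/(H (inl p0) (inr p0)); rewrite /F /hit !same_blockxx orbT.
    apply/Defs.properP => x y xy; apply: H; rewrite /F (hitE _ _ xy); case: ifP => // _.
    by congr Some; apply/eqP; rewrite same_block_pblock.
  have hitc v : hit v -> join_col a b v = a p0.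
    by case/orP => /H <- //=; rewrite -ab.
  rewrite /F; case: ifP => hx; case: ifP => hy //; first by rewrite !hitc.
  by case=> /eqP; rewrite same_block_pblock => /H.
exists (fibres F).
  apply/towerP; split=> j; rewrite ?u1 ?h1; [move=> a b rj|move=> rj].
    rewrite FP => /andP[dab /eqP ab]; have [jp|pj] := leqP j p.
      by rewrite (_ : j = p0) //; apply: ord_inj => /=; lia.
    by apply: H1 dab; rewrite h2.
  by rewrite FP H2 ?eqxx // u2.
apply: proper_eq => a b; rewrite !proper_compose; apply/existsP/existsP => -[x].
  rewrite proper_compose (@proper_joind _ p0 p1) // => /andP[/existsP[y /andP[]]].
  rewrite (@proper_joind _ p0 p1) // => /andP[/eqP <- /eqP a01] ax /andP[/eqP <- /eqP x01].
  exists x; rewrite (@proper_joind _ p0 p1) // FP ax x01 !eqxx /= a01 !andbT.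
  by apply/eqP/(H1 _ _ _ _ ax); rewrite h2.
rewrite FP (@proper_joind _ p0 p1) // => /andP[/andP[ax /eqP a0] /andP[/eqP <- /eqP x01]].
exists x; rewrite proper_compose (@proper_joind _ p0 p1) // x01 !eqxx !andbT.
apply/existsP; exists a; rewrite (@proper_joind _ p0 p1) // eqxx ax andbT /= a0 x01.
by apply/eqP/esym/(H1 _ _ _ _ ax); rewrite h2.
Qed.

(** A diagram of the smaller algebra fixes the column p, so that the colour which
    [cutd p] forgets can be recovered from the top row. *)
Lemma compose_cutd_inj p d d' : (p < n)%N ->
  d \in tower n (2 * p) -> d' \in tower n (2 * p) ->
  compose d (cutd p) = compose d' (cutd p) -> d = d'.
Proof.
move=> pn dt d't E; pose p0 := Ordinal pn.
have R c a b : c \in tower n (2 * p) -> proper c (join_col a b) =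
    proper (compose c (cutd p)) (join_col a b) && (a p0 == b p0).
  move=> /towerP[H1 _]; rewrite proper_compose.
  have h : (2 * p)./2 = p by lia.
  apply/idP/andP => [cab|[/existsP[x /andP[cax]]]].
    split; last by apply/eqP/(H1 _ _ _ _ cab); rewrite h.
    by apply/existsP; exists b; rewrite cab proper_cutd; apply/forallP => j; rewrite eqxx implybT.
  rewrite proper_cutd => /forallP xb /eqP ab.
  suff -> : b = x by [].
  apply/ffunP => j; have := xb j; case: (eqVneq (j : nat) p) => [jp _|_ /eqP //].
  have -> : j = p0 by apply: ord_inj.
  by rewrite -ab; apply: H1 cax; rewrite h.
by apply: proper_eq => a b; rewrite (R d) // (R d') // E.
Qed.

End Compression.

(** * Laurent series *)

Section Laurent.
Variable R : nzRingType.
Implicit Types (F G : laurent R) (a b : R).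

Lemma lconstD a b : lconst (a + b) = lconst a + lconst b.
Proof. by apply: laurentP => k /=; case: ifP; rewrite ?addr0. Qed.
Lemma lconstN a : lconst (- a) = - lconst a.
Proof. by apply: laurentP => k /=; case: ifP; rewrite ?oppr0. Qed.
Lemma lconst1 : lconst 1 = 1 :> laurent R.
Proof. by []. Qed.
Lemma lconstMl a F k : (lconst a * F) k = a * F k.
Proof. by rewrite [LHS]lmonomMl subr0. Qed.
Lemma lconstMr a F k : (F * lconst a) k = F k * a.
Proof. by rewrite [LHS]lmonomMr subr0. Qed.
Lemma lconstM a b : lconst (a * b) = lconst a * lconst b.
Proof. by apply: laurentP => k; rewrite lconstMl /=; case: ifP; rewrite ?mulr0. Qed.

Lemma lvarMl F k : (lvar * F) k = F (k + 1).
Proof. by rewrite [LHS]lmonomMl mul1r opprK. Qed.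
Lemma lvarMr F k : (F * lvar) k = F (k + 1).
Proof. by rewrite [LHS]lmonomMr mulr1 opprK. Qed.
Lemma lvarC F : lvar * F = F * lvar.
Proof. by apply: laurentP => k; rewrite lvarMl lvarMr. Qed.

Lemma lunitP F G : G * F = 1 -> F * G = 1 -> F \is a GRing.unit.
Proof. by move=> GF FG; apply/asboolP; exists G. Qed.

Lemma linvP F G : G * F = 1 -> F * G = 1 -> F^-1 = G.
Proof.
move=> GF FG; have U := lunitP GF FG.
by rewrite -[LHS]mulr1 -FG mulrA mulVr // mul1r.
Qed.

(** The expansion of (u - a)^-1. *)
Definition lres a : laurent R :=
  lseries (fun j => if j is j'.+1 then a ^+ j' else 0).

Lemma lresE a (k : int) : lres a k = if k is Posz j.+1 then a ^+ j else 0.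
Proof. by case: k => [[|j]|j]. Qed.

Lemma lres_rec a k : lres a (k + 1) = a * lres a k + (k == 0)%:R.
Proof.
rewrite !lresE; case: k => [[|j]|[|j]] /=.
- by rewrite mulr0 add0r.
- by rewrite addn1 exprS addr0.
- by rewrite mulr0 add0r.
by rewrite mulr0 add0r.
Qed.

Lemma lres_comm a : lconst a * lres a = lres a * lconst a.
Proof.
apply: laurentP => k; rewrite lconstMl lconstMr lresE.
by case: k => [[|j]|j]; rewrite ?mulr0 ?mul0r // -exprS exprSr.
Qed.

Lemma lresMl a : (lvar - lconst a) * lres a = 1.
Proof.
apply: laurentP => k; rewrite mulrBl.
rewrite -[LHS]/((lvar * lres a) k - (lconst a * lres a) k) lvarMl lconstMl lres_rec.
by rewrite addrAC subrr add0r /=; case: eqP.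
Qed.

Lemma lresMr a : lres a * (lvar - lconst a) = 1.
Proof. by rewrite mulrBr -lvarC -lres_comm -mulrBl lresMl. Qed.

Lemma lvarV : lvar^-1 = lmonom 1 1 :> laurent R.
Proof.
apply: linvP; apply: laurentP => k; rewrite (lvarMl, lvarMr) /=;
by rewrite -subr_eq0 addrK.
Qed.

Lemma lvar_unit : (lvar : laurent R) \is a GRing.unit.
Proof.
apply: (@lunitP _ (lmonom 1 1)); apply: laurentP => k; rewrite (lvarMl, lvarMr) /=;
by rewrite -subr_eq0 addrK.
Qed.

(** ** Series with leading coefficient one are invertible *)

Lemma lcoef_sum I (r : seq I) (F : I -> laurent R) k :
  (\sum_(i <- r) F i) k = \sum_(i <- r) F i k.
Proof. by elim: r => [|i r IH]; rewrite ?big_nil // !big_cons -IH. Qed.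

Lemma eq_lmul F F' G G' (m : nat) :
  (forall k, k < 0 -> F k = 0) -> (forall k, k < 0 -> G k = 0) ->
  (forall k, k < 0 -> F' k = 0) -> (forall k, k < 0 -> G' k = 0) ->
  (forall k, k <= m%:Z -> F k = F' k) -> (forall k, k <= m%:Z -> G k = G' k) ->
  (F * G) m = (F' * G') m.
Proof.
move=> F0 G0 F'0 G'0 FF' GG'.
have := lmul_coefE m F0 G0; have := lmul_coefE m F'0 G'0; rewrite !add0r => E' E.
rewrite [LHS]E [RHS]E'; apply: eq_bigr => i _; rewrite !add0r.
by congr (_ * _); [apply: FF'|apply: GG']; have := ltn_ord i; lia.
Qed.

Lemma lmul_order F G (a b : int) :
  (forall k, k < a -> F k = 0) -> (forall k, k < b -> G k = 0) ->
  forall k, k < a + b -> (F * G) k = 0.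
Proof. by move=> Fa Gb k; apply: lmul_coef0. Qed.

Lemma geom_telescope_l (A : nzRingType) (x : A) m :
  (\sum_(j < m) x ^+ j) * (1 - x) = 1 - x ^+ m.
Proof.
elim: m => [|m IH]; first by rewrite big_ord0 mul0r expr0 subrr.
by rewrite big_ord_recr /= mulrDl IH mulrBr mulr1 -exprSr subrKA.
Qed.

Lemma geom_telescope_r (A : nzRingType) (x : A) m :
  (1 - x) * (\sum_(j < m) x ^+ j) = 1 - x ^+ m.
Proof.
elim: m => [|m IH]; first by rewrite big_ord0 mulr0 expr0 subrr.
by rewrite big_ord_recr /= mulrDr IH mulrBl mul1r -exprS subrKA.
Qed.

Section Geometric.
Variable t : laurent R.
Hypothesis t0 : forall k, k < 1 -> t k = 0.

Lemma tpow_order j k : k < j%:Z -> (t ^+ j) k = 0.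
Proof.
elim: j k => [|j IH] k kj.
  by rewrite expr0 /= ifF //; apply/eqP; lia.
by rewrite exprS; apply: (lmul_order t0 IH); lia.
Qed.

(** The coefficient of degree m only sees the powers of t up to m. *)
Definition geom : laurent R := lseries (fun m => (\sum_(j < m.+1) t ^+ j) m).

Lemma geom_coef m (k : int) : k <= m%:Z -> geom k = (\sum_(j < m.+1) t ^+ j) k.
Proof.
case: k => [k|k] km; last first.
  by rewrite lcoef_sum big1 // => j _; apply: tpow_order.
rewrite /= !lcoef_sum -!(big_mkord xpredT (fun j => (t ^+ j) k)).
rewrite [RHS](big_cat_nat (n := k.+1)) //= [X in _ = _ + X]big_nat [X in _ + X]big1 ?addr0 //.
by move=> j /andP[kj _]; apply: tpow_order.
Qed.

Lemma one_sub0 k : k < 0 -> (1 - t) k = 0.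
Proof.
move=> k0; rewrite -[LHS]/((1 : laurent R) k - t k) t0 ?subr0 /=; last by lia.
by rewrite ifF //; apply/eqP; lia.
Qed.

Lemma geomMl : geom * (1 - t) = 1.
Proof.
have g0 k : k < 0 -> geom k = 0 by case: k.
have S0 m k : k < 0 -> (\sum_(j < m) t ^+ j) k = 0.
  by move=> k0; rewrite lcoef_sum big1 // => j _; apply: tpow_order; lia.
apply: laurentP => -[m|m]; last exact: (lmul_order g0 one_sub0).
have -> : (geom * (1 - t)) m = ((\sum_(j < m.+1) t ^+ j) * (1 - t)) m.
  apply: eq_lmul => // k kz; try exact: one_sub0; [exact: S0|exact: geom_coef].
by rewrite geom_telescope_l -[LHS]/((1 : laurent R) m - (t ^+ m.+1) m) tpow_order ?subr0 //; lia.
Qed.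

Lemma geomMr : (1 - t) * geom = 1.
Proof.
have g0 k : k < 0 -> geom k = 0 by case: k.
have S0 m k : k < 0 -> (\sum_(j < m) t ^+ j) k = 0.
  by move=> k0; rewrite lcoef_sum big1 // => j _; apply: tpow_order; lia.
apply: laurentP => -[m|m]; last exact: (lmul_order one_sub0 g0).
have -> : ((1 - t) * geom) m = ((1 - t) * (\sum_(j < m.+1) t ^+ j)) m.
  apply: eq_lmul => // k kz; try exact: one_sub0; [exact: S0|exact: geom_coef].
by rewrite geom_telescope_r -[LHS]/((1 : laurent R) m - (t ^+ m.+1) m) tpow_order ?subr0 //; lia.
Qed.

End Geometric.

(** After factoring out the leading monomial, the inverse is a geometric series. *)
Lemma lead1_unit F (a : int) :
  (forall k, k < a -> F k = 0) -> F a = 1 -> F \is a GRing.unit.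
Proof.
move=> Fa F1; pose t := 1 - lmonom (- a) 1 * F.
have t0 k : k < 1 -> t k = 0.
  move=> k1; rewrite -[LHS]/((1 : laurent R) k - lmul (lmonom (- a) 1) F k).
  rewrite lmonomMl mul1r opprK /=; case: eqP => [->|k0]; first by rewrite add0r F1 subrr.
  by rewrite Fa ?subr0 //; lia.
have E : F = lmonom a 1 * (1 - t).
  rewrite /t opprB addrC subrK mulrA; apply: laurentP => k.
  by rewrite -mulrA [RHS]lmonomMl mul1r [RHS]lmonomMl mul1r opprK subrK.
have Um : (lmonom a 1 : laurent R) \is a GRing.unit.
  by apply: (@lunitP _ (lmonom (- a) 1)); apply: laurentP => k;
    rewrite [LHS]lmonomMl mul1r /= ?opprK; congr (if _ then _ else _); apply/eqP/eqP; lia.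
by rewrite E unitrMl //; apply: (lunitP (geomMl t0) (geomMr t0)).
Qed.

End Laurent.

(** * The recursions, over an arbitrary ring *)

#[local] Instance ring_ops_of_nzRing (A : nzRingType) :
  @Ring_ops A 0 1 (@GRing.add A) (@GRing.mul A) (fun x y => x - y) (@GRing.opp A) eq := {}.
#[local] Instance ring_of_nzRing (A : nzRingType) : Ring (Ro := ring_ops_of_nzRing A).
Proof.
split; [exact: eq_equivalence|by move=> x y -> u v ->|by move=> x y -> u v ->
  |by move=> x y -> u v ->|by move=> x y ->|exact: add0r|exact: addrC|exact: addrA
  |exact: mul1r|exact: mulr1|exact: mulrA|exact: mulrDl| |by []|exact: subrr].
by move=> x y z; exact: mulrDr.
Qed.

Ltac ncring := non_commutative_ring.

Section NoncommutativeRing.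
Variable A : nzRingType.

Lemma inv_comm (x y yi : A) : yi * y = 1 -> y * yi = 1 -> x * y = y * x -> x * yi = yi * x.
Proof.
move=> yl yr xy; rewrite -[x * yi]mul1r -yl -mulrA [y * (x * yi)]mulrA -xy -!mulrA yr mulr1 //.
Qed.

Lemma inv_uniq (x y z : A) : x * y = 1 -> y * z = 1 -> x = z.
Proof. by move=> xy yz; rewrite -[x]mulr1 -yz mulrA xy mul1r. Qed.

(** Here P and R are the two linear factors, r2 is the resolvent to be compared
    with its conjugate r', and the Z are the two central series. *)
Section First.
Variables (w X Y Y2 e f g s sg Z1 Z2 P R r2 Pi Ri : A).
Hypotheses (PE : P = w + X) (RE : R = w + Y).
Hypotheses (PiP : Pi * P = 1) (PPi : P * Pi = 1) (RiR : Ri * R = 1) (RRi : R * Ri = 1).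
Hypotheses (r2l : r2 * (w + Y2) = 1) (r2r : (w + Y2) * r2 = 1).
Hypothesis wC : forall x, w * x = x * w.
Hypothesis Y2E : Y2 = s * Y * s + X * e + e * X - Y * e - sg.
Hypotheses (sgK : sg * sg = 1) (esg : e * sg = e) (sge : sg * e = e).
Hypotheses (ee : e * e = e) (se : s * e = e) (ssK : s * s = 1) (sYs : s * Y * s = sg * Y * sg).
Hypotheses (Xe : X * e = sg * g * e) (eX : e * X = e * g * sg).
Hypotheses (gX : g * X = g * Y) (sgX : sg * X * sg = X + g * e + e * g - X * e - e * X).
Hypotheses (fsf : f * sg * f = Y * f) (fef : f * e * f = f) (ege : e * g * e = e).
Hypotheses (fg : f * g = g * f) (sgs : s * g * s = f) (eY : e * Y = Y * e).
Hypotheses (fX : X * f = f * X) (fY : Y * f = f * Y) (XY : X * Y = Y * X).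
Hypotheses (XY2 : X * Y2 = Y2 * X) (YY2 : Y * Y2 = Y2 * Y).
Hypotheses (Z1g : Z1 * g = g * Ri * g) (Z1s : Z1 * s = s * Z1) (Z1X : Z1 * X = X * Z1)
  (Z1e : Z1 * e = e * Z1) (Z1fC : Z1 * f = f * Z1).
Hypothesis Z2f : Z2 * f = f * r2 * f.

Let r' := sg * Ri * sg.

Let comm_w x y : x * y = y * x -> x * (w + y) = (w + y) * x.
Proof. by move=> xy; rewrite mulrDr mulrDl wC xy. Qed.

Let XR : X * R = R * X. Proof. by rewrite RE; apply: comm_w. Qed.
Let fP : f * P = P * f. Proof. by rewrite PE; apply: comm_w. Qed.
Let fR : f * R = R * f. Proof. by rewrite RE; apply: comm_w. Qed.
Let fPi : f * Pi = Pi * f. Proof. exact: inv_comm fP. Qed.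
Let fRi : f * Ri = Ri * f. Proof. exact: inv_comm fR. Qed.
Let eR : e * R = R * e. Proof. by rewrite RE; apply: comm_w. Qed.
Let eRi : e * Ri = Ri * e. Proof. exact: inv_comm eR. Qed.
Let PR : P * R = R * P. Proof. by rewrite PE mulrDl mulrDr wC XR. Qed.
Let PRi : P * Ri = Ri * P. Proof. exact: inv_comm PR. Qed.
Let PiRi : Pi * Ri = Ri * Pi.
Proof. by apply: inv_comm RiR RRi _; apply/esym/(inv_comm PiP PPi)/esym. Qed.
Let RPi : R * Pi = Pi * R. Proof. exact: inv_comm (esym PR). Qed.

Let Pi_Y2 : Pi * (w + Y2) = (w + Y2) * Pi.
Proof.
by apply/esym/(inv_comm PiP PPi)/esym; rewrite PE [LHS]mulrDl [RHS]mulrDr wC (comm_w XY2).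
Qed.
Let r2R : r2 * R = R * r2.
Proof.
apply/esym/(inv_comm r2l r2r)/esym; rewrite RE [LHS]mulrDl [RHS]mulrDr wC; congr (_ + _).
exact: comm_w.
Qed.
Let r2P : r2 * P = P * r2.
Proof.
apply/esym/(inv_comm r2l r2r)/esym; rewrite PE [LHS]mulrDl [RHS]mulrDr wC; congr (_ + _).
exact: comm_w.
Qed.
Let r2Ri : r2 * Ri = Ri * r2. Proof. exact: inv_comm r2R. Qed.
Let Y2e : Y2 * e = X * e.
Proof.
transitivity (s * Y * (s * e) + X * (e * e) + e * (X * e) - Y * (e * e) - sg * e).
  by rewrite Y2E; ncring.
have eXe : e * (X * e) = e by rewrite Xe !mulrA esg ege.
rewrite se ee sge eXe -[s * Y * e]mulrA -eY mulrA se; ncring.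
Qed.
Let r2e : r2 * e = Pi * e.
Proof.
have E : (w + Y2) * e = P * e by rewrite PE !mulrDl Y2e.
by rewrite -[Pi * e]mul1r -r2l -mulrA [(w + Y2) * _]mulrA -Pi_Y2 -[Pi * _ * e]mulrA E [Pi * (P * e)]mulrA PiP mul1r.
Qed.
Let er' : e * r' = Ri * e.
Proof. by rewrite /r' !mulrA esg eRi -mulrA esg. Qed.

Let Z1f : Z1 * f = f * r' * f.
Proof.
have -> : r' = s * Ri * s.
  apply/esym/(@inv_uniq _ (w + s * Y * s)).
    transitivity (s * Ri * (s * w + (s * s) * Y * s)); first ncring.
    rewrite -wC ssK mul1r -mulrDl -RE -!mulrA [Ri * _]mulrA RiR mul1r //.
  rewrite sYs; transitivity ((w * sg + sg * Y * (sg * sg)) * Ri * sg); first by rewrite /r'; ncring.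
  rewrite sgK mulr1 wC -mulrDr -RE -[sg * R * Ri]mulrA RRi mulr1 //.
rewrite -sgs; transitivity (s * (Z1 * g) * s); first by rewrite !mulrA Z1s.
rewrite Z1g; transitivity (s * g * (s * s) * Ri * (s * s) * g * s); last by ncring.
by rewrite ssK; ncring.
Qed.

(* The two unknown terms of the comparison. *)
Let Q := f * e * g * Ri * sg * f.
Let S := f * r2 * sg * f.

Let resolvent : r2 - r' = - (r2 * (X * e + e * X - Y * e - sg) * r').
Proof.
have r'l : (w + s * Y * s) * r' = 1.
  rewrite sYs; transitivity ((w * sg + sg * Y * (sg * sg)) * Ri * sg); first by rewrite /r'; ncring.
  by rewrite sgK mulr1 wC -mulrDr -RE -[sg * R * Ri]mulrA RRi mulr1.
transitivity (r2 * ((w + s * Y * s) * r') - r2 * (w + Y2) * r'); first by rewrite r'l r2l mulr1 mul1r.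
by rewrite Y2E; ncring.
Qed.

Let c1 : r2 * (X - Y) * e * r' = (Ri - Pi) * e.
Proof.
have -> : X - Y = P - R by rewrite PE RE; ncring.
rewrite -mulrA er'; transitivity ((r2 * P) * Ri * e - (r2 * R) * Ri * e); first by ncring.
rewrite r2P r2R -[P * r2 * Ri]mulrA r2Ri -[R * r2 * Ri]mulrA r2Ri !mulrA RRi mul1r.
rewrite -!mulrA r2e !mulrA -[P * Ri * Pi]mulrA -PiRi !mulrA PPi; ncring.
Qed.

Let difference : Z2 * f - Z1 * f = - ((Ri - Pi) * f + Pi * Q - Ri * S).
Proof.
have c2 : r2 * e * X * r' = Pi * (e * g * Ri * sg).
  rewrite r2e -[Pi * e * X]mulrA eX; transitivity (Pi * (e * g * (sg * sg) * Ri * sg)).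
    by rewrite /r'; ncring.
  by rewrite sgK mulr1.
have c3 : r2 * sg * r' = Ri * r2 * sg.
  by rewrite -r2Ri /r' !mulrA -[r2 * sg * sg]mulrA sgK mulr1.
rewrite Z2f Z1f; transitivity (f * (r2 - r') * f); first by ncring.
rewrite resolvent.
transitivity (- (f * (r2 * (X - Y) * e * r' + r2 * e * X * r' - r2 * sg * r') * f)); first by ncring.
rewrite c1 c2 c3; congr (- _).
transitivity (f * Ri * e * f - f * Pi * e * f + f * Pi * e * g * Ri * sg * f
   - f * Ri * r2 * sg * f); first by ncring.
rewrite fPi fRi; transitivity ((Ri - Pi) * (f * e * f) + Pi * Q - Ri * S).
  by rewrite /Q /S; ncring.
by rewrite fef.
Qed.

Let SE : S = Y * Ri * f - (P - R) * Pi * Ri * f - Pi * f * g * Ri + Z2 * Ri * f.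
Proof.
have r'sg : r' * sg = sg * Ri by rewrite /r' -!mulrA sgK mulr1.
have Bsg : (X * e + e * X - Y * e - sg) * sg = (X - Y) * e + e * g - 1.
  transitivity ((X - Y) * (e * sg) + (e * X) * sg - sg * sg); first by ncring.
  by rewrite esg sgK eX -mulrA sgK mulr1.
have -> : S = f * r' * sg * f + f * (r2 - r') * sg * f by rewrite /S; ncring.
rewrite resolvent.
transitivity (f * (r' * sg) * f - f * r2 * (X * e + e * X - Y * e - sg) * (r' * sg) * f); first by ncring.
rewrite r'sg.
transitivity (f * sg * (Ri * f) -
   f * r2 * ((X * e + e * X - Y * e - sg) * sg) * (Ri * f)); first by ncring.
rewrite Bsg -fRi; have -> : X - Y = P - R by rewrite PE RE; ncring.
transitivity ((f * sg * f) * Ri - (f * (r2 * P) * e * f - f * (r2 * R) * e * f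
   + f * (r2 * e) * g * f - f * r2 * f) * Ri); first by ncring.
rewrite fsf r2P r2R; transitivity (Y * (f * Ri) - ((f * P) * (r2 * e) * f - (f * R) * (r2 * e) * f
   + f * (r2 * e) * g * f - f * r2 * f) * Ri); first by ncring.
rewrite r2e -Z2f fRi fP fR.
transitivity (Y * Ri * f - (P * (f * Pi) * e * f - R * (f * Pi) * e * f
   + (f * Pi) * e * (g * f) - Z2 * f) * Ri); first by ncring.
rewrite fPi -fg; transitivity (Y * Ri * f - (P * Pi * (f * e * f) - R * Pi * (f * e * f)
   + Pi * (f * e * f) * g - Z2 * f) * Ri); first by ncring.
rewrite fef; transitivity (Y * Ri * f - (P - R) * Pi * (f * Ri) - Pi * f * g * Ri + Z2 * (f * Ri)).
  by ncring.
by rewrite fRi; ncring.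
Qed.

Let QP : Q * P = (X + Z1 + Ri * X - Y * Ri - Ri * g) * f.
Proof.
have sgP : sg * P = (P + g * e + e * g - X * e - e * X) * sg.
  transitivity (w * sg + sg * X * (sg * sg)); first by rewrite sgK PE mulr1 mulrDr wC.
  by rewrite !mulrA sgX PE; ncring.
have gPi : g * Ri * P = g.
  have gP : g * P = g * R by rewrite PE RE !mulrDr gX.
  by rewrite -mulrA -PRi mulrA gP -mulrA RRi mulr1.
have fXef : f * e * X * f = X * f.
  by rewrite -!mulrA fX !mulrA fef.
have -> : Q * P = f * e * g * Ri * (sg * P) * f by rewrite /Q -mulrA fP !mulrA.
rewrite sgP.
transitivity (f * e * (g * Ri * P) * sg * f + f * e * (g * Ri * g) * (e * sg) * f
  + f * e * g * (Ri * e) * g * sg * f - f * e * g * Ri * X * (e * sg) * f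
  - f * e * g * (Ri * e) * X * sg * f); first by ncring.
rewrite gPi -Z1g -eRi esg.
have XRi : X * Ri = Ri * X by apply: inv_comm XR.
have YRi : Y * Ri = Ri * Y.
  by apply: inv_comm RiR RRi _; rewrite RE; apply: comm_w.
transitivity (f * (e * g * sg) * f + f * (e * Z1) * g * e * f + f * (e * g * e) * Ri * g * sg * f
  - f * e * g * (Ri * X) * e * f - f * (e * g * e) * Ri * X * sg * f); first by ncring.
rewrite -eX -Z1e ege -XRi.
transitivity (f * e * X * f + (f * Z1) * (e * g * e) * f + f * (e * Ri) * g * sg * f
  - f * e * (g * X) * Ri * e * f - f * (e * Ri) * X * sg * f); first by ncring.
rewrite fXef -Z1fC ege eRi gX.
transitivity (X * f + Z1 * (f * e * f) + (f * Ri) * (e * g * sg) * f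
  - f * e * g * Y * (Ri * e) * f - (f * Ri) * (e * X) * sg * f); first by ncring.
rewrite fef -eX -eRi fRi.
transitivity (X * f + Z1 * f + Ri * (f * e * X * f)
  - f * e * g * (Y * e) * Ri * f - Ri * f * (e * X) * sg * f); first by ncring.
rewrite fXef -eY eX.
transitivity (X * f + Z1 * f + Ri * (X * f)
  - f * (e * g * e) * Y * Ri * f - Ri * f * e * g * (sg * sg) * f); first by ncring.
rewrite ege sgK mulr1.
transitivity (X * f + Z1 * f + Ri * (X * f)
  - f * e * (Y * (Ri * f)) - Ri * (f * e) * (g * f)); first by ncring.
rewrite -fRi [Y * (f * Ri)]mulrA fY -fg.
transitivity (X * f + Z1 * f + Ri * (X * f)
  - (f * e * f) * Y * Ri - Ri * (f * e * f) * g); first by ncring.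
rewrite fef -fY -[Y * f * Ri]mulrA fRi -[Ri * f * g]mulrA fg XRi; ncring.
Qed.

(** In the comparison [difference] the terms with g coming from [SE] and [QP]
    cancel, and the remaining elements P, R, Z1, Z2 act as if they commuted. *)
Lemma first_recursion : (Z2 - w - 1) * (1 - Ri * Ri) * f = (1 - Pi * Pi) * (Z1 - w - 1) * f.
Proof.
have YRi : Y * Ri = 1 - w * Ri.
  have -> : Y = R - w by rewrite RE; ncring.
  by rewrite mulrBl RRi.
have PiX : Pi * X = 1 - w * Pi.
  have -> : X = P - w by rewrite PE; ncring.
  by rewrite mulrBr PiP -wC.
have Z2Ri : Z2 * Ri * f = Ri * Z2 * f.
  rewrite -mulrA -fRi [LHS]mulrA Z2f -[Ri * Z2 * f]mulrA Z2f.
  by rewrite -mulrA fRi !mulrA -[f * r2 * Ri]mulrA r2Ri !mulrA fRi.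
have PiZ1 : Pi * Z1 = Z1 * Pi.
  by apply/esym/(inv_comm PiP PPi); rewrite PE; apply: comm_w.
have gPi : g * Pi = g * Ri.
  have gP : g * P = g * R by rewrite PE RE !mulrDr gX.
  by rewrite -[g * Ri]mulr1 -PPi -mulrA [Ri * _]mulrA -PRi !mulrA gP -[g * R * Ri]mulrA RRi mulr1.
have Qe : Q = (X + Z1 + Ri * X - Y * Ri - Ri * g) * f * Pi.
  by rewrite -QP -mulrA PPi mulr1.
have PiQ : Pi * Q = Pi * (1 - w * Pi) * f + Pi * Pi * Z1 * f + Ri * Pi * (1 - w * Pi) * f
    - Pi * (1 - w * Ri) * Pi * f - Pi * Ri * g * Ri * f.
  have XPi : X * Pi = Pi * X by apply: inv_comm PiP PPi _; rewrite PE; apply: comm_w.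
  rewrite Qe; transitivity
    (Pi * (X + Z1 + Ri * X - Y * Ri - Ri * g) * (f * Pi)); first by ncring.
  rewrite fPi; transitivity (Pi * (X * Pi) * f + Pi * (Z1 * Pi) * f + (Pi * Ri) * (X * Pi) * f
    - Pi * (Y * Ri) * Pi * f - Pi * Ri * (g * Pi) * f); first by ncring.
  by rewrite XPi gPi -PiZ1 PiX YRi PiRi; ncring.
have RiS : Ri * S = Ri * (1 - w * Ri) * f - (Ri * Ri - Pi * Ri) * f
    - Pi * Ri * g * Ri * f + Z2 * Ri * Ri * f.
  have PPiR : (P - R) * Pi * Ri = Ri - Pi.
    by rewrite mulrBl PPi mulrBl mul1r RPi -mulrA RRi mulr1.
  rewrite SE; transitivity (Ri * (Y * Ri) * f - Ri * ((P - R) * Pi * Ri) * f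
    - Ri * Pi * (f * g) * Ri + (Ri * Z2) * (Ri * f)); first by ncring.
  rewrite PPiR fg -PiRi.
  have -> : Ri * Z2 * (Ri * f) = Z2 * Ri * Ri * f.
    by rewrite -[in LHS]fRi mulrA -Z2Ri -!mulrA fRi.
  transitivity (Ri * (Y * Ri) * f - (Ri * Ri - Ri * Pi) * f
    - Pi * Ri * g * (f * Ri) + Z2 * Ri * Ri * f); first by ncring.
  by rewrite fRi YRi -PiRi; ncring.
have D := difference; rewrite PiQ RiS in D.
transitivity ((Z2 * f - Z1 * f) + Z1 * f - (w + 1) * f - Z2 * Ri * Ri * f + (w + 1) * Ri * Ri * f).
  by ncring.
rewrite D; transitivity (- (Ri - Pi) * f - (Pi - Pi * (w * Pi) + Pi * Pi * Z1 + Ri * Pi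
    - Ri * Pi * (w * Pi) - Pi * Pi + Pi * (w * Ri) * Pi) * f
  + (Ri - Ri * (w * Ri) - Ri * Ri + Pi * Ri) * f + Z1 * f - (w + 1) * f + (w + 1) * Ri * Ri * f).
  by ncring.
transitivity ((Z1 - w - 1 - Pi * Pi * Z1 + Pi * Pi * w + Pi * Pi) * f); last by ncring.
have wPi : Pi * (w * Pi) = w * Pi * Pi by rewrite mulrA -wC.
have wRi : Ri * (w * Ri) = w * Ri * Ri by rewrite mulrA -wC.
have wPiRi : Pi * (w * Ri) * Pi = w * Ri * Pi * Pi by rewrite mulrA -wC -[w * Pi * Ri]mulrA PiRi !mulrA.
have wRiPi : Ri * Pi * (w * Pi) = w * Ri * Pi * Pi by rewrite mulrA -wC !mulrA.
have wPP : Pi * Pi * w = w * Pi * Pi by rewrite -wC mulrA.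
rewrite wPi wRi wPiRi wRiPi wPP !PiRi; ncring.
Qed.
End First.

Section Second.
Variables (w X Y X2 e f h s t T1 T2 P R r2 Pi Ri : A).
Hypotheses (PE : P = w - X) (RE : R = w - Y).
Hypotheses (PiP : Pi * P = 1) (PPi : P * Pi = 1) (RiR : Ri * R = 1) (RRi : R * Ri = 1).
Hypotheses (r2l : r2 * (w - X2) = 1) (r2r : (w - X2) * r2 = 1).
Hypothesis wC : forall x, w * x = x * w.
Hypothesis X2E : X2 = t * X * t + t - e * f - f * e + e * X * f * e.
Hypotheses (tt : t * t = 1) (et : e * t = e) (ee : e * e = e).
Hypotheses (eft : e * f * t = e * X) (X2e : X2 * e = e * X * f * e).
Hypothesis tYt : t * Y * t = Y + f * e + e * f - X * e - e * X.
Hypotheses (X2f : X2 * f = Y * f) (eY : e * Y = e * X) (Ye : Y * e = X * e).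
Hypotheses (efe : e * f * e = e) (fef : f * e * f = f) (he : h * e = e * h)
  (hh : h * h = h).
Hypotheses (hth : h * t * h = e * h) (hfh : h * f * h = h) (hX : h * X = X * h) (hY : h * Y = Y * h).
Hypotheses (fX : f * X = X * f) (XY : X * Y = Y * X) (YX2 : Y * X2 = X2 * Y) (XX2 : X * X2 = X2 * X).
Hypotheses (th : t * h = s * e * s * t) (ht : h * t = t * s * e * s) (ss : s * s = 1) (sX : s * X = X * s).
Hypotheses (T1s : T1 * s = s * T1) (T1t : T1 * t = t * T1) (T1X : T1 * X = X * T1)
  (T1Y : T1 * Y = Y * T1) (T1f : T1 * f = f * T1) (T1hC : T1 * h = h * T1).
Hypotheses (T1e : T1 * e = e * Pi * e) (T2h : T2 * h = h * r2 * h).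

Let r' := t * Pi * t.

Let comm_w x y : x * y = y * x -> x * (w - y) = (w - y) * x.
Proof. by move=> xy; rewrite mulrBr mulrBl wC xy. Qed.

Let hP : h * P = P * h. Proof. by rewrite PE; apply: comm_w. Qed.
Let hPi : h * Pi = Pi * h. Proof. exact: inv_comm hP. Qed.
Let hR : h * R = R * h. Proof. by rewrite RE; apply: comm_w. Qed.
Let hRi : h * Ri = Ri * h. Proof. exact: inv_comm hR. Qed.
Let fPi : f * Pi = Pi * f. Proof. by apply: inv_comm PiP PPi _; rewrite PE; apply: comm_w. Qed.
Let sPi : s * Pi = Pi * s. Proof. by apply: inv_comm PiP PPi _; rewrite PE; apply: comm_w. Qed.
Let XPi : X * Pi = Pi * X. Proof. by apply: inv_comm PiP PPi _; rewrite PE; apply: comm_w. Qed.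
Let T1Pi : T1 * Pi = Pi * T1. Proof. by apply: inv_comm PiP PPi _; rewrite PE; apply: comm_w. Qed.
Let T1Ri : T1 * Ri = Ri * T1. Proof. by apply: inv_comm RiR RRi _; rewrite RE; apply: comm_w. Qed.
Let PiR : Pi * R = R * Pi.
Proof.
apply/esym/(inv_comm PiP PPi)/esym; rewrite RE; apply: comm_w.
by rewrite PE mulrBl mulrBr wC XY.
Qed.
Let PiX2 : Pi * (w - X2) = (w - X2) * Pi.
Proof.
apply/esym/(inv_comm PiP PPi)/esym; apply: comm_w.
by rewrite PE mulrBl mulrBr wC XX2.
Qed.
Let r2Pi : r2 * Pi = Pi * r2. Proof. exact/esym/(inv_comm r2l r2r). Qed.
Let RiX2 : Ri * (w - X2) = (w - X2) * Ri.
Proof.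
apply/esym/(inv_comm RiR RRi)/esym; apply: comm_w.
by rewrite RE mulrBl mulrBr wC YX2.
Qed.
Let r2f : r2 * f = Ri * f.
Proof.
have E : (w - X2) * f = R * f by rewrite RE !mulrBl X2f.
by rewrite -[Ri * f]mul1r -r2l -mulrA [(w - X2) * _]mulrA -RiX2 -[Ri * _ * f]mulrA E
  [Ri * (R * f)]mulrA RiR mul1r.
Qed.
Let eP : e * P = e * R. Proof. by rewrite PE RE !mulrBr eY. Qed.
Let PRe : P * e = R * e. Proof. by rewrite PE RE !mulrBl Ye. Qed.
Let eRi : e * Ri = e * Pi.
Proof.
have PiRi : Pi * Ri = Ri * Pi by apply: inv_comm PiR.
transitivity (e * (P * Pi) * Ri); first by rewrite PPi mulr1.
by rewrite mulrA eP -[LHS]mulrA PiRi mulrA -[e * R * Ri]mulrA RRi mulr1.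
Qed.
Let Rie : Ri * e = Pi * e.
Proof.
have PiRi : Pi * Ri = Ri * Pi by apply: inv_comm PiR.
transitivity (Ri * (Pi * P) * e); first by rewrite PiP mulr1.
by rewrite -!mulrA PRe mulrA -PiRi -!mulrA [Ri * (R * e)]mulrA RiR mul1r.
Qed.

Let r2e : r2 * e = e * Pi * f * e.
Proof.
have E : (w - X2) * (e * Pi * f * e) = e.
  transitivity ((w * e) * Pi * f * e - X2 * e * Pi * f * e); first by ncring.
  rewrite X2e (wC e); transitivity (e * w * Pi * f * e - e * X * (f * e * (Pi * f)) * e); first by ncring.
  rewrite -fPi [f * e * _]mulrA fef fPi.
  transitivity (e * ((w - X) * Pi) * f * e); first by ncring.
  by rewrite -PE PPi mulr1.
by rewrite -[in LHS]E mulrA r2l mul1r.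
Qed.

(* The unknown terms of the comparison; [VR] expresses V by T1 alone. *)
Let V := h * f * e * Pi * t * h.
Let S := h * r2 * t * h.

Let T1h : T1 * h = h * r' * h.
Proof.
transitivity (h * t * Pi * (t * h)); last by rewrite /r' !mulrA.
rewrite ht th; transitivity (t * s * e * (s * Pi) * (s * e * s * t)); last by ncring.
rewrite sPi; transitivity (t * s * (e * Pi * (s * s) * e) * s * t); last by ncring.
rewrite ss mulr1 -T1e; transitivity (t * (s * T1) * e * s * t); last by ncring.
rewrite -T1s; transitivity ((t * T1) * s * e * s * t); last by ncring.
by rewrite -T1t -!mulrA [s * (e * (s * t))]mulrA [s * e * _]mulrA -th [t * (t * h)]mulrA tt mul1r.
Qed.

Let resolvent : r2 - r' = r2 * (t - e * f - f * e + X2 * e) * r'.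
Proof.
have r'l : (w - t * X * t) * r' = 1.
  transitivity ((w * t - t * X * (t * t)) * Pi * t); first by rewrite /r'; ncring.
  by rewrite tt mulr1 wC -mulrBr -PE -[t * P * Pi]mulrA PPi mulr1.
transitivity (r2 * ((w - t * X * t) * r') - r2 * (w - X2) * r').
  by rewrite r'l r2l mulr1 mul1r.
by rewrite X2e X2E; ncring.
Qed.

Let r2X2 : r2 * X2 = w * r2 - 1.
Proof. by rewrite -r2l mulrBr wC subKr. Qed.

(* T1 and T2 agree where the positions compared by e agree. *)
Let hr2eh : h * r2 * e * h = T1 * e * h.
Proof.
rewrite -mulrA -[h * r2 * (e * h)]mulrA [r2 * _]mulrA r2e.
transitivity ((h * e) * Pi * f * (e * h)); first by ncring.
rewrite -he {1}he; transitivity (e * (h * Pi) * f * h * e); first by ncring.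
rewrite hPi; transitivity (e * Pi * (h * f * h) * e); first by ncring.
by rewrite hfh -mulrA he mulrA -T1e.
Qed.

Let ePit : h * e * Pi * t * h = T1 * e * h.
Proof.
rewrite he; transitivity (e * (h * Pi) * t * h); first by ncring.
rewrite hPi; transitivity (e * Pi * (h * t * h)); first by ncring.
by rewrite hth mulrA -T1e.
Qed.

Let difference : T2 * h - T1 * h = Pi * S - Ri * V.
Proof.
have er' : e * r' = e * Pi * t by rewrite /r' !mulrA et.
have efr' : e * f * r' = e * X * Pi * t by rewrite /r' !mulrA eft.
rewrite T2h T1h; transitivity (h * (r2 - r') * h); first by ncring.
rewrite resolvent; transitivity (h * r2 * (t * r') * h - h * r2 * (e * f * r') * h
  - h * (r2 * f) * (e * r') * h + h * (r2 * X2) * (e * r') * h); first by ncring.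
have -> : t * r' = Pi * t by rewrite /r' !mulrA tt mul1r.
rewrite er' efr' r2f r2X2; transitivity (h * (r2 * Pi) * t * h - h * r2 * e * (X * Pi) * t * h
  - (h * Ri) * f * e * Pi * t * h + (h * w) * r2 * e * Pi * t * h - h * e * Pi * t * h); first by ncring.
rewrite r2Pi hRi -wC ePit; transitivity ((h * Pi) * r2 * t * h - Ri * V
   + (w * h * r2 * e * Pi - h * r2 * e * (X * Pi)) * t * h - T1 * e * h); first by rewrite /V; ncring.
have -> : w * h * r2 * e * Pi - h * r2 * e * (X * Pi) = h * r2 * e.
  transitivity (h * r2 * e * (P * Pi)); last by rewrite PPi mulr1.
  by rewrite PE mulrBl mulrBr -!mulrA wC -!mulrA -wC.
rewrite -[h * r2 * e * t]mulrA et hr2eh hPi /S; ncring.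
Qed.

Let PPi_split : w * Pi - X * Pi = 1.
Proof. by rewrite -mulrBl -PE. Qed.

Let SE : S = T2 * h * Pi + T1 * e * h - Ri * h * e * Pi.
Proof.
have r't : r' * t = t * Pi by rewrite /r' -mulrA tt mulr1.
have Dt : (t - e * f - f * e + X2 * e) * t = 1 - e * X - f * e + X2 * e.
  transitivity (t * t - e * f * t - f * (e * t) + X2 * (e * t)); first by ncring.
  by rewrite tt eft et.
transitivity (h * (r' * t) * h + h * (r2 - r') * t * h); first by rewrite /S; ncring.
rewrite resolvent; transitivity (h * (r' * t) * h
  + h * r2 * (t - e * f - f * e + X2 * e) * (r' * t) * h); first by ncring.
rewrite r't; transitivity (h * t * (Pi * h)
  + h * r2 * ((t - e * f - f * e + X2 * e) * t) * (Pi * h)); first by ncring.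
rewrite Dt -hPi; transitivity ((h * t * h + (h * r2 * h - h * r2 * e * (X * h)
  - h * (r2 * f) * (e * h) + h * (r2 * X2) * e * h)) * Pi).
  by ncring.
rewrite hth -T2h -hX r2f r2X2 -he; transitivity ((h * e + (T2 * h - (h * r2 * e * h) * X
  - (h * Ri) * f * h * e + (h * w) * r2 * e * h - h * e * h)) * Pi); first by ncring.
rewrite hRi -wC; transitivity ((h * e + (T2 * h - (h * r2 * e * h) * X
  - Ri * (h * f * h) * e + w * (h * r2 * e * h) - h * e * h)) * Pi); first by ncring.
rewrite hr2eh hfh; have -> : h * e * h = h * e by rewrite he -mulrA hh.
have E : T1 * e * h * X * Pi = w * (T1 * e * h) * Pi - T1 * e * h.
  have XP : X * Pi = w * Pi - 1 by rewrite -PPi_split subKr.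
  by rewrite (wC (T1 * e * h)) -[LHS]mulrA XP; ncring.
transitivity (T2 * h * Pi - (T1 * e * h * X * Pi) + w * (T1 * e * h) * Pi - Ri * h * e * Pi);
  first by ncring.
by rewrite E; ncring.
Qed.

Let VR : V * R = - (Pi * h * e) + T1 * h * e * P + T1 * h.
Proof.
have tR : t * R = (R - f * e - e * f + X * e + e * X) * t.
  transitivity (w * t - (t * Y * t) * t); last by rewrite tYt RE; ncring.
  by rewrite -[t * Y * t * t]mulrA tt mulr1 wC RE mulrBr.
have ePiR : e * Pi * R = e by rewrite -mulrA PiR mulrA -eP -mulrA PPi mulr1.
have PiX : Pi * X = w * Pi - 1 by rewrite -XPi -PPi_split subKr.
have eXt : e * X * t = e * f by rewrite -eft -mulrA tt mulr1.
have -> : V * R = h * f * e * Pi * (t * R) * h by rewrite /V -mulrA hR !mulrA.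
rewrite tR; transitivity (h * f * (e * Pi * R) * (t * h) - h * f * e * (Pi * f) * (e * t) * h
  - h * f * (e * Pi * e) * f * t * h + h * f * e * (Pi * X) * (e * t) * h
  + h * f * (e * Pi * e) * X * t * h); first by ncring.
rewrite ePiR et -fPi -T1e PiX; transitivity (h * f * (e * t) * h - h * (f * e * f) * Pi * e * h
  - h * (f * T1) * (e * f * t) * h + (h * f * e * w) * Pi * e * h - h * f * (e * e) * h
  + h * (f * T1) * (e * X * t) * h); first by ncring.
rewrite et fef eft eXt ee -T1f -(wC (h * f * e)).
transitivity (h * f * (e * h) - h * (f * Pi) * (e * h)
  - (h * T1) * f * e * (X * h) + w * h * f * (e * Pi * e) * h - h * f * (e * h)
  + (h * T1) * (f * e * f) * h); first by ncring.
rewrite fPi -T1e fef -he -hX -T1hC.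
transitivity (- ((h * Pi) * f * h * e) - T1 * h * f * (e * h) * X + w * h * (f * T1) * (e * h)
  + T1 * (h * f * h)); first by ncring.
rewrite hPi -he -T1f hfh; transitivity (- (Pi * (h * f * h) * e) - T1 * (h * f * h) * e * X
  + w * (h * T1) * f * h * e + T1 * h); first by ncring.
rewrite -T1hC hfh; transitivity (- (Pi * h * e) - T1 * h * e * X + w * T1 * (h * f * h) * e + T1 * h).
  by ncring.
rewrite hfh PE; transitivity (- (Pi * h * e) - T1 * h * e * X + w * (T1 * h * e) + T1 * h).
  by ncring.
by rewrite wC; ncring.
Qed.

(** The terms of S and V that contain e cancel, because R e = P e. *)
Lemma second_recursion : T2 * (1 - Pi * Pi) * h = (1 - Ri * Ri) * T1 * h.
Proof.
have PiRi : Pi * Ri = Ri * Pi by apply: inv_comm PiR.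
have VE : V = (- (Pi * h * e) + T1 * h * e * P + T1 * h) * Ri.
  by rewrite -VR -mulrA RRi mulr1.
have T2Pi : Pi * T2 * h = T2 * Pi * h.
  transitivity (T2 * h * Pi); last by rewrite -mulrA hPi mulrA.
  rewrite -[LHS]mulrA T2h -[RHS]mulrA hPi !mulrA -[h * r2 * Pi]mulrA r2Pi !mulrA hPi //.
have PiS : Pi * S = T2 * Pi * Pi * h + T1 * Pi * e * h - Ri * Pi * h * e * Pi.
  rewrite SE; transitivity ((Pi * T2 * h) * Pi + (Pi * T1) * e * h - (Pi * Ri) * h * e * Pi).
    by ncring.
  by rewrite T2Pi -T1Pi PiRi -[T2 * Pi * h * Pi]mulrA hPi !mulrA.
have RiV : Ri * V = - (Ri * Pi * h * e * Pi) + T1 * Pi * e * h + Ri * Ri * T1 * h.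
  rewrite VE; transitivity (- (Ri * Pi * h * (e * Ri)) + (Ri * T1) * h * (e * P) * Ri
    + Ri * T1 * (h * Ri)); first by ncring.
  rewrite eRi eP hRi -T1Ri; transitivity (- (Ri * Pi * h * e * Pi) + T1 * Ri * h * e * (R * Ri)
    + (T1 * Ri) * Ri * h); first by ncring.
  rewrite RRi mulr1 -[T1 * Ri * h * e]mulrA he mulrA -[T1 * Ri * e]mulrA Rie T1Ri.
  by rewrite -[Ri * T1 * Ri]mulrA T1Ri; ncring.
have D := difference; rewrite PiS RiV in D.
transitivity ((T2 * h - T1 * h) + T1 * h - T2 * Pi * Pi * h); first by ncring.
by rewrite D; ncring.
Qed.
End Second.
End NoncommutativeRing.

(** * Compression in the algebra *)

Lemma zF_neq0 : zF != 0.
Proof. by rewrite /zF tofrac_eq0 polyX_eq0. Qed.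

Lemma ecutE n p : ecut zF n p = dbasis zF (cutd n p).
Proof.
have o : odd (2 * p + 1) by lia.
have h : uphalf (2 * p + 1) = p.+1 by lia.
by rewrite /ecut /e_ o h.
Qed.

Lemma ejoinE n p : ejoin zF n p = dbasis zF (joind n p).
Proof.
have o : odd (2 * p.+1) = false by lia.
have h : (2 * p.+1)./2 = p.+1 by lia.
by rewrite /ejoin /e_ o h.
Qed.

(** Whatever loops a compression creates, their number only scales the result. *)
Lemma compress n r r' (c : diagram n) :
  (forall d, d \in tower n r -> exists2 d', d' \in tower n r' &
     compose (compose c d) c = compose d' c) ->
  forall x, x \in tower_alg zF n r -> exists2 y, y \in tower_alg zF n r' &
    y * dbasis zF c = dbasis zF c * x * dbasis zF c.
Proof.
move=> H; apply: tower_ind => [|l x x' [y yr E] [y' y'r E']|d /H[d' d'r E]].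
- by exists 0; rewrite ?mem0v // mul0r mulr0 mul0r.
- exists (l *: y + y'); first by rewrite memvD ?memvZ.
  by rewrite mulrDl mulrDr mulrDl -scalerAr -!scalerAl E E'.
pose l1 := zF ^+ loops c d * zF ^+ loops (compose c d) c.
exists ((l1 / zF ^+ loops d' c) *: dbasis zF d'); first by rewrite memvZ ?mem_dbasis.
rewrite -scalerAl !dbasisM -scalerAl dbasisM !scalerA E; congr (_ *: _).
by rewrite divfK // expf_neq0 // zF_neq0.
Qed.

Lemma cut_compress n p x : (p < n)%N -> x \in tower_alg zF n (2 * p + 2) ->
  exists2 y, y \in tower_alg zF n (2 * p) &
    y * ecut zF n p = ecut zF n p * x * ecut zF n p.
Proof.
by move=> pn; rewrite ecutE; apply: compress => d; apply: compress_cut.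
Qed.

Lemma join_compress n p x : (p.+1 < n)%N -> x \in tower_alg zF n (2 * p + 2) ->
  exists2 y, y \in tower_alg zF n (2 * p + 1) &
    y * ejoin zF n p = ejoin zF n p * x * ejoin zF n p.
Proof.
by move=> pn; rewrite ejoinE; apply: compress => d; apply: compress_join.
Qed.

Lemma tower_alg_out n r (x : PA n) d :
  x \in tower_alg zF n r -> d \notin tower n r -> x d = 0.
Proof.
move=> + dr; move: x; apply: tower_ind => [|l x y Ex Ey|d' d'r].
- by rewrite ffunE.
- by rewrite !ffunE Ex Ey addr0; apply: mulr0.
by rewrite dbasisE; case: eqP => // Ed; rewrite Ed d'r in dr.
Qed.

Lemma cut_inj n p x : (p < n)%N -> x \in tower_alg zF n (2 * p) ->
  x * ecut zF n p = 0 -> x = 0.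
Proof.
move=> pn xr; rewrite ecutE => E; apply/ffunP => d; rewrite [RHS]ffunE.
have [dr|/(tower_alg_out xr) //] := boolP (d \in tower n (2 * p)).
have := congr1 (fun y : PA n => y (compose d (cutd n p)) : Qz) E.
rewrite {1}[x]partalg_expand mulr_suml sum_ffunE [RHS]ffunE.
rewrite (bigD1 d) //= big1 ?addr0; last first.
  move=> d' d'd; rewrite -scalerAl dbasisM !ffunE dbasisE.
  case: eqP => [Ed|_]; last by rewrite !scaler0.
  have [d'r|/(tower_alg_out xr) ->] := boolP (d' \in tower n (2 * p)); last by rewrite scale0r.
  by rewrite (compose_cutd_inj pn dr d'r Ed) eqxx in d'd.
rewrite -scalerAl dbasisM !ffunE dbasisE eqxx => E'.
have {E'} : (x d : Qz) * (zF ^+ loops d (cutd n p) * 1) = 0 by exact: E'.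
by rewrite mulr1 => /eqP; rewrite mulf_eq0 expf_eq0 (negbTE zF_neq0) andbF orbF => /eqP.
Qed.

(** The next generator [ecut p.+1] restores what [ejoin p] forgets. *)
Lemma join_inj n p x : (p.+1 < n)%N -> x \in tower_alg zF n (2 * p + 2) ->
  x * ejoin zF n p = 0 -> x = 0.
Proof.
move=> pn xr E.
have xc : x * ecut zF n p.+1 = ecut zF n p.+1 * x by apply: comm_ecut xr _ _ => //; lia.
apply: (cut_inj pn); first by apply: tower_alg_le xr; lia.
by rewrite -(ecut_ejoin_ecut pn) !mulrA xc -[_ * x * _]mulrA E mulr0 mul0r.
Qed.

(** * The central series *)

Section Central.
Variable n : nat.
Local Notation TA := (tower_alg zF n).

Lemma x_oddE p : x_ n (2 * p + 1) = - (zF / 2)%:A + jodd zF n p.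
Proof.
rewrite /x_ /JM (_ : odd _ = true); last by lia.
by rewrite (_ : (2 * p + 1)./2 = p) //; lia.
Qed.

Lemma x_evenE p : x_ n (2 * p + 2) = - (zF / 2)%:A + jeven zF n p.
Proof.
rewrite /x_ /JM (_ : odd _ = false); last by lia.
by rewrite (_ : (2 * p + 2)./2.-1 = p) //; lia.
Qed.

Lemma mem_scalar (l : Qz) r : l%:A \in TA r.
Proof. by rewrite memvZ // tower_alg1. Qed.

Lemma xpow_odd p j : (p < n)%N ->
  xpow n (2 * p + 1) j \in TA (2 * p) /\
  xpow n (2 * p + 1) j * ecut zF n p = ecut zF n p * x_ n (2 * p + 1) ^+ j * ecut zF n p.
Proof.
move=> pn; rewrite /xpow.
have xr : x_ n (2 * p + 1) ^+ j \in TA (2 * p + 2).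
  by rewrite tower_algX // x_oddE memvD ?memvN ?mem_scalar ?mem_jodd.
have [y yr Ey] := cut_compress pn xr.
rewrite -[(2 * p + 1).-1]/((2 * p + 1).-1) (_ : (2 * p + 1).-1 = 2 * p)%N; last by lia.
set Q := (X in classical_sets.xget 0 X).
exact: (@classical_sets.xgetPex _ 0 Q (ex_intro _ y (conj yr Ey))).
Qed.

Lemma xpow_even p j : (p.+1 < n)%N ->
  xpow n (2 * p + 2) j \in TA (2 * p + 1) /\
  xpow n (2 * p + 2) j * ejoin zF n p = ejoin zF n p * x_ n (2 * p + 2) ^+ j * ejoin zF n p.
Proof.
move=> pn; rewrite /xpow.
have xr : x_ n (2 * p + 2) ^+ j \in TA (2 * p + 2).
  by rewrite tower_algX // x_evenE memvD ?memvN ?mem_scalar ?mem_jeven.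
have [y yr Ey] := join_compress pn xr.
have -> : ejoin zF n p = e_ zF n (2 * p + 2) by rewrite /ejoin; congr e_; lia.
rewrite /ejoin (_ : 2 * p.+1 = 2 * p + 2)%N in Ey; last by lia.
rewrite (_ : (2 * p + 2).-1 = 2 * p + 1)%N; last by lia.
set Q := (X in classical_sets.xget 0 X).
exact: (@classical_sets.xgetPex _ 0 Q (ex_intro _ y (conj yr Ey))).
Qed.

Lemma xpow_even0 p : (p.+1 < n)%N -> xpow n (2 * p + 2) 0 = 1.
Proof.
move=> pn; have [yr Ey] := xpow_even 0 pn.
apply/eqP; rewrite -subr_eq0; apply/eqP/(join_inj pn).
  by rewrite memvB ?tower_alg1 //; apply: tower_alg_le yr; lia.
by rewrite mulrBl Ey expr0 mulr1 mul1r ejoin_idem // subrr.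
Qed.

Lemma W_oddE p k : W n (2 * p + 1) k = if k is Posz j.+1 then xpow n (2 * p + 1) j else 0.
Proof.
rewrite /W (_ : odd _ = true); last by lia.
rewrite lvarV [LHS]lmonomMl mul1r /=; case: k => [[|j]|j] //=.
by rewrite subn1.
Qed.

Lemma W_evenE p k : W n (2 * p + 2) k = if k is Posz j then xpow n (2 * p + 2) j else 0.
Proof. by rewrite /W (_ : odd _ = false) //; lia. Qed.

End Central.

(** * Series with coefficients in the tower *)

Section Coefficients.
Variables (n : nat).
Local Notation TA := (tower_alg zF n).
Implicit Types (F G : laurent (PA n)) (a : PA n).

Definition coefs_in r F := forall k, F k \in TA r.

Lemma coefs_inD r F G : coefs_in r F -> coefs_in r G -> coefs_in r (F + G).
Proof. by move=> HF HG k; apply: memvD. Qed.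
Lemma coefs_inN r F : coefs_in r F -> coefs_in r (- F).
Proof. by move=> HF k; rewrite -[(- F) k]/(- F k) memvN. Qed.
Lemma coefs_in_monom r d a : a \in TA r -> coefs_in r (lmonom d a).
Proof. by move=> ar k /=; case: ifP; rewrite ?mem0v. Qed.
Lemma coefs_inM r F G : coefs_in r F -> coefs_in r G -> coefs_in r (F * G).
Proof.
move=> HF HG k; have [a Fa] := lbound F; have [b Gb] := lbound G.
have [kab|/split_ge[m ->]] := ltP k (a + b).
  by rewrite (lmul_order Fa Gb) // mem0v.
rewrite -[(F * G) _]/(lmul_coef F G _) (lmul_coefE m Fa Gb).
by apply: memv_suml => i _; apply: tower_algM.
Qed.
Lemma coefs_in_le r r' F : (r <= r')%N -> coefs_in r F -> coefs_in r' F.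
Proof. by move=> rr' HF k; apply: tower_alg_le rr' _. Qed.
Lemma coefs_in_lres r a : a \in TA r -> coefs_in r (lres a).
Proof. by move=> ar k; rewrite lresE; case: k => [[|j]|j]; rewrite ?mem0v ?tower_algX. Qed.

Lemma lcomm F a : (forall k, F k * a = a * F k) -> F * lconst a = lconst a * F.
Proof. by move=> H; apply: laurentP => k; rewrite lconstMl lconstMr. Qed.

Lemma coefs_comm r F a : coefs_in r F -> (forall y, y \in TA r -> y * a = a * y) ->
  F * lconst a = lconst a * F.
Proof. by move=> HF H; apply: lcomm => k; apply: H. Qed.

Lemma coefs_W_odd p : (p < n)%N -> coefs_in (2 * p) (W n (2 * p + 1)).
Proof.
move=> pn k; rewrite W_oddE; case: k => [[|j]|j]; rewrite ?mem0v //.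
by case: (xpow_odd j pn).
Qed.

Lemma coefs_W_even p : (p.+1 < n)%N -> coefs_in (2 * p + 1) (W n (2 * p + 2)).
Proof.
move=> pn k; rewrite W_evenE; case: k => j; rewrite ?mem0v //.
by case: (xpow_even j pn).
Qed.

Lemma W_odd_ecut p : (p < n)%N -> W n (2 * p + 1) * lconst (ecut zF n p) =
  lconst (ecut zF n p) * (lvar - lconst (x_ n (2 * p + 1)))^-1 * lconst (ecut zF n p).
Proof.
move=> pn; rewrite (linvP (lresMr _) (lresMl _)); apply: laurentP => k.
rewrite !lconstMr lconstMl W_oddE lresE; case: k => [[|j]|j]; rewrite ?mulr0 ?mul0r //.
by case: (xpow_odd j pn).
Qed.

Lemma W_even_ejoin p : (p.+1 < n)%N -> W n (2 * p + 2) * lconst (ejoin zF n p) =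
  lvar * (lconst (ejoin zF n p) * (lvar - lconst (x_ n (2 * p + 2)))^-1 * lconst (ejoin zF n p)).
Proof.
move=> pn; rewrite (linvP (lresMr _) (lresMl _)); apply: laurentP => k.
rewrite lvarMl !lconstMr lconstMl W_evenE lresE.
case: k => [j|[|j]] /=; rewrite ?mulr0 ?mul0r //.
by rewrite addn1; case: (xpow_even j pn).
Qed.

Lemma subvar_unit a : lvar - lconst a \is a GRing.unit.
Proof. exact: lunitP (lresMr a) (lresMl a). Qed.

Lemma subvar_sqr_unit a : (lvar - lconst a) ^+ 2 - 1 \is a GRing.unit.
Proof.
rewrite subr_sqr_1; have -> : lvar - lconst a - 1 = lvar - lconst (a + 1).
  by rewrite lconstD lconst1 opprD addrA.
have -> : lvar - lconst a + 1 = lvar - lconst (a - 1).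
  by rewrite lconstD lconstN lconst1 opprB addrCA addrC.
by rewrite unitrMl subvar_unit.
Qed.

Lemma W_odd_unit p a : (p < n)%N -> W n (2 * p + 1) + (lconst a - lvar - 1) \is a GRing.unit.
Proof.
move=> pn; rewrite -unitrN; apply: (@lead1_unit _ _ (-1)).
  move=> k k1; rewrite -[LHS]/(- (W n (2 * p + 1) k + (lconst a k - lvar k - (1 : laurent _) k))).
  rewrite W_oddE; case: k k1 => // j k1.
  by rewrite /= !ifF ?subr0 ?addr0 ?oppr0 //; apply/negbTE; move: k1; rewrite NegzE; lia.
rewrite -[LHS]/(- (W n (2 * p + 1) (-1) + (lconst a (-1) - lvar (-1) - (1 : laurent _) (-1)))).
by rewrite W_oddE /= subr0 add0r sub0r opprK.
Qed.

Lemma W_even_unit p : (p.+1 < n)%N -> W n (2 * p + 2) \is a GRing.unit.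
Proof.
move=> pn; apply: (@lead1_unit _ _ 0) => [k|]; last by rewrite W_evenE /= xpow_even0.
by rewrite W_evenE; case: k.
Qed.

End Coefficients.

(** The two sides of the recursions carry their denominators on opposite sides;
    one commutation is enough to collect them. *)
Lemma quotient_formula (A : unitRingType) (D D0 P R : A) :
  D0 \is a GRing.unit -> P \is a GRing.unit -> R \is a GRing.unit ->
  R ^+ 2 - 1 \is a GRing.unit -> D0 * R = R * D0 ->
  D * (1 - R^-1 * R^-1) = (1 - P^-1 * P^-1) * D0 ->
  D / D0 = (P ^+ 2 - 1) / P ^+ 2 * (R ^+ 2 / (R ^+ 2 - 1)).
Proof.
move=> UD UP UR UR1 DR E; set q := 1 - R^-1 * R^-1.
have R2 : R ^+ 2 - 1 = q * R ^+ 2.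
  by rewrite /q mulrBl mul1r expr2 -mulrA [R^-1 * (R * R)]mulrA mulVr // mul1r mulVr.
have UR2 : R ^+ 2 \is a GRing.unit by rewrite unitrX.
have Uq : q \is a GRing.unit.
  have -> : q = (R ^+ 2 - 1) * (R ^+ 2)^-1 by rewrite R2 mulrK.
  by rewrite unitrMl ?unitrV.
have DR' : GRing.comm D0 R^-1 by apply: commrV.
have Dq : GRing.comm D0 q^-1 by apply: commrV; apply: commrB; [apply: commr1|apply: commrM].
have P2 : (P ^+ 2 - 1) / P ^+ 2 = 1 - P^-1 * P^-1.
  by rewrite mulrBl divrr ?unitrX // mul1r expr2 invrM.
rewrite P2 R2 invrM // [R ^+ 2 * _]mulrA divrr // mul1r.
have -> : D = (1 - P^-1 * P^-1) * D0 * q^-1 by rewrite -E mulrK.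
by rewrite -!mulrA [D0 * _]mulrA Dq -!mulrA divrr // mulr1.
Qed.

(** * The two recursions for the central series *)

Section Recursions.
Variables (n p : nat).
Hypothesis pn : (p.+2 < n)%N.
Local Notation L := (@lconst (PA n)).
Local Notation x m := (L (x_ n m)).
Local Notation u := (@lvar (PA n)).
Local Notation z2 := (L (zF / 2)%:A).
Local Notation X := (jeven zF n p).
Local Notation Y := (jcod zF n p).
Local Notation X' := (jeven zF n p.+1).
Local Notation Y' := (jcod zF n p.+1).
Local Notation e := (ejoin zF n p).
Local Notation f := (ecut zF n p.+1).
Local Notation g := (ecut zF n p).
Local Notation h := (ejoin zF n p.+1).
Local Notation s := (transp zF n p).
Local Notation s' := (transp zF n p.+1).
Local Notation sg := (sige zF n p).
Local Notation t := (sigo zF n p).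
Let pn1 : (p.+1 < n)%N := ltnW pn.
Let pn0 : (p < n)%N := ltnW pn1.

Lemma z_half : zF%:A = (zF / 2)%:A + (zF / 2)%:A :> PA n.
Proof.
have two0 : 2 != 0 :> Qz.
  rewrite -(rmorph_nat (@FracField.tofrac {poly rat})) tofrac_eq0 -polyC_natr polyC_eq0.
  by rewrite pnatr_eq0.
rewrite -scalerDl; congr (_ *: _).
by rewrite -(mulr2n (zF / 2)) -(mulr_natr (zF / 2) 2) divfK.
Qed.

Lemma scalar_central (l : Qz) (F : laurent (PA n)) : L l%:A * F = F * L l%:A.
Proof. by apply/esym/lcomm => k; rewrite mulr_algr mulr_algl. Qed.

Lemma x_even_add q : u + x (2 * q + 2)%N = (u - z2) + L (jeven zF n q).
Proof. by rewrite x_evenE lconstD lconstN addrA. Qed.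

Lemma x_even_sub q : u - x (2 * q + 2)%N = (u + z2) - L (jeven zF n q).
Proof. by rewrite x_evenE lconstD lconstN opprD opprK addrA. Qed.

Lemma x_oddN q : x_ n (2 * q + 1) = (zF / 2)%:A - jcod zF n q.
Proof. by rewrite x_oddE jcod.unlock z_half opprB addrCA opprD addNKr addrC. Qed.

Lemma x_odd_add q : u + x (2 * q + 1)%N = (u + z2) - L (jcod zF n q).
Proof. by rewrite x_oddN lconstD lconstN addrA. Qed.

Lemma x_odd_sub q : u - x (2 * q + 1)%N = (u - z2) + L (jcod zF n q).
Proof. by rewrite x_oddN lconstD lconstN opprD opprK addrA. Qed.

Lemma addvar_unit a : u + L a \is a GRing.unit.
Proof. by rewrite -[L a]opprK -lconstN subvar_unit. Qed.

Lemma jcodS : Y' = s * Y * s + X * e + e * X - Y * e - sg.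
Proof.
have E : s * (zF%:A - jodd zF n p) * s = zF%:A - s * jodd zF n p * s.
  by rewrite mulrBr mulrBl mulr_algr -scalerAl transpK.
by rewrite !jcod.unlock E joddS; ncring.
Qed.

Lemma sigo_sige : t * sg = s /\ sg * t = s /\ t * s = sg /\ s * t = sg.
Proof.
have ts : t * s = sg by rewrite -sig_transp // -mulrA transpK // mulr1.
have st : s * t = sg by rewrite -transp_sig // mulrA transpK // mul1r.
split; first by rewrite -transp_sig // -mulrA sigK // mulr1.
by split=> //; rewrite -sig_transp // mulrA sigK // mul1r.
Qed.

Lemma sigoK : t * t = 1.
Proof.
have [_ [_ [ts _]]] := sigo_sige.
by rewrite -{2}transp_sig // mulrA ts sigK.
Qed.

Lemma ejoin_sigo : e * t = e.
Proof. by rewrite -sig_transp // mulrA ejoin_sig // ejoin_transp. Qed.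

Lemma sigo_ejoin_e : t * e = e.
Proof. by rewrite -sig_transp // -mulrA transp_ejoin // sig_ejoin. Qed.

Lemma ecutS : f * s = s * g.
Proof. by rewrite -(transp_ecut pn1) -mulrA transpK // mulr1. Qed.

Lemma transp_ecutS : s * f = g * s.
Proof. by rewrite -(transp_ecut pn1) -mulrA mulrA transpK // mul1r. Qed.

Lemma ejoin_ecut_sigo : e * f * t = e * X.
Proof.
rewrite -transp_sig // mulrA -[e * f * s]mulrA ecutS mulrA ejoin_transp //.
by rewrite ejoin_jeven.
Qed.

Lemma sigo_ecut_ejoin : t * f * e = X * e.
Proof.
rewrite -sig_transp // -[sg * s * f]mulrA transp_ecutS mulrA -mulrA transp_ejoin //.
by rewrite jeven_ejoin.
Qed.

Lemma sigo_jeven_ejoin : t * X * e = f * e.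
Proof. by rewrite -mulrA -sigo_ecut_ejoin !mulrA sigoK mul1r. Qed.

Lemma ejoin_jeven_sigo : e * X * t = e * f.
Proof. by rewrite -ejoin_ecut_sigo -mulrA sigoK mulr1. Qed.

(** Conjugating by sigma_{2p+3} instead of the transposition absorbs the mixed
    terms of the recursion for L_{2p+4}. *)
Lemma jevenS_sigo : X' = t * X * t + t - e * f - f * e + e * X * f * e.
Proof.
have E : t * X * t = s * X * s + f * e + e * f - s * X * e - e * X * s.
  transitivity (s * (sg * X * sg) * s).
    by rewrite -{1}transp_sig // -sig_transp // !mulrA.
  rewrite sig_jeven_sig //; transitivity (s * X * s + (s * g) * (e * s) + (s * e) * (g * s)
    - s * X * (e * s) - (s * e) * X * s); first by ncring.
  rewrite ejoin_transp // transp_ejoin // -ecutS -transp_ecutS -[f * s * e]mulrA transp_ejoin //.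
  by rewrite !mulrA ejoin_transp.
by rewrite jevenS E; ncring.
Qed.

Lemma jevenS_ejoin : X' * e = e * X * f * e.
Proof.
rewrite jevenS_sigo; transitivity (t * X * (t * e) + t * e - e * f * e - f * (e * e)
  + e * X * f * (e * e)); first by ncring.
rewrite sigo_ejoin_e ejoin_idem // sigo_jeven_ejoin ejoin_ecut_ejoinr //; ncring.
Qed.

Lemma sigo_jcodS_sigo : t * Y' * t = Y' + f * e + e * f - X * e - e * X.
Proof.
have [tsg [sgt [ts st]]] := sigo_sige.
rewrite jcodS; transitivity ((t * s) * Y * (s * t) + (t * X * e) * t + t * (e * X * t)
  - t * Y * (e * t) - (t * sg) * t); first by ncring.
rewrite ts st sigo_jeven_ejoin ejoin_jeven_sigo ejoin_sigo tsg st -transp_jcod //.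
rewrite -[t * Y * e]mulrA -ejoin_jcod // !mulrA sigo_ejoin_e.
rewrite -[f * e * t]mulrA ejoin_sigo; ncring.
Qed.

Lemma ejoinS_sigo : h * t = t * s' * e * s'.
Proof.
transitivity (t * (t * h) * t); first by rewrite mulrA sigoK mul1r.
by rewrite sigo_ejoin // -mulrA -[_ * t * t]mulrA sigoK mulr1 !mulrA.
Qed.

Ltac constant := rewrite -!(lconstM, lconstN, lconstD, lconst1); congr lconst.

Lemma central_w (l : Qz) (F : laurent (PA n)) : (u + L l%:A) * F = F * (u + L l%:A).
Proof. by rewrite mulrDl mulrDr lvarC scalar_central. Qed.

Lemma central_wN (l : Qz) (F : laurent (PA n)) : (u - L l%:A) * F = F * (u - L l%:A).
Proof. by rewrite mulrBl mulrBr lvarC scalar_central. Qed.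

Lemma first_recursion_ecut :
  let P := u + x (2 * p + 2)%N in let R := u - x (2 * p + 1)%N in
  (W n (2 * p.+1 + 1) - (u - z2) - 1) * (1 - R^-1 * R^-1) * L f =
  (1 - P^-1 * P^-1) * (W n (2 * p + 1) - (u - z2) - 1) * L f.
Proof.
move=> P R; have UP : P \is a GRing.unit by apply: addvar_unit.
have UR : R \is a GRing.unit by apply: subvar_unit.
have UR' := subvar_unit (x_ n (2 * p.+1 + 1)); rewrite x_odd_sub in UR'.
have tX : X \in tower_alg zF n (2 * p + 2) by rewrite mem_jeven.
have tY : Y \in tower_alg zF n (2 * p + 2) by rewrite mem_jcod.
have cW : forall a, (forall y, y \in tower_alg zF n (2 * p) -> y * a = a * y) ->
    W n (2 * p + 1) * L a = L a * W n (2 * p + 1).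
  by move=> a; apply: coefs_comm; apply: coefs_W_odd.
apply: (@first_recursion _ (u - z2) (L X) (L Y) (L Y') (L e) (L f) (L g) (L s) (L sg)
  _ _ P R ((u - z2) + L Y')^-1); rewrite ?mulVr ?mulrV //.
- exact: x_even_add.
- exact: x_odd_sub.
- by move=> F; apply: central_wN.
- by constant; apply: jcodS.
- by constant; apply: sigK.
- by constant; apply: ejoin_sig.
- by constant; apply: sig_ejoin.
- by constant; apply: ejoin_idem.
- by constant; apply: transp_ejoin.
- by constant; apply: transpK.
- by constant; apply: transp_jcod.
- by constant; apply: jeven_ejoin.
- by constant; apply: ejoin_jeven.
- by constant; apply: ecut_jeven.
- by constant; apply: sig_jeven_sig.
- by constant; apply: ecut_sig_ecut.
- by constant; apply: ecut_ejoin_ecut.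
- by constant; apply: ejoin_ecut_ejoin.
- by constant; apply: ecut_comm.
- by constant; apply: transp_ecut.
- by constant; apply: ejoin_jcod.
- by constant; apply: comm_ecut tX _ _ => //; lia.
- by constant; apply: comm_ecut tY _ _ => //; lia.
- by constant; apply: jeven_jcod.
- by constant; apply: comm_jcod tX _ _ => //; lia.
- by constant; apply: comm_jcod tY _ _ => //; lia.
- exact: W_odd_ecut.
- by apply: cW => y yr; apply: comm_transp yr _ _.
- by apply: cW => y yr; apply: comm_jeven yr _ _ => //; lia.
- by apply: cW => y yr; apply: comm_ejoin yr _ _ => //; lia.
- by apply: cW => y yr; apply: comm_ecut yr _ _ => //; lia.
by rewrite -x_odd_sub; apply: W_odd_ecut.
Qed.

Lemma lvarV_comm (F : laurent (PA n)) : u^-1 * F = F * u^-1.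
Proof. by apply/esym/commrV; rewrite /GRing.comm lvarC. Qed.

Lemma second_recursion_ejoin :
  let P := u - x (2 * p + 2)%N in let R := u + x (2 * p.+1 + 1)%N in
  W n (2 * p.+1 + 2) * (1 - P^-1 * P^-1) * L h = (1 - R^-1 * R^-1) * W n (2 * p + 2) * L h.
Proof.
move=> P R; have UP : P \is a GRing.unit by apply: subvar_unit.
have UR : R \is a GRing.unit by apply: addvar_unit.
have UP' := subvar_unit (x_ n (2 * p.+1 + 2)); rewrite x_even_sub in UP'.
have Uu := lvar_unit (PA n).
have tX : X \in tower_alg zF n (2 * p + 2) by rewrite mem_jeven.
have cW : forall a, (forall y, y \in tower_alg zF n (2 * p + 1) -> y * a = a * y) ->
    u^-1 * W n (2 * p + 2) * L a = L a * (u^-1 * W n (2 * p + 2)).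
  move=> a Ha; rewrite -mulrA (coefs_comm (coefs_W_even pn1) Ha).
  by rewrite mulrA lvarV_comm mulrA.
suff E : (u^-1 * W n (2 * p.+1 + 2)) * (1 - P^-1 * P^-1) * L h =
    (1 - R^-1 * R^-1) * (u^-1 * W n (2 * p + 2)) * L h.
  apply: (@mulrI _ u^-1); first by rewrite unitrV.
  by rewrite !mulrA E !mulrA lvarV_comm.
apply: (@second_recursion _ (u + z2) (L X) (L Y') (L X') (L e) (L f) (L h) (L s') (L t)
  _ _ P R ((u + z2) - L X')^-1); rewrite ?mulVr ?mulrV //.
- exact: x_even_sub.
- exact: x_odd_add.
- by move=> F; apply: central_w.
- by constant; apply: jevenS_sigo.
- by constant; apply: sigoK.
- by constant; apply: ejoin_sigo.
- by constant; apply: ejoin_idem.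
- by constant; apply: ejoin_ecut_sigo.
- by constant; apply: jevenS_ejoin.
- by constant; apply: sigo_jcodS_sigo.
- by constant; apply: jeven_ecut.
- by constant; apply: ejoin_jcodS.
- by constant; apply: jcodS_ejoin.
- by constant; apply: ejoin_ecut_ejoinr.
- by constant; apply: ecut_ejoin_ecut.
- by constant; apply/esym/ejoin_comm.
- by constant; apply: ejoin_idem.
- by constant; apply: ejoin_sigo_ejoin.
- by constant; apply: ejoin_ecut_ejoin.
- by constant; apply/esym; apply: comm_ejoin tX _ _ => //; lia.
- by constant; apply: ejoin_jcod.
- by constant; apply/esym; apply: comm_ecut tX _ _ => //; lia.
- by constant; apply: comm_jcod tX _ _ => //; lia.
- by constant; apply/esym; apply: jeven_jcod.
- by constant; apply: comm_jeven tX _ _ => //; lia.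
- by constant; apply: sigo_ejoin.
- by constant; apply: ejoinS_sigo.
- by constant; apply: transpK.
- by constant; apply/esym; apply: comm_transp tX _ _ => //; lia.
- by apply: cW => y yr; apply: comm_transp yr _ _ => //; lia.
- by apply: cW => y yr; apply: comm_sigo yr _ _ => //; lia.
- by apply: cW => y yr; apply: comm_jeven yr _ _ => //; lia.
- by apply: cW => y yr; apply: comm_jcod yr _ _ => //; lia.
- by apply: cW => y yr; apply: comm_ecut yr _ _ => //; lia.
- by apply: cW => y yr; apply: comm_ejoin yr _ _ => //; lia.
- by rewrite -[LHS]mulrA W_even_ejoin // mulKr.
by rewrite -x_even_sub -[LHS]mulrA W_even_ejoin // mulKr.
Qed.

Lemma coefs_cancel r (c : PA n) (F G : laurent (PA n)) :
  (forall y, y \in tower_alg zF n r -> y * c = 0 -> y = 0) ->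
  coefs_in r F -> coefs_in r G -> F * L c = G * L c -> F = G.
Proof.
move=> inj HF HG E; apply: laurentP => k; apply/eqP; rewrite -subr_eq0; apply/eqP/inj.
  by rewrite memvB.
by rewrite mulrBl -!lconstMr E subrr.
Qed.

Lemma coefs_in_subvarV r a : a \in tower_alg zF n r -> coefs_in r (u - L a)^-1.
Proof. by move=> ar; rewrite (linvP (lresMr _) (lresMl _)); apply: coefs_in_lres. Qed.

Lemma coefs_in_addvarV r a : a \in tower_alg zF n r -> coefs_in r (u + L a)^-1.
Proof. by move=> ar; rewrite -[L a]opprK -lconstN; apply: coefs_in_subvarV; rewrite memvN. Qed.

Lemma coefs_in1 r : coefs_in r (1 : laurent (PA n)).
Proof. exact: (coefs_in_monom _ (tower_alg1 _ _ _)). Qed.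

Lemma mem_x_odd q r : (2 * q + 2 <= r)%N -> x_ n (2 * q + 1) \in tower_alg zF n r.
Proof. by move=> qr; rewrite x_oddN memvB ?mem_jcod ?mem_scalar. Qed.

Lemma mem_x_even q r : (2 * q + 2 <= r)%N -> x_ n (2 * q + 2) \in tower_alg zF n r.
Proof. by move=> qr; rewrite x_evenE memvD ?memvN ?mem_jeven ?mem_scalar. Qed.

(** Both sides of the recursions have coefficients in the algebra on which
    multiplication by the generator at their right is injective. *)
Lemma first_recursion_W :
  let P := u + x (2 * p + 2)%N in let R := u - x (2 * p + 1)%N in
  let c := z2 - u - 1 in
  (W n (2 * p.+1 + 1) + c) * (1 - R^-1 * R^-1) =
  (1 - P^-1 * P^-1) * (W n (2 * p + 1) + c).
Proof.
move=> P R c; have cE F : F + c = F - (u - z2) - 1 by rewrite /c opprB addrA.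
have cR : coefs_in (2 * p + 2) R^-1 by apply/coefs_in_subvarV/mem_x_odd.
have cP : coefs_in (2 * p + 2) P^-1 by apply/coefs_in_addvarV/mem_x_even.
have cc : coefs_in (2 * p + 2) c.
  by rewrite /c; repeat apply: coefs_inD; repeat apply: coefs_inN;
    apply: coefs_in_monom; rewrite ?mem_scalar ?tower_alg1.
have one_sub (F : laurent (PA n)) : coefs_in (2 * p + 2) F -> coefs_in (2 * p + 2) (1 - F * F).
  by move=> cF; apply: coefs_inD; [exact: coefs_in1|exact/coefs_inN/coefs_inM].
apply: (coefs_cancel (r := 2 * p + 2) (c := f)).
- by move=> y yr; apply: (cut_inj pn1); apply: tower_alg_le yr; lia.
- apply: coefs_inM; last exact: one_sub.
  by apply: coefs_inD cc; apply: coefs_in_le (coefs_W_odd pn1); lia.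
- apply: coefs_inM; first exact: one_sub.
  by apply: coefs_inD cc; apply: coefs_in_le (coefs_W_odd pn0); lia.
by rewrite !cE; apply: first_recursion_ecut.
Qed.

Lemma second_recursion_W :
  let P := u - x (2 * p + 2)%N in let R := u + x (2 * p.+1 + 1)%N in
  W n (2 * p.+1 + 2) * (1 - P^-1 * P^-1) = (1 - R^-1 * R^-1) * W n (2 * p + 2).
Proof.
move=> P R.
have cR : coefs_in (2 * p.+1 + 2) R^-1 by apply/coefs_in_addvarV/mem_x_odd.
have cP : coefs_in (2 * p.+1 + 2) P^-1 by apply/coefs_in_subvarV/mem_x_even; lia.
have one_sub (F : laurent (PA n)) : coefs_in (2 * p.+1 + 2) F -> coefs_in (2 * p.+1 + 2) (1 - F * F).
  by move=> cF; apply: coefs_inD; [exact: coefs_in1|exact/coefs_inN/coefs_inM].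
apply: (coefs_cancel (r := 2 * p.+1 + 2) (c := h)).
- by move=> y yr; apply: (join_inj pn).
- apply: coefs_inM; last exact: one_sub.
  by apply: coefs_in_le (coefs_W_even pn); lia.
- apply: coefs_inM; first exact: one_sub.
  by apply: coefs_in_le (coefs_W_even pn1); lia.
exact: second_recursion_ejoin.
Qed.

Lemma W_odd_comm (c := z2 - u - 1) (R := u - x (2 * p + 1)%N) :
  (W n (2 * p + 1) + c) * R = R * (W n (2 * p + 1) + c).
Proof.
have cC F : c * F = F * c.
  by rewrite /c !mulrBl !mulrBr scalar_central lvarC mul1r mulr1.
rewrite [LHS]mulrDl [RHS]mulrDr cC; congr (_ + _).
rewrite /R mulrBr mulrBl lvarC; congr (_ - _).
apply: coefs_comm (coefs_W_odd pn0) _ => y yr.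
rewrite x_oddN mulrBl mulrBr mulr_algl mulr_algr; congr (_ - _).
exact: comm_jcod yr _ _.
Qed.

Lemma W_even_comm (P := u - x (2 * p + 2)%N) : W n (2 * p + 2) * P = P * W n (2 * p + 2).
Proof.
rewrite /P mulrBr mulrBl lvarC; congr (_ - _).
apply: coefs_comm (coefs_W_even pn1) _ => y yr.
rewrite x_evenE mulrDl mulrDr mulNr mulrN mulr_algl mulr_algr; congr (_ + _).
exact: comm_jeven yr _ _.
Qed.

End Recursions.

Theorem proposition6p1 (n i : nat) (i_gt0 : (0 < i)%N) (i_lt_n : (i.+1 < n)%N) :
  let u : laurent (PA n) := lvar in
  let x m : laurent (PA n) := lconst (x_ n m) in
  let c : laurent (PA n) := lconst (zF / 2)%:A - u - 1 in
  (W n (2 * i + 1) + c) / (W n (2 * i - 1) + c)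
    = ((u + x (2 * i)%N) ^+ 2 - 1) / (u + x (2 * i)%N) ^+ 2
      * ((u - x (2 * i - 1)%N) ^+ 2 / ((u - x (2 * i - 1)%N) ^+ 2 - 1))
  /\
  W n (2 * i + 2) / W n (2 * i)
    = ((u + x (2 * i + 1)%N) ^+ 2 - 1) / (u + x (2 * i + 1)%N) ^+ 2
      * ((u - x (2 * i)%N) ^+ 2 / ((u - x (2 * i)%N) ^+ 2 - 1)).
Proof.
case: i i_gt0 i_lt_n => // p _ pn u x c.
have pn1 : (p.+1 < n)%N := ltnW pn; have pn0 : (p < n)%N := ltnW pn1.
have -> : (2 * p.+1 - 1 = 2 * p + 1)%N by lia.
have E : (2 * p.+1 = 2 * p + 2)%N by lia.
split; rewrite /x E.
- apply: quotient_formula; rewrite ?subvar_unit ?addvar_unit ?subvar_sqr_unit //.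
  + exact: W_odd_unit.
  + exact: W_odd_comm.
  by rewrite -E; have := first_recursion_W pn; rewrite -E.
- apply: quotient_formula; rewrite ?subvar_unit ?addvar_unit ?subvar_sqr_unit //.
  + exact: W_even_unit.
  + exact: W_even_comm.
  by rewrite -E; have := second_recursion_W pn; rewrite -E.
Qed.
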